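(* Let $0<q<1$ and let $\beta=(a,b,c,d,t)\in\mathbb{R}^5$ satisfy the conditions $$(\ast)\qquad t<0,\quad 0<b,c\leq a<d/q,\quad bd,cd\geq q,\quad ab,ac<1.$$ Let $k=k(\beta)\in\mathbb{Z}$ be the unique integer such that $1<|dtq^k|\leq q^{-1}$. The subspace $$V_{cl}\oplus V_{str}\subset L^2_+(m)$$ is dense if and only if $|\tilde{a}tq^k|\geq 1$, where $\tilde a=\sqrt{q^{-1}abcd}$. Furthermore, the (non-empty) set of parameters $\beta$ satisfying $(\ast)$ and $|\tilde{a}tq^{k(\beta)}|\geq 1$ is invariant under the duality involution $\sigma:\beta\mapsto\beta_\sigma$.
   Context: Notation. $\mathbb{Z}_+=\{0,1,2,\dots\}$; $\mathbb{T}$ is the positively oriented unit circle; $(x;q)_\infty=\prod_{i\ge0}(1-xq^i)$, $(x_1,\dots,x_r;q)_\infty=\prod_i(x_i;q)_\infty$; $\theta(x)=(x,q/x;q)_\infty$, $\theta(x_1,\dots,x_r)=\prod_i\theta(x_i)$. Duality involution: $\beta_\sigma=(\tilde a,\tilde b,\tilde c,\tilde d,\tilde t)$ with $\tilde a=\sqrt{q^{-1}abcd}$ (positive root), $\tilde b=ab/\tilde a$, $\tilde c=ac/\tilde a$, $\tilde d=ad/\tilde a$, $\tilde t=1/(adt)$. It is known that $\beta\mapsto\beta_\sigma$ is an involution on the set of $\beta$ satisfying $(\ast)$. Measure: $\Theta(x)=\frac{\theta(dx,d/x)}{\theta(dtx,dt/x)}$, $\Delta(x)=\frac{(x^2,1/x^2;q)_\infty}{(ax,a/x,bx,b/x,cx,c/x,dx,d/x;q)_\infty}$,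 $W(x)=\Delta(x)\Theta(x)$. For generic $\beta$ satisfying $(\ast)$ (so that $W$ has simple poles) the measure $m=m(\cdot;\beta;q)$ is $$\int f(x)\,dm(x)=\frac{1}{4\pi i}\int_{\mathbb{T}}f(x)W(x)\frac{dx}{x}+\frac12\sum_{x\in D}\bigl(f(x)+f(x^{-1})\bigr)\underset{y=x}{\mathrm{Res}}\left(\frac{W(y)}{y}\right),$$ $D=D_+\cup D_-$, $D_+=\{aq^j:j\in\mathbb{Z}_+,\ aq^j>1\}$, $D_-=\{dtq^j:j\in\mathbb{Z},\ dtq^j<-1\}$. The discrete weights depend continuously on $\beta$, and $m$ is defined for all $\beta$ satisfying $(\ast)$ by continuous extension; it is a positive measure. $L^2_+(m)$ is the Hilbert space of $L^2$-functions $f$ for $m$ with $f(x)=f(x^{-1})$ $m$-a.e. Subspaces: $\mathcal{A}=\mathbb{C}[x+x^{-1}]$ is the space of inversion-invariant Laurent polynomials; $G(x)=(dx,d/x;q)_\infty^{-1}$ and $G^\tau(x)=(qx/d,q/dx;q)_\infty^{-1}$ (i.e. $G$ with $d$ replaced by $q/d$). The subspaces $V_{cl},V_{str}\subset L^2_+(m)$ are $V_{cl}=\mathcal{A}\,G^{-1}\Theta^{-1}$ and $V_{str}=\mathcal{A}\,G^\tau$; one has $V_{cl}\cap V_{str}=\{0\}$ (the sum is not orthogonal). *)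

(* Defs.v *)
From HB Require Import structures.
From mathcomp Require Import all_boot all_order all_algebra.
From mathcomp Require Import all_classical all_reals all_analysis.
From mathcomp Require Import measurable_realfun complex.

Set Implicit Arguments.
Unset Strict Implicit.
Unset Printing Implicit Defensive.

Import Order.TTheory GRing.Theory Num.Theory.
Import numFieldNormedType.Exports.

Local Open Scope classical_set_scope.
Local Open Scope ring_scope.
Local Open Scope complex_scope.

(* R[i] with the topology of its norm and the corresponding Borel sets. *)
HB.instance Definition _ (R : realType) :=
  PseudoPointedMetric.copy R[i] (R[i] : numFieldType).
HB.instance Definition _ (R : realType) :=
  NormedModule.copy R[i] ((R[i] : numFieldType)^o).
HB.instance Definition _ (R : realType) :=
  Measurable.copy R[i] (g_sigma_algebraType (@open R[i])).

Section complex_analysis.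
Context {R : realType}.
Implicit Types (z : R[i]) (f : R[i] -> R[i]).

Definition cabs z : R := complex.Re `|z|.

Definition expi (th : R) : R[i] := cos th +i* sin th.

Definition cRintegral (D : set R) (g : R -> R[i]) : R[i] :=
  (\int[lebesgue_measure]_(x in D) complex.Re (g x)) +i*
  (\int[lebesgue_measure]_(x in D) complex.Im (g x)).

(* integral over the positively oriented circle |y - z| = r *)
Definition circle_integral f z (r : R) : R[i] :=
  cRintegral `[0, 2 * pi]
    (fun th => f (z + r%:C * expi th) * ('i%C * r%:C * expi th)).

Definition residue f z : R[i] :=
  lim ((2 * pi%:C * 'i%C)^-1 * circle_integral f z r @[r --> 0^'+]).

End complex_analysis.

Section q_functions.
Context {R : realType}.
Implicit Types (q : R) (x : R[i]).

Definition qpoch q x : R[i] := limn (fun n => \prod_(i < n) (1 - x * (q ^+ i)%:C)).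

Definition theta q x : R[i] := qpoch q x * qpoch q (q%:C / x).

End q_functions.

(* beta = (a, b, c, d, t) *)
Definition params (R : realType) : Type := (R * R * R * R * R)%type.

Section parameters.
Context {R : realType}.
Implicit Types (q : R) (beta : params R).

Definition admissible q beta : Prop :=
  let: (a, b, c, d, t) := beta in
  [/\ t < 0, [/\ 0 < b, 0 < c, b <= a & c <= a], a < d / q,
      q <= b * d /\ q <= c * d & a * b < 1 /\ a * c < 1].

Definition atilde q beta : R :=
  let: (a, b, c, d, t) := beta in Num.sqrt (q^-1 * (a * b * c * d)).

(* the duality involution sigma *)
Definition dual q beta : params R :=
  let: (a, b, c, d, t) := beta in
  let a' := atilde q beta in
  (a', a * b / a', a * c / a', a * d / a', (a * d * t)^-1).

(* The integer k with 1 < |d t q^k| <= 1/q; it exists and is unique, see kexpP. *)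
Definition kexp q beta : int :=
  let: (a, b, c, d, t) := beta in
  xget 0 [set k : int | 1 < `|d * t * q ^ k| <= q^-1].

Definition dual_bound q beta : Prop :=
  let: (a, b, c, d, t) := beta in
  1 <= `|atilde q beta * t * q ^ kexp q beta|.

End parameters.

Section weight.
Context {R : realType}.
Implicit Types (q : R) (beta : params R) (x : R[i]).

Definition bigTheta q beta x : R[i] :=
  let: (a, b, c, d, t) := beta in
  (theta q (d%:C * x) * theta q (d%:C / x)) /
  (theta q ((d * t)%:C * x) * theta q ((d * t)%:C / x)).

Definition bigDelta q beta x : R[i] :=
  let: (a, b, c, d, t) := beta in
  (qpoch q (x ^+ 2) * qpoch q (x ^- 2)) /
  (qpoch q (a%:C * x) * qpoch q (a%:C / x) *
   (qpoch q (b%:C * x) * qpoch q (b%:C / x)) *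
   (qpoch q (c%:C * x) * qpoch q (c%:C / x)) *
   (qpoch q (d%:C * x) * qpoch q (d%:C / x))).

Definition W q beta x : R[i] := bigDelta q beta x * bigTheta q beta x.

(* The factors (dx, d/x; q)_oo of Delta cancel against Theta, so these are the
   conditions under which the zeros of the denominator of W are simple (those
   of theta(dtx, dt/x) are negative, the others positive). *)
Definition generic q beta : Prop :=
  let: (a, b, c, d, t) := beta in
  admissible q beta /\
  forall (u : R) (n : int),
    u \in [:: a ^+ 2; b ^+ 2; c ^+ 2; a * b; a * c; b * c; a / b; a / c; b / c;
              (d * t) ^+ 2] ->
    u != q ^ n.

(* Residue of W(y)/y at a pole depending on beta, continuously extended from
   generic to admissible beta. The extension is needed: when a pole of W merges
   with its inverse (a^2 or (dt)^2 in q^Z), a zero of (x^2, 1/x^2; q)_oo keeps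
   the pole simple, but the residue there is not the limiting weight. *)
Definition ext_residue q (pole : params R -> R) beta : R[i] :=
  lim (residue (fun y => W q beta' y / y) (pole beta')%:C
         @[beta' --> within (generic q) (nbhs beta)]).

Definition pole_plus q (j : nat) beta : R :=
  let: (a, b, c, d, t) := beta in a * q ^+ j.

Definition pole_minus q (j : int) beta : R :=
  let: (a, b, c, d, t) := beta in d * t * q ^ j.

End weight.

Section facts.
Context {R : realType}.
Implicit Types (q : R) (z : R[i]).

Lemma cabsE z : cabs z = Num.sqrt (complex.Re z ^+ 2 + complex.Im z ^+ 2).
Proof. by rewrite /cabs normc_def. Qed.

Lemma cabs_ge0 z : 0 <= cabs z.
Proof. by rewrite cabsE sqrtr_ge0. Qed.

Lemma normc_cabs z : `|z| = (cabs z)%:C.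
Proof. by rewrite cabsE normc_def. Qed.

Lemma cabsR (r : R) : cabs r%:C = `|r|.
Proof. by rewrite cabsE/= expr0n/= addr0 sqrtr_sqr. Qed.

Lemma cabsN z : cabs (- z) = cabs z.
Proof. by rewrite /cabs normrN. Qed.

Lemma cabsM z1 z2 : cabs (z1 * z2) = cabs z1 * cabs z2.
Proof.
by apply/(@complexI R); rewrite rmorphM/= -!normc_cabs normrM.
Qed.

Lemma cabs_le z : cabs z <= `|complex.Re z| + `|complex.Im z|.
Proof.
rewrite cabsE -(ler_pXn2r (n:=2))// ?nnegrE ?sqrtr_ge0 ?addr_ge0//.
rewrite sqr_sqrtr ?addr_ge0 ?sqr_ge0// sqrrD !real_normK ?num_real//.
by rewrite addrAC lerDl mulrn_wge0// mulr_ge0.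
Qed.

Lemma cvg_complex (T : Type) (F : set_system T) {FF : Filter F} (u : T -> R[i])
    (l : R[i]) :
  complex.Re (u x) @[x --> F] --> complex.Re l ->
  complex.Im (u x) @[x --> F] --> complex.Im l ->
  u x @[x --> F] --> l.
Proof.
move=> /cvgrPdist_lt ul /cvgrPdist_lt vl; apply/cvgrPdist_lt => -[e e'] e0.
have [e1 e'0] : 0 < e /\ e' = 0.
  by move: e0; rewrite ltcE/= => /andP[/eqP ? ?].
rewrite e'0; have e2 : 0 < e / 2 by rewrite divr_gt0.
near=> x; rewrite normc_cabs ltcR.
apply: (le_lt_trans (cabs_le _)); rewrite [ltRHS]splitr.
rewrite !raddfB/=; apply: ltrD; near: x; [exact: ul|exact: vl].
Unshelve. all: by end_near. Qed.

Lemma cvg_cabs (T : Type) (F : set_system T) {FF : Filter F} (u : T -> R[i])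
    (l : R[i]) :
  u x @[x --> F] --> l -> cabs (u x) @[x --> F] --> cabs l.
Proof.
move=> /cvgrPdist_lt ul; apply/cvgrPdist_lt => e e0.
have := ul e%:C; rewrite ltcR => /(_ e0); apply: filterS => x.
rewrite normc_cabs ltcR; apply: le_lt_trans.
rewrite -lecR -normc_cabs; apply: le_trans (ler_dist_dist _ _).
by rewrite !normc_cabs -rmorphB cabsR.
Qed.

Lemma cvg_conjc (T : Type) (F : set_system T) {FF : Filter F} (u : T -> R[i])
    (l : R[i]) :
  u x @[x --> F] --> l -> conjc (u x) @[x --> F] --> conjc l.
Proof.
move=> /cvgrPdist_lt ul; apply/cvgrPdist_lt => e e0.
by apply: filterS (ul e e0) => x; rewrite -rmorphB normcJ.
Qed.

Lemma is_cvg_qpoch q z : 0 < q < 1 ->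
  cvgn (fun n => \prod_(i < n) (1 - z * (q ^+ i)%:C)).
Proof.
move=> /andP[q0 q1].
pose P n := \prod_(i < n) (1 - z * (q ^+ i)%:C).
have geo r : cvgn (series (geometric r q)).
  by apply: is_cvg_geometric_series; rewrite ger0_norm// ltW.
pose K := expR (limn (series (geometric (cabs z) q))).
have PK n : cabs (P n) <= K.
  apply: (@le_trans _ _ (expR (series (geometric (cabs z) q) n))); last first.
    rewrite ler_expR; apply: nondecreasing_cvgn_le => //.
    apply: nondecreasing_series => k _ _ /=.
    by rewrite mulr_ge0 ?cabs_ge0// exprn_ge0// ltW.
  elim: n => [|n IH].
    by rewrite /P big_ord0 /series/= big_geq// expR0 /cabs normr1.
  rewrite /P big_ord_recr/= -/(P n) cabsM /series/= big_nat_recr//= expRD.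
  apply: ler_pM => //; try exact: cabs_ge0.
  apply: le_trans (expR_ge1Dx _).
  rewrite -lecR -normc_cabs (le_trans (ler_normB _ _))// normr1.
  rewrite normrM rmorphD rmorphM/= -normc_cabs lerD2l.
  by apply: ler_wpM2l => //; rewrite normc_cabs cabsR ger0_norm// exprn_ge0// ltW.
have dP n : cabs (P n.+1 - P n) <= geometric (K * cabs z) q n.
  rewrite /P big_ord_recr/= -/(P n) -[X in _ - X]mulr1 -mulrBr cabsM.
  rewrite addrC addKr cabsN -mulrA ler_pM ?cabs_ge0//.
  rewrite cabsM ler_wpM2l ?cabs_ge0// cabsE/= expr0n/= addr0 sqrtr_sqr.
  by rewrite ger0_norm// exprn_ge0// ltW.
have cvgp (p : {additive R[i] -> R}) : (forall w, `|p w| <= cabs w) ->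
    cvgn (fun n => p (P n)).
  move=> pw; pose u n := p (P n).
  have -> : (fun n => p (P n)) = (fun n => u 0%N + series (telescope u) n).
    by apply/funext => n; rewrite seriesEnat/= telescope_sumr// addrC subrK.
  apply: is_cvgD; first exact: is_cvg_cst.
  apply: normed_cvg; apply: (series_le_cvg _ _ _ (geo (K * cabs z))).
  - by move=> n /=.
  - by move=> n /=; rewrite !mulr_ge0 ?cabs_ge0 ?expR_ge0 ?exprn_ge0 ?ltW.
  - by move=> n; rewrite /telescope /u/= -(raddfB p); apply: le_trans (dP n).
have cR : cvgn (fun n => complex.Re (P n)).
  apply: (cvgp (@complex.Re R : {additive R[i] -> R})) => /= w; rewrite cabsE -sqrtr_sqr ler_wsqrtr//.
  by rewrite lerDl sqr_ge0.
have cI : cvgn (fun n => complex.Im (P n)).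
  apply: (cvgp (@complex.Im R : {additive R[i] -> R})) => /= w; rewrite cabsE -sqrtr_sqr ler_wsqrtr//.
  by rewrite lerDr sqr_ge0.
apply/cvg_ex; exists (limn (fun n => complex.Re (P n)) +i*
                      limn (fun n => complex.Im (P n))).
exact: cvg_complex.
Qed.

End facts.

Section measurability.
Context {R : realType}.
Implicit Types (q : R) (z : R[i]).

Lemma measurable_inv (D : set R) : measurable_fun D (@GRing.inv R).
Proof.
apply: (measurable_funS measurableT (@subsetT _ D)).
rewrite (_ : [set: R] = [set x : R | x != 0] `|` [set 0]); last first.
  by apply/seteqP; split=> // x _ /=; have [->|x0] := eqVneq x 0; [right|left].
have o0 : open [set x : R | x != 0].
  rewrite (_ : mkset _ = ~` [set 0]); first exact/closed_openC/closed_eq.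
  by apply/seteqP; split=> x /= /eqP.
apply/measurable_funU => //; first exact: open_measurable.
split.
- apply: open_continuous_measurable_fun => // x; rewrite inE /= => x0.
  exact: inv_continuous.
- apply: (eq_measurable_fun (cst (0 : R))); last exact: measurable_cst.
  by move=> x; rewrite inE => /= ->; rewrite invr0.
Qed.

Definition cmeas (F : R -> R[i]) :=
  measurable_fun setT (fun x => complex.Re (F x)) /\
  measurable_fun setT (fun x => complex.Im (F x)).

Lemma cmeas_cst z : cmeas (cst z).
Proof. by split; exact: measurable_cst. Qed.

Lemma cmeasM F G : cmeas F -> cmeas G -> cmeas (fun x => F x * G x).
Proof.
move=> [rF iF] [rG iG]; split.
  rewrite (_ : (fun _ => _) = fun x => complex.Re (F x) * complex.Re (G x) -
      complex.Im (F x) * complex.Im (G x)).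
    by apply: measurable_funB; exact: measurable_funM.
  by apply/funext => x; case: (F x) (G x) => [a b] [c d].
rewrite (_ : (fun _ => _) = fun x => complex.Re (F x) * complex.Im (G x) +
    complex.Im (F x) * complex.Re (G x)).
  by apply: measurable_funD; exact: measurable_funM.
by apply/funext => x; case: (F x) (G x) => [a b] [c d].
Qed.

Lemma cmeasB F G : cmeas F -> cmeas G -> cmeas (fun x => F x - G x).
Proof.
move=> [rF iF] [rG iG]; split.
  under eq_fun do rewrite raddfB; exact: measurable_funB.
under eq_fun do rewrite raddfB; exact: measurable_funB.
Qed.

Lemma cmeasV F : cmeas F -> cmeas (fun x => (F x)^-1).
Proof.
move=> [rF iF].
have mn : measurable_fun setT
    (fun x => (complex.Re (F x) ^+ 2 + complex.Im (F x) ^+ 2)^-1).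
  apply: (measurableT_comp (f := @GRing.inv R)); first exact: measurable_inv.
  by apply: measurable_funD; exact: measurable_funX.
split.
  rewrite (_ : (fun _ => _) = fun x => complex.Re (F x) *
     (complex.Re (F x) ^+ 2 + complex.Im (F x) ^+ 2)^-1).
    exact: measurable_funM.
  by apply/funext => x; case: (F x).
rewrite (_ : (fun _ => _) = fun x => - (complex.Im (F x) *
   (complex.Re (F x) ^+ 2 + complex.Im (F x) ^+ 2)^-1)).
  by apply: measurable_funN; exact: measurable_funM.
by apply/funext => x; case: (F x).
Qed.

Lemma measurable_cos : measurable_fun setT (@cos R).
Proof. by apply: continuous_measurable_fun; exact: continuous_cos. Qed.

Lemma measurable_sin : measurable_fun setT (@sin R).
Proof. by apply: continuous_measurable_fun; exact: continuous_sin. Qed.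

Lemma cmeas_expi : cmeas expi.
Proof. by split; [exact: measurable_cos|exact: measurable_sin]. Qed.

Lemma measurable_cabs F : cmeas F -> measurable_fun setT (fun x => cabs (F x)).
Proof.
move=> [rF iF]; under eq_fun do rewrite cabsE.
apply: (measurableT_comp (f := @Num.sqrt R)).
  by apply: continuous_measurable_fun; exact: sqrt_continuous.
by apply: measurable_funD; exact: measurable_funX.
Qed.

Lemma cabs_prod n (F : nat -> R[i]) :
  cabs (\prod_(i < n) F i) = \prod_(i < n) cabs (F i).
Proof.
elim: n => [|n IH]; first by rewrite !big_ord0 (cabsR 1) normr1.
by rewrite !big_ord_recr/= cabsM IH.
Qed.

Lemma cabsV z : cabs z^-1 = (cabs z)^-1.
Proof.
by apply/(@complexI R); rewrite fmorphV/= -!normc_cabs normfV.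
Qed.

Lemma measurable_cabs_qpoch q F : 0 < q < 1 -> cmeas F ->
  measurable_fun setT (fun x => cabs (qpoch q (F x))).
Proof.
move=> q01 mF.
apply: (@measurable_fun_cvg _ _ _ _
  (fun n x => cabs (\prod_(i < n) (1 - F x * (q ^+ i)%:C)))).
  move=> n; under eq_fun do rewrite (cabs_prod n (fun i => 1 - F _ * (q ^+ i)%:C)).
  apply: measurable_prod => i _; apply: measurable_cabs.
  by apply: cmeasB; [exact: cmeas_cst|apply: cmeasM => //; exact: cmeas_cst].
by move=> x _; apply: cvg_cabs; exact: is_cvg_qpoch.
Qed.

Lemma measurable_cabs_theta q F : 0 < q < 1 -> cmeas F ->
  measurable_fun setT (fun x => cabs (theta q (F x))).
Proof.
move=> q01 mF; under eq_fun do rewrite cabsM.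
apply: measurable_funM; apply: measurable_cabs_qpoch => //.
by apply: cmeasM; [exact: cmeas_cst|exact: cmeasV].
Qed.

Lemma measurable_cabs_W q (beta : params R) : 0 < q < 1 ->
  measurable_fun setT (fun th => cabs (W q beta (expi th))).
Proof.
case: beta => [[[[a b] c] d] t] q01.
have mM k : cmeas (fun th => k%:C * expi th).
  by apply: cmeasM; [exact: cmeas_cst|exact: cmeas_expi].
have mV k : cmeas (fun th => k%:C / expi th).
  by apply: cmeasM; [exact: cmeas_cst|apply: cmeasV; exact: cmeas_expi].
have mQ k : measurable_fun setT (fun th =>
    cabs (qpoch q (k%:C * expi th)) * cabs (qpoch q (k%:C / expi th))).
  by apply: measurable_funM; exact: measurable_cabs_qpoch.
have mT k : measurable_fun setT (fun th =>
    cabs (theta q (k%:C * expi th)) * cabs (theta q (k%:C / expi th))).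
  by apply: measurable_funM; exact: measurable_cabs_theta.
under eq_fun do rewrite !cabsM !cabsV !cabsM.
have mX : cmeas (fun th => expi th ^+ 2).
  by under eq_fun do rewrite expr2; apply: cmeasM; exact: cmeas_expi.
have mVf (f : R -> R) : measurable_fun setT f ->
    measurable_fun setT (fun x => (f x)^-1).
  by move=> mf; apply: (measurableT_comp (f := @GRing.inv R)) => //;
    exact: measurable_inv.
apply: measurable_funM; apply: measurable_funM.
- by apply: measurable_funM; apply: measurable_cabs_qpoch => //; exact: cmeasV.
- by apply: mVf; do 3![apply: measurable_funM => //].
- by have := mT d; under eq_fun do rewrite !cabsM.
- by apply: mVf; have := mT (d * t); under eq_fun do rewrite !cabsM.
Qed.

Lemma continuous_expi : continuous (@expi R).
Proof.
by move=> x; apply: cvg_complex; [exact: continuous_cos|exact: continuous_sin].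
Qed.

Lemma measurable_expi : measurable_fun setT (@expi R).
Proof.
apply: (@measurability _ _ _ _ _ _ (@open R[i])) => // _ [A oA <-].
rewrite setTI; apply: open_measurable.
by apply: open_comp => // x _; exact: continuous_expi.
Qed.

End measurability.

Section weight_facts.
Context {R : realType}.
Implicit Types (q : R) (z : R[i]) (beta : params R).

Lemma qpoch_conj q z : 0 < q < 1 -> qpoch q (conjc z) = conjc (qpoch q z).
Proof.
move=> q01; apply/cvg_lim; first exact: norm_hausdorff.
have /cvg_conjc := @is_cvg_qpoch _ q z q01; apply: cvg_trans; apply: near_eq_cvg.
apply: nearW => n; rewrite rmorph_prod; apply: eq_bigr => i _.
by rewrite rmorphB rmorphM rmorph1/= oppr0.
Qed.

Lemma W_circle_ge0 q beta z : 0 < q < 1 -> `|z| = 1 -> 0 <= W q beta z.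
Proof.
case: beta => [[[[a b] c] d] t] q01 z1.
have zV : z^-1 = conjc z.
  have z0 : z != 0 by rewrite -normr_eq0 z1 oner_eq0.
  by apply: (mulfI z0); rewrite divff// -sqr_normc z1 expr1n.
have kV (k : R) : k%:C / z = conjc (k%:C * z).
  by rewrite zV rmorphM/= oppr0.
have pos w : 0 <= qpoch q w * qpoch q (conjc w).
  by rewrite qpoch_conj// -sqr_normc exprn_ge0.
have posT w : 0 <= theta q w * theta q (conjc w).
  rewrite /theta mulrACA mulr_ge0//.
  have -> : q%:C / conjc w = conjc (q%:C / w) by rewrite rmorphM fmorphV/= oppr0.
  exact: pos.
rewrite /W /bigDelta /bigTheta !kV.
have -> : z ^- 2 = conjc (z ^+ 2) by rewrite -exprVn zV rmorphXn.
by do ![exact: pos|exact: posT|rewrite invr_ge0|apply: mulr_ge0].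
Qed.

End weight_facts.

Section AW_measure.
Context {R : realType}.
Implicit Types (q : R) (beta : params R).

(* (4 pi i)^-1 \int_T f W dx/x in the parametrization x = expi th. W is
   nonnegative on T (W_circle_ge0), so the modulus does not change it. *)
Definition circle_part q (q01 : 0 < q < 1) beta (A : set R[i]) : \bar R :=
  (\int[lebesgue_measure]_(th in `[0%R, (2 * pi)%R]%classic `&` expi @^-1` A)
    ((4 * pi)^-1 * cabs (W q beta (expi th)))%:E)%E.

Section circle_part_measure.
Variables (q : R) (q01 : 0 < q < 1) (beta : params R).
Local Notation mu := (circle_part q01 beta).

Let dens_ge0 th : (0 <= ((4 * pi)^-1 * cabs (W q beta (expi th)))%:E)%E.
Proof. by rewrite lee_fin mulr_ge0 ?cabs_ge0// invr_ge0 mulr_ge0 ?pi_ge0. Qed.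

Let circle_part0 : mu set0 = 0%E.
Proof. by rewrite /circle_part preimage_set0 setI0 integral_set0. Qed.

Let circle_part_ge0 A : (0 <= mu A)%E.
Proof. by apply: integral_ge0 => th _; exact: dens_ge0. Qed.

Let circle_part_sigma_additive : semi_sigma_additive mu.
Proof.
move=> F mF tF mUF; rewrite /circle_part preimage_bigcup setI_bigcupr.
have mI k : measurable (`[0, 2 * pi]%classic `&` expi @^-1` F k : set R).
  apply: measurableI => //.
  by rewrite -[X in measurable X]setTI; exact: measurable_expi.
rewrite ge0_integral_bigcup//.
- by apply: is_cvg_ereal_nneg_natsum_cond => n _ _; exact: circle_part_ge0.
- apply/measurable_EFinP; apply: measurable_funTS; apply: measurable_funM.
    exact: measurable_cst.
  exact: measurable_cabs_W.
- apply/trivIsetP => i j _ _ ij; rewrite /= setIACA setIid -(preimage_setI expi).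
  move/trivIsetP : tF => /(_ i j I I ij) ->; by rewrite preimage_set0 setI0.
Qed.

HB.instance Definition _ := isMeasure.Build _ _ _ mu
  circle_part0 circle_part_ge0 circle_part_sigma_additive.

End circle_part_measure.

(* The mass of m at x and at 1/x is half the residue. Since m is a positive
   measure this residue is a nonnegative real; the modulus makes the mass a
   nonnegative real by construction. *)
Definition plus_weight q beta (j : nat) : R :=
  if 1 < pole_plus q j beta then cabs (ext_residue q (pole_plus q j) beta) / 2
  else 0.

Definition minus_weight q beta (j : int) : R :=
  if pole_minus q j beta < -1 then cabs (ext_residue q (pole_minus q j) beta) / 2
  else 0.

Lemma plus_weight_ge0 q beta j : 0 <= plus_weight q beta j.
Proof. by rewrite /plus_weight; case: ifP => // _; rewrite divr_ge0 ?cabs_ge0. Qed.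

Lemma minus_weight_ge0 q beta j : 0 <= minus_weight q beta j.
Proof. by rewrite /minus_weight; case: ifP => // _; rewrite divr_ge0 ?cabs_ge0. Qed.

Definition pair_mass (x : R[i]) : {measure set R[i] -> \bar R} :=
  measure_add \d_x \d_(x^-1).

Definition plus_part q beta : {measure set R[i] -> \bar R} :=
  mseries (fun j => mscale (NngNum (plus_weight_ge0 q beta j))
                           (pair_mass (pole_plus q j beta)%:C)) 0.

Definition minus_mass q beta (j : int) : {measure set R[i] -> \bar R} :=
  mscale (NngNum (minus_weight_ge0 q beta j)) (pair_mass (pole_minus q j beta)%:C).

Definition minus_part q beta : {measure set R[i] -> \bar R} :=
  mseries (fun n => measure_add (minus_mass q beta (Posz n))
                                (minus_mass q beta (Negz n))) 0.

Definition AWmeasure q (q01 : 0 < q < 1) beta : {measure set R[i] -> \bar R} :=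
  measure_add (circle_part q01 beta)
              (measure_add (plus_part q beta) (minus_part q beta)).

End AW_measure.

Section L2.
Context {R : realType}.
Implicit Types (m : {measure set R[i] -> \bar R}) (f : R[i] -> R[i]).
Implicit Types (V : set (R[i] -> R[i])).

Definition norm2sq m f : \bar R := (\int[m]_x (cabs (f x) ^+ 2)%:E)%E.

Definition L2plus m : set (R[i] -> R[i]) := [set f : R[i] -> R[i] |
  [/\ measurable_fun setT f, {ae m, forall x, f x = f x^-1} &
      (norm2sq m f < +oo)%E]].

Definition dense_in_L2plus m V : Prop :=
  forall f, L2plus m f -> forall e : R, 0 < e ->
    exists2 v, V v & (norm2sq m (f \- v)%R < e%:E)%E.

Definition sum_space V1 V2 : set (R[i] -> R[i]) :=
  [set f : R[i] -> R[i] | exists2 g, V1 g & exists2 h, V2 h & f = g \+ h].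

End L2.

Section subspaces.
Context {R : realType}.
Implicit Types (q : R) (beta : params R) (x : R[i]).

(* A h, where A is the space of inversion-invariant Laurent polynomials *)
Definition laurent_mul (h : R[i] -> R[i]) : set (R[i] -> R[i]) :=
  [set f : R[i] -> R[i] | exists p : {poly R[i]}, f = fun x => p.[x + x^-1] * h x].

Definition Gfun q beta x : R[i] :=
  let: (a, b, c, d, t) := beta in (qpoch q (d%:C * x) * qpoch q (d%:C / x))^-1.

Definition Gtau q beta x : R[i] :=
  let: (a, b, c, d, t) := beta in Gfun q (a, b, c, q / d, t) x.

(* The meromorphic function 1/(G Theta), with its removable singularities at
   the zeros of (dx, d/x; q)_oo removed (they can be mass points of m): see
   GThetaVE. *)
Definition GThetaV q beta x : R[i] :=
  let: (a, b, c, d, t) := beta in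
  theta q ((d * t)%:C * x) * theta q ((d * t)%:C / x) /
  (qpoch q (q%:C / (d%:C * x)) * qpoch q (q%:C / (d%:C / x))).

Lemma GThetaVE q beta x :
  let: (a, b, c, d, t) := beta in
  qpoch q (d%:C * x) * qpoch q (d%:C / x) != 0 ->
  GThetaV q beta x = (Gfun q beta x)^-1 * (bigTheta q beta x)^-1.
Proof.
case: beta => [[[[a b] c] d] t] h0; rewrite /GThetaV /Gfun /bigTheta.
rewrite invrK [X in _ = _ * X]invf_div.
have -> : theta q (d%:C * x) * theta q (d%:C / x) =
    (qpoch q (d%:C * x) * qpoch q (d%:C / x)) *
    (qpoch q (q%:C / (d%:C * x)) * qpoch q (q%:C / (d%:C / x))).
  by rewrite /theta mulrACA.
by rewrite [RHS]mulrCA [in RHS]invfM mulVKf.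
Qed.

Definition Vcl q beta := laurent_mul (GThetaV q beta).

Definition Vstr q beta := laurent_mul (Gtau q beta).

End subspaces.

Section kexp_facts.
Context {R : realType}.
Implicit Types (q : R) (beta : params R).

Lemma exists_unique_kexp q (u : R) : 0 < q < 1 -> 0 < u ->
  exists! k : int, 1 < u * q ^ k <= q^-1.
Proof.
move=> /andP[q0 q1] u0.
have lnq : ln q < 0 by rewrite -ln1 ltr_ln ?posrE.
have qE (k : int) : q ^ k = expR (k%:~R * ln q).
  by rewrite -powR_intmul ?ltW// /powR gt_eqF.
pose v := - (ln u / ln q).
have uE (k : int) : u * q ^ k = expR ((k%:~R - v) * ln q).
  rewrite qE -{1}(lnK u0) -expRD mulrBl mulNr opprK divfK ?lt_eqF//.
  by rewrite addrC.
have kE (k : int) : (1 < u * q ^ k <= q^-1) = (k == Num.ceil v - 1).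
  rewrite uE -[X in _ <= X^-1](lnK q0) -expRN -[X in X < _]expR0 ltr_expR ler_expR.
  rewrite nmulr_lgt0// -[X in _ <= X]mulN1r ler_nM2r// subr_lt0.
  rewrite [RHS]eq_sym subr_eq ceil_eq addrK intrD.
  by congr (_ && _); rewrite lerBrDr addrC lerBlDr.
exists (Num.ceil v - 1); split; first by rewrite kE.
by move=> k; rewrite kE => /eqP.
Qed.

Lemma kexpP q beta : 0 < q < 1 -> admissible q beta ->
  let: (a, b, c, d, t) := beta in
  forall k : int, (1 < `|d * t * q ^ k| <= q^-1) = (k == kexp q beta).
Proof.
case: beta => [[[[a b] c] d] t] q01 [t0 [b0 c0 ba ca] ad _ _] k.
have [q0 q1] := andP q01.
have dt0 : 0 < `|d * t|.
  have : 0 < d / q by apply: lt_trans ad; exact: lt_le_trans ba.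
  rewrite pmulr_lgt0 ?invr_gt0// => d0.
  by rewrite normr_gt0 mulf_neq0 ?(gt_eqF d0) ?(lt_eqF t0).
have nE (j : int) : `|d * t * q ^ j| = `|d * t| * q ^ j.
  by rewrite normrM (ger0_norm (exprz_ge0 _ _))// ltW.
have [k0 [Pk0 uk0]] := exists_unique_kexp q01 dt0.
have kE : kexp q (a, b, c, d, t) = k0.
  rewrite /kexp; case: xgetP => [j _|/(_ k0)/=]; last by rewrite nE.
  by rewrite /= nE => /uk0.
rewrite kE nE; apply/idP/eqP => [/uk0->|->]//.
Qed.

End kexp_facts.

(* Main.v *)
(* Every element of V_cl vanishes on D_-, while off D_- the measure is finite
   with x + 1/x bounded and 1/(G Theta) is bounded and nonzero almost
   everywhere, so that V_cl is dense in L^2 of that part by density of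
   polynomials. Hence V_cl + V_str is dense iff V_str is dense in l^2(D_-).
   Write D_- = {x_n = d t q^(k-n) : n >= 0}. The mass of G^tau at x_n is
   comparable to q^(n(n+1)) / tau2^n, where tau2 = q^2 (atilde t q^k)^2.
   If tau2 >= q^2, averages of the Lagrange interpolation polynomials of the
   nodes x_i + 1/x_i, i < N, approximate all point masses. If tau2 < q^2, the
   divided differences at these nodes, which kill polynomials of degree < N - 1,
   are bounded on l^2(D_-) uniformly in N, so delta_{x_0} is not approximable. *)

Require Import Defs.
From HB Require Import structures.
From mathcomp Require Import all_boot all_order all_algebra.
From mathcomp Require Import all_classical all_reals all_analysis.
From mathcomp Require Import measurable_realfun complex.
From mathcomp Require Import ring lra zify.

Set Implicit Arguments.
Unset Strict Implicit.
Unset Printing Implicit Defensive.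

Import Order.TTheory GRing.Theory Num.Theory.
Import numFieldNormedType.Exports.

Local Open Scope classical_set_scope.
Local Open Scope ring_scope.

(** * q-shifted factorials and theta functions *)

(** The two subspaces act one after the other: the V_str component is fixed by approximation on D_-
    alone, and the remainder it leaves off D_- is then approximated by V_cl, which cannot disturb
    D_-. Off D_- the variable x + 1/x is real and bounded, so density there concerns polynomials in
    one bounded real function. The threshold q^2 comes from counting exponents. With N nodes, the
    squared Lagrange basis polynomial of a fixed node is O(q^(2n + N(N-1) - 2nN)) at x_n for n >= N;
    times the mass this is (q^2/tau2)^n q^((n-N)(n-N+1)). Dually, the squared coefficient of the
    divided difference, normalized at x_0, divided by the mass is O((tau2/q^2)^n) uniformly in N.
    The masses on D_- are limits of residues over generic parameters. They are evaluated in closed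
    form at generic parameters and extended by continuity, generic parameters being dense. On D_+ no
    residue is ever computed: finiteness of D_+ suffices. *)

Section qpoch_theory.
Local Open Scope complex_scope.
Context {R : realType} (q : R) (q01 : 0 < q < 1).
Implicit Types (z w : R[i]) (u v : R).

Let q0 : 0 < q. Proof. by case/andP: q01. Qed.
Let q1 : q < 1. Proof. by case/andP: q01. Qed.
Let q_neq0 : q != 0. Proof. by rewrite gt_eqF. Qed.

(** Real version of [qpoch], on which order and positivity make sense; by [qpoch_real] no imaginary
    part is lost. *)
Definition rpoch u : R := complex.Re (qpoch q u%:C).

Lemma cvg_qpoch z :
  \prod_(i < n) (1 - z * (q ^+ i)%:C) @[n --> \oo] --> qpoch q z.
Proof. exact: is_cvg_qpoch. Qed.
Arguments cvg_qpoch : clear implicits.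

Lemma cvg_Re (T : Type) (F : set_system T) {FF : Filter F} (f : T -> R[i]) l :
  f x @[x --> F] --> l -> complex.Re (f x) @[x --> F] --> complex.Re l.
Proof.
move=> /cvgrPdist_lt fl; apply/cvgrPdist_lt => e e0.
have := fl e%:C; rewrite ltcR => /(_ e0); apply: filterS => x.
rewrite normc_cabs ltcR; apply: le_lt_trans.
rewrite -raddfB cabsE -sqrtr_sqr ler_wsqrtr//.
by rewrite lerDl sqr_ge0.
Qed.

Lemma cvg_Im (T : Type) (F : set_system T) {FF : Filter F} (f : T -> R[i]) l :
  f x @[x --> F] --> l -> complex.Im (f x) @[x --> F] --> complex.Im l.
Proof.
move=> /cvgrPdist_lt fl; apply/cvgrPdist_lt => e e0.
have := fl e%:C; rewrite ltcR => /(_ e0); apply: filterS => x.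
rewrite normc_cabs ltcR; apply: le_lt_trans.
rewrite -raddfB cabsE -sqrtr_sqr ler_wsqrtr//.
by rewrite lerDr sqr_ge0.
Qed.

Lemma cvg_real_complex (T : Type) (F : set_system T) {FF : Filter F}
    (f : T -> R) (l : R) :
  f x @[x --> F] --> l -> (f x)%:C @[x --> F] --> l%:C.
Proof. by move=> fl; apply: cvg_complex => //=; exact: cvg_cst. Qed.

Lemma prod_real_complex n u : \prod_(i < n) (1 - u%:C * (q ^+ i)%:C) =
  (\prod_(i < n) (1 - u * q ^+ i))%:C.
Proof.
by rewrite rmorph_prod; apply: eq_bigr => i _; rewrite rmorphB rmorphM.
Qed.

Lemma cvg_rpoch u : \prod_(i < n) (1 - u * q ^+ i) @[n --> \oo] --> rpoch u.
Proof.
rewrite (_ : (fun n => _) =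
    fun n => complex.Re (\prod_(i < n) (1 - u%:C * (q ^+ i)%:C))).
  exact: (cvg_Re (cvg_qpoch _)).
by apply/funext => n; rewrite prod_real_complex.
Qed.
Arguments cvg_rpoch : clear implicits.

Lemma qpoch_real u : qpoch q u%:C = (rpoch u)%:C.
Proof.
apply: (@cvg_unique _ (@norm_hausdorff _ R[i]) _ _ _ _ (cvg_qpoch _)).
rewrite (_ : (fun n => _) = fun n => (\prod_(i < n) (1 - u * q ^+ i))%:C).
  exact: (cvg_real_complex (cvg_rpoch _)).
by apply/funext => n; exact: prod_real_complex.
Qed.

Lemma rpoch_ge u (e : R) :
  (forall n, e <= \prod_(i < n) (1 - u * q ^+ i)) -> e <= rpoch u.
Proof.
by move=> h; apply: (cvgr_to_ge (cvg_rpoch u)); apply: nearW.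
Qed.

Lemma rpoch_ge1 u : u <= 0 -> 1 <= rpoch u.
Proof.
move=> u0; apply: rpoch_ge => n; elim/big_ind: _ => // [x y x1 y1|i _].
  by rewrite mulr_ege1.
by rewrite lerBrDr gerDl mulr_le0_ge0// exprn_ge0// ltW.
Qed.

Lemma qpoch_shift m z :
  qpoch q z = \prod_(i < m) (1 - z * (q ^+ i)%:C) * qpoch q (z * (q ^+ m)%:C).
Proof.
apply: (@cvg_unique _ (@norm_hausdorff _ R[i]) _ _ _ _ (cvg_qpoch _)).
rewrite /= -(cvg_shiftn m)/=.
have -> : (fun n => \prod_(i < n + m) (1 - z * (q ^+ i)%:C)) =
  fun n => \prod_(i < m) (1 - z * (q ^+ i)%:C) *
     \prod_(i < n) (1 - z * (q ^+ m)%:C * (q ^+ i)%:C).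
  apply/funext => n; rewrite addnC big_split_ord/=; congr (_ * _).
  by apply: eq_bigr => i _; rewrite exprD rmorphM/= mulrA.
by apply: cvgM; [exact: cvg_cst|exact: cvg_qpoch].
Qed.

Lemma rpoch_shift m u :
  rpoch u = \prod_(i < m) (1 - u * q ^+ i) * rpoch (u * q ^+ m).
Proof.
apply: complexI; rewrite -qpoch_real (qpoch_shift m) rmorphM/=.
by rewrite -prod_real_complex -qpoch_real rmorphM.
Qed.

Lemma qpochS z : qpoch q z = (1 - z) * qpoch q (z * q%:C).
Proof. by rewrite (qpoch_shift 1) big_ord1/= expr0 mulr1 expr1. Qed.

Lemma sum_geo_le n : \sum_(i < n) q ^+ i <= (1 - q)^-1.
Proof.
have q1' : 0 < 1 - q by rewrite subr_gt0.
rewrite -[leRHS]mul1r ler_pdivlMr// -opprB mulrN mulrC -subrX1 opprB.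
by rewrite gerBl exprn_ge0 ?ltW.
Qed.

Lemma cvg_expq : q ^+ n @[n --> \oo] --> 0.
Proof. by apply: cvg_expr; rewrite gtr0_norm. Qed.

Lemma expq_lt u : 0 < u -> exists m, q ^+ m < u.
Proof.
move=> u0; have /cvgrPdist_lt /(_ _ u0) [m _ /(_ m (leqnn _))] := cvg_expq.
by rewrite /= sub0r normrN ger0_norm ?exprn_ge0 ?(ltW q0)//; exists m.
Qed.

(** Weierstrass's product inequality for the factors [1 - u q^i]. *)
Lemma prod_geo_ge u n : 0 <= u <= 1 ->
  1 - u * \sum_(i < n) q ^+ i <= \prod_(i < n) (1 - u * q ^+ i).
Proof.
move=> /andP[u0 u1]; elim: n => [|n IH]; first by rewrite !big_ord0 mulr0 subr0.
have qn0 : 0 <= q ^+ n by rewrite exprn_ge0// ltW.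
have qn1 : q ^+ n <= 1 by rewrite exprn_ile1// ltW.
have s0 : 0 <= \sum_(i < n) q ^+ i.
  by apply: sumr_ge0 => i _; rewrite exprn_ge0// ltW.
have uq1 : 0 <= 1 - u * q ^+ n by rewrite subr_ge0 mulr_ile1.
rewrite !big_ord_recr/=; apply: (@le_trans _ _ ((1 - u * \sum_(i < n) q ^+ i) * (1 - u * q ^+ n))).
  by set s := \sum_(_ < _) _ in s0 *; have := mulr_ge0 (mulr_ge0 u0 s0) (mulr_ge0 u0 qn0); lra.
exact: ler_wpM2r.
Qed.

(** Positive factors could still have a product tending to 0. Once m factors are split off so that
    [u q^m] is below (1 - q)/2, Weierstrass's inequality keeps every remaining partial product above
    1/2. *)
Lemma rpoch_gt0 u : u < 1 -> 0 < rpoch u.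
Proof.
move=> u1; have [u0|u0] := leP u 0; first exact: lt_le_trans (rpoch_ge1 u0).
have e0 : 0 < (1 - q) / 2 by rewrite divr_gt0// subr_gt0.
have [m qm] := expq_lt e0.
have qm0 : 0 <= q ^+ m by rewrite exprn_ge0// ltW.
rewrite (rpoch_shift m) mulr_gt0//.
  apply: prodr_gt0 => i _; rewrite subr_gt0; apply: le_lt_trans u1.
  by rewrite ler_piMr ?(ltW u0)// exprn_ile1// ltW.
apply: (@lt_le_trans _ _ (2^-1)) => //; apply: rpoch_ge => n.
apply: le_trans (prod_geo_ge _ _).
  have := sum_geo_le n; set s := \sum_(_ < _) _ => sq.
  have uq : u * q ^+ m <= (1 - q) / 2.
    by apply: le_trans (ltW qm); rewrite ler_piMl// ltW.
  have : u * q ^+ m * s <= (1 - q) / 2 * (1 - q)^-1.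
    apply: ler_pM => //; first by rewrite mulr_ge0// ltW.
    by apply: sumr_ge0 => i _; rewrite exprn_ge0// ltW.
  have -> : (1 - q) / 2 * (1 - q)^-1 = 2^-1 by field; rewrite subr_eq0 gt_eqF.
  lra.
rewrite mulr_ge0 ?(ltW u0)//= mulr_ile1 ?(ltW u0) ?(ltW u1)//.
by rewrite exprn_ile1// ltW.
Qed.

Lemma cabs_1B z u : cabs z <= u -> 1 - u <= cabs (1 - z).
Proof.
move=> zu; rewrite -lecR -normc_cabs; apply: le_trans (lerB_dist _ _).
by rewrite normr1 normc_cabs rmorphB rmorph1 lerB// lecR.
Qed.

Lemma cabs_expq i : cabs ((q ^+ i)%:C) = q ^+ i.
Proof. by rewrite cabsR ger0_norm// exprn_ge0// ltW. Qed.

Lemma cabs_prod_1B z n : cabs (\prod_(i < n) (1 - z * (q ^+ i)%:C)) =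
  \prod_(i < n) cabs (1 - z * (q ^+ i)%:C).
Proof. exact: (cabs_prod n (fun i : nat => 1 - z * (q ^+ i)%:C)). Qed.

Lemma cabs_qpoch_ge z u : cabs z <= u -> u <= 1 -> rpoch u <= cabs (qpoch q z).
Proof.
move=> zu u1; apply: (ler_cvg_to (cvg_rpoch u) (cvg_cabs (cvg_qpoch z))).
apply: nearW => n; rewrite cabs_prod_1B; apply: ler_prod => i _.
have qi0 : 0 <= q ^+ i by rewrite exprn_ge0// ltW.
have u0 := le_trans (cabs_ge0 z) zu.
rewrite subr_ge0 mulr_ile1 ?exprn_ile1 ?(ltW q0) ?(ltW q1)//=.
by apply: cabs_1B; rewrite cabsM cabs_expq ler_wpM2r.
Qed.

Lemma cabs_gt0 z : (0 < cabs z) = (z != 0).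
Proof. by rewrite -ltcR -normc_cabs normr_gt0. Qed.

Lemma qpoch_neq0 z : (forall i : nat, z * (q ^+ i)%:C != 1) -> qpoch q z != 0.
Proof.
move=> zi.
(* This threshold for [q^m] gives [|z q^m| <= 1/2]; adding 1 covers z = 0. *)
have e0 : 0 < (cabs z + 1)^-1 / 2 by rewrite divr_gt0// invr_gt0 ltr_pwDr ?cabs_ge0.
have [m qm] := expq_lt e0.
rewrite (qpoch_shift m) mulf_neq0//.
  by apply/prodf_neq0 => i _; rewrite subr_eq0 eq_sym.
rewrite -cabs_gt0; apply: (lt_le_trans _ (@cabs_qpoch_ge _ 2^-1 _ _)); last lra.
  by apply: rpoch_gt0; lra.
rewrite cabsM cabs_expq; apply: (@le_trans _ _ ((cabs z + 1) * ((cabs z + 1)^-1 / 2))).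
  by apply: ler_pM; rewrite ?cabs_ge0 ?exprn_ge0 ?(ltW q0) ?(ltW qm)// lerDl.
by rewrite mulrA divff ?mul1r// gt_eqF// ltr_pwDr// cabs_ge0.
Qed.

Lemma cabsD z w : cabs (z + w) <= cabs z + cabs w.
Proof. by rewrite -lecR rmorphD/= -!normc_cabs ler_normD. Qed.

Lemma cabs_prod_le z u n : cabs z <= u ->
  cabs (\prod_(i < n) (1 - z * (q ^+ i)%:C)) <= \prod_(i < n) (1 + u * q ^+ i).
Proof.
move=> zu; rewrite cabs_prod_1B; apply: ler_prod => i _.
rewrite cabs_ge0/= (le_trans (cabsD _ _))// cabsN cabsM cabs_expq.
by rewrite (cabsR 1) normr1 lerD2l ler_wpM2r// exprn_ge0// ltW.
Qed.

Lemma prod_le_rpoch u n : 0 <= u -> \prod_(i < n) (1 + u * q ^+ i) <= rpoch (- u).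
Proof.
move=> u0; have := cvg_rpoch (- u).
under eq_fun do under eq_bigr do rewrite mulNr opprK.
move=> c; have <- := cvg_lim (@Rhausdorff R) c.
apply: (nondecreasing_cvgn_le (u_ := fun n => \prod_(i < n) (1 + u * q ^+ i))); last by apply/cvg_ex; exists (rpoch (- u)).
apply/nondecreasing_seqP => k; rewrite big_ord_recr/= ler_peMr//.
  by apply: prodr_ge0 => i _; rewrite addr_ge0// mulr_ge0// exprn_ge0// ltW.
by rewrite lerDl mulr_ge0// exprn_ge0// ltW.
Qed.

Lemma cabs_qpoch_le z u : cabs z <= u -> cabs (qpoch q z) <= rpoch (- u).
Proof.
move=> zu; have u0 := le_trans (cabs_ge0 z) zu.
apply: (cvgr_to_le (cvg_cabs (cvg_qpoch z))); apply: nearW => n.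
exact: le_trans (cabs_prod_le _ zu) (prod_le_rpoch _ u0).
Qed.

(** Induction on the partial products, with a constant that depends only on the common bound [u].
    This local Lipschitz estimate yields continuity in [cvg_comp_qpoch], in place of locally uniform
    convergence of the product. *)
Lemma qpoch_lip z w u : cabs z <= u -> cabs w <= u ->
  cabs (qpoch q z - qpoch q w) <= cabs (z - w) * (rpoch (- u) / (1 - q)).
Proof.
move=> zu wu; have u0 := le_trans (cabs_ge0 z) zu.
pose P z n := \prod_(i < n) (1 - z * (q ^+ i)%:C).
pose B n := \prod_(i < n) (1 + u * q ^+ i).
have B1 n : 1 <= B n.
  rewrite /B; elim/big_ind: _ => // [x y x1 y1|i _]; first by rewrite mulr_ege1.
  by rewrite lerDl mulr_ge0// exprn_ge0// ltW.
have step n : cabs (P z n - P w n) <= cabs (z - w) * (B n * \sum_(i < n) q ^+ i).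
  elim: n => [|n IH]; first by rewrite /P !big_ord0 subrr (cabsR 0) normr0 mulr0 mulr0.
  rewrite /P /B !big_ord_recr/= -/(P z n) -/(P w n) -/(B n).
  have qn0 : 0 <= q ^+ n by rewrite exprn_ge0// ltW.
  have -> : P z n * (1 - z * (q ^+ n)%:C) - P w n * (1 - w * (q ^+ n)%:C) =
    (P z n - P w n) * (1 - z * (q ^+ n)%:C) - P w n * ((z - w) * (q ^+ n)%:C) by ring.
  apply: (le_trans (cabsD _ _)); rewrite cabsN !cabsM cabs_expq.
  have h1 : cabs (1 - z * (q ^+ n)%:C) <= 1 + u * q ^+ n.
    rewrite (le_trans (cabsD _ _))// cabsN cabsM cabs_expq.
    by rewrite (cabsR 1) normr1 lerD2l ler_wpM2r.
  have h2 : cabs (P w n) <= B n by exact: cabs_prod_le.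
  have h3 := ler_pM (cabs_ge0 _) (cabs_ge0 _) IH h1.
  have h4 : cabs (P w n) * (cabs (z - w) * q ^+ n) <= B n * (cabs (z - w) * q ^+ n).
    by rewrite ler_wpM2r// mulr_ge0// cabs_ge0.
  apply: (le_trans (lerD h3 h4)).
  have : 0 <= cabs (z - w) * (B n * (u * q ^+ n * q ^+ n)).
    by rewrite !mulr_ge0 ?cabs_ge0// (le_trans ler01).
  set s := \sum_(_ < n) _; lra.
apply: (cvgr_to_le (cvg_cabs (cvgB (cvg_qpoch z) (cvg_qpoch w)))); apply: nearW => n.
apply: (le_trans (step n)); apply: ler_wpM2l; first exact: cabs_ge0.
apply: ler_pM.
- by have := B1 n; lra.
- by apply: sumr_ge0 => i _; rewrite exprn_ge0// ltW.
- exact: prod_le_rpoch.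
- exact: sum_geo_le.
Qed.

Lemma cvg_comp_qpoch (T : Type) (F : set_system T) {FF : Filter F}
    (f : T -> R[i]) l :
  f x @[x --> F] --> l -> qpoch q (f x) @[x --> F] --> qpoch q l.
Proof.
move=> fl; have /cvgrPdist_lt fl' := fl; apply/cvgrPdist_lt => -[e e'] e0.
have [e1 e'0] : 0 < e /\ e' = 0.
  by move: e0; rewrite ltcE/= => /andP[/eqP ? ?].
rewrite e'0.
pose K := rpoch (- (cabs l + 1)) / (1 - q).
have K0 : 0 < K.
  rewrite divr_gt0 ?subr_gt0// rpoch_gt0// (@le_lt_trans _ _ 0)// oppr_le0.
  by rewrite addr_ge0 ?cabs_ge0.
have d0 : 0 < Num.min 1 (e / K) by rewrite lt_min ltr01 divr_gt0.
have := fl' (Num.min 1 (e / K))%:C; rewrite ltcR => /(_ d0).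
apply: filterS => x; rewrite !normc_cabs !ltcR lt_min => /andP[l1 l2].
have fx : cabs (f x) <= cabs l + 1.
  have -> : f x = l - (l - f x) by rewrite opprB addrC subrK.
  by rewrite (le_trans (cabsD _ _))// lerD2l cabsN ltW.
apply: le_lt_trans (@qpoch_lip _ _ (cabs l + 1) _ _) _ => //; first by rewrite lerDl.
by rewrite -ltr_pdivlMr.
Qed.

Lemma cvg_comp_rpoch (T : Type) (F : set_system T) {FF : Filter F}
    (f : T -> R) (l : R) :
  f x @[x --> F] --> l -> rpoch (f x) @[x --> F] --> rpoch l.
Proof. by move=> fl; exact: (cvg_Re (cvg_comp_qpoch (cvg_real_complex fl))). Qed.

Lemma thetaE z : theta q z = (1 - z) * qpoch q (z * q%:C) * qpoch q (q%:C / z).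
Proof. by rewrite /theta qpochS. Qed.

Lemma theta_div z : z != 0 -> theta q (z / q%:C) = - (z / q%:C) * theta q z.
Proof.
move=> z0; have q0' : q%:C != 0 :> R[i] by rewrite fmorph_eq0.
rewrite /theta [in LHS]qpochS divfK// [in RHS](qpochS (q%:C / z)).
have -> : q%:C / (z / q%:C) = q%:C / z * q%:C by field; rewrite z0 q0'.
by field; rewrite z0 q0'.
Qed.

Lemma theta_mul z : z != 0 -> theta q (z * q%:C) = - z^-1 * theta q z.
Proof.
move=> z0; have q0' : q%:C != 0 :> R[i] by rewrite fmorph_eq0.
have := @theta_div (z * q%:C); rewrite mulfK// => ->; last by rewrite mulf_neq0.
by rewrite mulrA mulrNN mulVf ?mul1r.
Qed.

Lemma theta_divX n : exists2 c : R, c ^+ 2 = (q ^+ (n * n.+1))^-1 &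
  forall z, z != 0 -> theta q (z / (q ^+ n)%:C) = c%:C * z ^+ n * theta q z.
Proof.
elim: n => [|n [c c2 IH]].
  exists 1; first by rewrite expr1n invr1.
  by move=> z _; rewrite !expr0 rmorph1 divr1 !mul1r.
exists (- (c * (q ^+ n.+1)^-1)).
  rewrite sqrrN exprMn c2 -exprVn -exprVn -exprVn -exprM -exprD; congr (_ ^+ _).
  by ring.
move=> z z0.
have qn0 : (q ^+ n)%:C != 0 :> R[i] by rewrite fmorph_eq0 expf_neq0.
have qc0 : q%:C != 0 :> R[i] by rewrite fmorph_eq0.
have -> : z / (q ^+ n.+1)%:C = z / (q ^+ n)%:C / q%:C.
  by rewrite exprSr rmorphM/= -mulrA invfM.
rewrite theta_div ?mulf_neq0 ?invr_eq0// IH// rmorphN rmorphM fmorphV/=.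
by rewrite [q ^+ n.+1]exprSr rmorphM/= exprS; field; rewrite qn0 qc0.
Qed.

Lemma theta_mulX n : exists2 c : R, c ^+ 2 = (q ^+ (n * n.-1))^-1 &
  forall z, z != 0 -> theta q (z * (q ^+ n)%:C) = c%:C * z ^- n * theta q z.
Proof.
elim: n => [|n [c c2 IH]].
  exists 1; first by rewrite expr1n invr1.
  by move=> z _; rewrite !expr0 rmorph1 invr1 !mulr1 mul1r.
exists (- (c * (q ^+ n)^-1)).
  rewrite sqrrN exprMn c2 -exprVn -exprVn -exprVn -exprM -exprD; congr (_ ^+ _).
  by case: n {c c2 IH} => //= n; ring.
move=> z z0.
have qn0 : (q ^+ n)%:C != 0 :> R[i] by rewrite fmorph_eq0 expf_neq0.
have -> : z * (q ^+ n.+1)%:C = z * (q ^+ n)%:C * q%:C.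
  by rewrite exprSr rmorphM/= mulrA.
rewrite theta_mul ?mulf_neq0// IH// rmorphN rmorphM fmorphV/=.
by rewrite exprS; field; rewrite qn0 z0 expf_neq0.
Qed.

(* The constant is (-1)^j q^(-j(j+1)/2), of which only the square is needed. *)
Lemma theta_expz (j : int) : exists2 c : R, c ^+ 2 = (q ^ (j * (j + 1)))^-1 &
  forall z, z != 0 -> theta q (z / (q ^ j)%:C) = c%:C * z ^ j * theta q z.
Proof.
case: j => n.
  have [c c2 cE] := theta_divX n; exists c => //.
  by rewrite c2; congr (_^-1); rewrite -PoszD -PoszM -exprnP addn1.
have [c c2 cE] := theta_mulX n.+1; exists c.
  rewrite c2; congr (_^-1).
  have -> : Negz n * (Negz n + 1) = (n.+1 * n.+1.-1)%:Z by rewrite /=; lia.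
  by rewrite -exprnP.
by move=> z z0; rewrite -cE// NegzE -exprnN fmorphV invrK.
Qed.

End qpoch_theory.
Arguments cvg_qpoch {R q} q01 z.
Arguments cvg_rpoch {R q} q01 u.

(** * Residues and the weights on D_- *)

Section complex_measurability.
Local Open Scope complex_scope.
Context d (T : measurableType d) {R : realType}.
Implicit Types (F G : T -> R[i]) (z : R[i]).

Definition cmeasurable F :=
  measurable_fun setT (fun x => complex.Re (F x)) /\
  measurable_fun setT (fun x => complex.Im (F x)).

Lemma cmeasurable_cst z : cmeasurable (cst z).
Proof. by split; exact: measurable_cst. Qed.

Lemma cmeasurable_real (f : T -> R) :
  measurable_fun setT f -> cmeasurable (fun x => (f x)%:C).
Proof. by move=> mf; split => //=; exact: measurable_cst. Qed.

Lemma cmeasurableM F G :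
  cmeasurable F -> cmeasurable G -> cmeasurable (fun x => F x * G x).
Proof.
move=> [rF iF] [rG iG]; split.
  rewrite (_ : (fun _ => _) = fun x => complex.Re (F x) * complex.Re (G x) -
      complex.Im (F x) * complex.Im (G x)).
    by apply: measurable_funB; exact: measurable_funM.
  by apply/funext => x; case: (F x) (G x) => [? ?] [? ?].
rewrite (_ : (fun _ => _) = fun x => complex.Re (F x) * complex.Im (G x) +
    complex.Im (F x) * complex.Re (G x)).
  by apply: measurable_funD; exact: measurable_funM.
by apply/funext => x; case: (F x) (G x) => [? ?] [? ?].
Qed.

Lemma cmeasurableD F G :
  cmeasurable F -> cmeasurable G -> cmeasurable (fun x => F x + G x).
Proof.
move=> [rF iF] [rG iG]; split.
  by under eq_fun do rewrite raddfD; exact: measurable_funD.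
by under eq_fun do rewrite raddfD; exact: measurable_funD.
Qed.

Lemma cmeasurableN F : cmeasurable F -> cmeasurable (fun x => - F x).
Proof.
move=> [rF iF]; split.
  by under eq_fun do rewrite raddfN; exact: measurableT_comp.
by under eq_fun do rewrite raddfN; exact: measurableT_comp.
Qed.

Lemma cmeasurableB F G :
  cmeasurable F -> cmeasurable G -> cmeasurable (fun x => F x - G x).
Proof. by move=> mF mG; apply: cmeasurableD => //; exact: cmeasurableN. Qed.

Lemma cmeasurableV F : cmeasurable F -> cmeasurable (fun x => (F x)^-1).
Proof.
move=> [rF iF].
have mn : measurable_fun setT
    (fun x => (complex.Re (F x) ^+ 2 + complex.Im (F x) ^+ 2)^-1).
  apply: (measurableT_comp (f := @GRing.inv R)); first exact: measurable_inv.
  by apply: measurable_funD; exact: measurable_funX.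
split.
  rewrite (_ : (fun _ => _) = fun x => complex.Re (F x) *
     (complex.Re (F x) ^+ 2 + complex.Im (F x) ^+ 2)^-1).
    exact: measurable_funM.
  by apply/funext => x; case: (F x).
rewrite (_ : (fun _ => _) = fun x => - (complex.Im (F x) *
   (complex.Re (F x) ^+ 2 + complex.Im (F x) ^+ 2)^-1)).
  by apply: measurableT_comp => //; exact: measurable_funM.
by apply/funext => x; case: (F x).
Qed.

Lemma cmeasurableX F n : cmeasurable F -> cmeasurable (fun x => F x ^+ n).
Proof.
move=> mF; elim: n => [|n IH]; first exact: cmeasurable_cst.
by under eq_fun do rewrite exprS; exact: cmeasurableM.
Qed.

Lemma cmeasurableXz F (n : int) : cmeasurable F -> cmeasurable (fun x => F x ^ n).
Proof.
move=> mF; case: n => n; first exact: cmeasurableX.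
by under eq_fun do rewrite NegzE -exprnN; apply: cmeasurableV; exact: cmeasurableX.
Qed.

Lemma cmeasurable_sum n (F : nat -> T -> R[i]) :
  (forall i, cmeasurable (F i)) -> cmeasurable (fun x => \sum_(i < n) F i x).
Proof.
move=> mF; elim: n => [|n IH].
  by under eq_fun do rewrite big_ord0; exact: cmeasurable_cst.
by under eq_fun do rewrite big_ord_recr; exact: cmeasurableD.
Qed.

Lemma cmeasurable_prod n (F : nat -> T -> R[i]) :
  (forall i, cmeasurable (F i)) -> cmeasurable (fun x => \prod_(i < n) F i x).
Proof.
move=> mF; elim: n => [|n IH].
  by under eq_fun do rewrite big_ord0; exact: cmeasurable_cst.
by under eq_fun do rewrite big_ord_recr; exact: cmeasurableM.
Qed.

Lemma cmeasurable_horner (p : {poly R[i]}) F :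
  cmeasurable F -> cmeasurable (fun x => p.[F x]).
Proof.
move=> mF; under eq_fun do rewrite horner_coef.
apply: (@cmeasurable_sum _ (fun i x => p`_i * F x ^+ i)) => i.
by apply: cmeasurableM; [exact: cmeasurable_cst|exact: cmeasurableX].
Qed.

Lemma cmeasurable_cabs F : cmeasurable F -> measurable_fun setT (fun x => cabs (F x)).
Proof.
move=> [rF iF]; under eq_fun do rewrite cabsE.
apply: (measurableT_comp (f := @Num.sqrt R)).
  by apply: continuous_measurable_fun; exact: sqrt_continuous.
by apply: measurable_funD; exact: measurable_funX.
Qed.

Lemma cmeasurable_qpoch (q : R) F : 0 < q < 1 ->
  cmeasurable F -> cmeasurable (fun x => qpoch q (F x)).
Proof.
move=> q01 mF.
have mP n : cmeasurable (fun x => \prod_(i < n) (1 - F x * (q ^+ i)%:C)).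
  apply: (@cmeasurable_prod _ (fun i x => 1 - F x * (q ^+ i)%:C)) => i.
  apply: cmeasurableB; first exact: cmeasurable_cst.
  by apply: cmeasurableM => //; exact: cmeasurable_cst.
split.
  apply: (measurable_fun_cvg (fun n => (mP n).1)) => x _.
  exact: (cvg_Re (cvg_qpoch q01 _)).
apply: (measurable_fun_cvg (fun n => (mP n).2)) => x _.
exact: (cvg_Im (cvg_qpoch q01 _)).
Qed.

Lemma cmeasurable_theta (q : R) F : 0 < q < 1 ->
  cmeasurable F -> cmeasurable (fun x => theta q (F x)).
Proof.
move=> q01 mF; apply: cmeasurableM; apply: cmeasurable_qpoch => //.
by apply: cmeasurableM; [exact: cmeasurable_cst|exact: cmeasurableV].
Qed.

Lemma measurable_cmeasurable F : measurable_fun setT F -> cmeasurable F.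
Proof.
move=> mF; split.
  apply: (measurableT_comp (f := @complex.Re R)) => //.
  apply: (measurability _ (measurable_realfun.RGenOInfty.measurableE R)) => //.
  move=> _ [_ [x ->] <-]; rewrite setTI; apply: sub_sigma_algebra.
  by apply: open_comp => // z _; exact: (@cvg_Re R R[i] (nbhs z) _ id z (@cvg_id _ (nbhs z))).
apply: (measurableT_comp (f := @complex.Im R)) => //.
apply: (measurability _ (measurable_realfun.RGenOInfty.measurableE R)) => //.
move=> _ [_ [x ->] <-]; rewrite setTI; apply: sub_sigma_algebra.
by apply: open_comp => // z _; exact: (@cvg_Im R R[i] (nbhs z) _ id z (@cvg_id _ (nbhs z))).
Qed.

End complex_measurability.

Lemma cmeasurable_id (R : realType) : cmeasurable (@id R[i]).
Proof. by apply: measurable_cmeasurable; exact: measurable_id. Qed.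

Section residues.
Local Open Scope complex_scope.
Context {R : realType}.
Implicit Types (f g : R[i] -> R[i]) (z : R[i]).

(** Uniform convergence of the integrands. For r near 0 the function [h r] is close to a constant,
    hence bounded, so measurability is enough to make it integrable. *)
Lemma Rintegral_02pi_cvg (h : R -> R -> R) (l : R) :
  (forall r, measurable_fun setT (h r)) ->
  (forall e : R, 0 < e -> \forall r \near 0^'+, forall th, `|h r th - l| <= e) ->
  (\int[lebesgue_measure]_(th in `[0, 2 * pi]) h r th) @[r --> 0^'+] -->
    2 * pi * l.
Proof.
move=> mh hl.
have pi2 : 0 < 2 * pi :> R by rewrite mulr_gt0// pi_gt0.
have mI : (lebesgue_measure (`[0%R, (2 * pi)%R]%classic : set R) = (2 * pi)%:E)%E.
  by rewrite lebesgue_measure_itv/= lte_fin pi2 oppr0 addr0.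
have mIoo : (lebesgue_measure (`[0%R, (2 * pi)%R]%classic : set R) < +oo)%E.
  by rewrite mI ltry.
have cstI (k : R) : \int[lebesgue_measure]_(th in `[0, 2 * pi]) k = 2 * pi * k.
  by rewrite Rintegral_cst//= mI mulrC.
have icst (k : R) : lebesgue_measure.-integrable `[0, 2 * pi] (EFin \o (fun _ => k)).
  by apply: measurable_bounded_integrable => //; exact: bounded_cst.
apply/cvgrPdist_le => e e0.
have e1 : 0 < e / (2 * pi) by rewrite divr_gt0.
apply: filterS (hl _ e1) => r hr.
have ih : lebesgue_measure.-integrable `[0, 2 * pi] (EFin \o h r).
  apply: measurable_bounded_integrable => //.
    by apply: measurable_funTS; exact: mh.
  exists (`|l| + e / (2 * pi)); split; first by rewrite num_real.
  move=> x hx th _ /=; apply: le_trans (ltW hx).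
  rewrite -[X in `|X|](subrK l) addrC (le_trans (ler_normD _ _))//.
  by rewrite lerD2l hr.
have up : \int[lebesgue_measure]_(th in `[0, 2 * pi]) h r th <=
    2 * pi * (l + e / (2 * pi)).
  rewrite -cstI; apply: le_Rintegral => // th _.
  by have := hr th; rewrite ler_distl => /andP[_]; rewrite addrC.
have lo : 2 * pi * (l - e / (2 * pi)) <=
    \int[lebesgue_measure]_(th in `[0, 2 * pi]) h r th.
  rewrite -cstI; apply: le_Rintegral => // th _.
  by have := hr th; rewrite ler_distl => /andP[].
have eE : 2 * pi * (e / (2 * pi)) = e by rewrite mulrC divfK// gt_eqF.
rewrite ler_distl; move: up lo eE.
set I := Rintegral _ _ _; move: (e / _) => e' up lo eE.
by apply/andP; split; lra.
Qed.

Lemma cabs_expi (th : R) : cabs (expi th) = 1.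
Proof. by rewrite cabsE/= cos2Dsin2 sqrtr1. Qed.

(** On a circle around z the factor [w - z] cancels against dw and leaves [i g], which tends
    uniformly to [i g(z)] by continuity at z. The limit in the radius thus does the work of Cauchy's
    theorem. *)
Lemma residue_simple_pole f g z (d : R) : 0 < d ->
  (forall w, 0 < cabs (w - z) < d -> f w = g w / (w - z)) ->
  g w @[w --> z] --> g z ->
  (forall r : R, cmeasurable (fun th => g (z + r%:C * expi th))) ->
  residue f z = g z.
Proof.
move=> d0 fg gz mg; apply/cvg_lim; first exact: norm_hausdorff.
pose G r th := 'i%C * g (z + r%:C * expi th).
have near_G (e : R) : 0 < e -> \forall r \near 0^'+, forall th,
    cabs (G r th - 'i%C * g z) <= e.
  move=> e0; move/cvgrPdist_lt : gz => /(_ e%:C); rewrite ltcR => /(_ e0).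
  move=> /nbhs_ballP[/= [r0 r0']]; rewrite ltcE/= => /andP[/eqP r0'0 r00] hr.
  near=> r => th.
  have r_gt0 : 0 < r by near: r; exact: nbhs_right_gt.
  have r_lt : r < r0 by near: r; exact: nbhs_right_lt.
  rewrite /G -mulrBr cabsM.
  have -> : cabs 'i%C = 1 :> R by rewrite cabsE/= expr0n/= expr1n add0r sqrtr1.
  rewrite mul1r -cabsN opprB -lecR -normc_cabs; apply/ltW/hr.
  rewrite -ball_normE/= opprD addrA subrr sub0r normrN normc_cabs cabsM cabs_expi.
  rewrite mulr1 cabsR r0'0 ltcR gtr0_norm//.
have mG r : cmeasurable (G r) by apply: cmeasurableM => //; exact: cmeasurable_cst.
have ReC := Rintegral_02pi_cvg (fun r => (mG r).1).
have ImC := Rintegral_02pi_cvg (fun r => (mG r).2).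
have cc : cRintegral `[0, 2 * pi] (G r) @[r --> 0^'+] -->
    (2 * pi)%:C * ('i%C * g z).
  apply: cvg_complex.
    have -> : complex.Re ((2 * pi)%:C * ('i%C * g z)) = 2 * pi * complex.Re ('i%C * g z).
      by case: ('i%C * g z) => x y /=; rewrite mul0r subr0.
    apply: ReC => e /near_G; apply: filterS => r + th => /(_ th).
    by apply: le_trans; rewrite -raddfB cabsE -sqrtr_sqr ler_wsqrtr// lerDl sqr_ge0.
  have -> : complex.Im ((2 * pi)%:C * ('i%C * g z)) = 2 * pi * complex.Im ('i%C * g z).
    by case: ('i%C * g z) => x y /=; rewrite mul0r addr0.
  apply: ImC => e /near_G; apply: filterS => r + th => /(_ th).
  by apply: le_trans; rewrite -raddfB cabsE -sqrtr_sqr ler_wsqrtr// lerDr sqr_ge0.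
have i0 : 'i%C != 0 :> R[i] by rewrite eq_complex/= oner_eq0 andbF.
have pi0 : pi%:C != 0 :> R[i] by rewrite fmorph_eq0 gt_eqF// pi_gt0.
have -> : g z = (2 * pi%:C * 'i%C)^-1 * ((2 * pi)%:C * ('i%C * g z)).
  have -> : (2 * pi)%:C = 2 * pi%:C :> R[i] by rewrite rmorphM/= rmorph_nat.
  by move: i0 pi0; move: 'i%C pi%:C => i p i0 p0; field; rewrite i0 p0.
apply: cvgM; first exact: cvg_cst.
apply: cvg_trans cc; apply: near_eq_cvg; near=> r.
rewrite /circle_integral; congr cRintegral; apply/funext => th.
have r0 : 0 < r by near: r; exact: nbhs_right_gt.
have zr : z + r%:C * expi th - z = r%:C * expi th by rewrite addrC addKr.
rewrite fg; last first.
  rewrite zr cabsM cabs_expi mulr1 cabsR gtr0_norm// r0/=.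
  by near: r; exact: nbhs_right_lt.
have X0 : r%:C * expi th != 0 by rewrite -cabs_gt0 cabsM cabs_expi mulr1 cabsR normr_gt0 gt_eqF.
by rewrite zr /G -(mulrA 'i%C) mulrCA divfK.
Unshelve. all: by end_near. Qed.

End residues.

Section minus_weights.
Local Open Scope complex_scope.
Context {R : realType} (q : R) (q01 : 0 < q < 1).
Implicit Types (a b c d t D x : R) (j : int) (z w : R[i]).

Let q0 : 0 < q. Proof. by case/andP: q01. Qed.
Let q1 : q < 1. Proof. by case/andP: q01. Qed.
Let q_neq0 : q != 0. Proof. by rewrite gt_eqF. Qed.
Local Notation rp := (rpoch q).
Local Notation qp := (qpoch q).

Lemma cvg_complexM (T : Type) (F : set_system T) {FF : Filter F}
    (f g : T -> R[i]) (l m : R[i]) :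
  f x @[x --> F] --> l -> g x @[x --> F] --> m -> f x * g x @[x --> F] --> l * m.
Proof. exact: cvgM. Qed.

Lemma cvg_complexV (T : Type) (F : set_system T) {FF : Filter F}
    (f : T -> R[i]) (l : R[i]) :
  l != 0 -> f x @[x --> F] --> l -> (f x)^-1 @[x --> F] --> l^-1.
Proof. exact: cvgV. Qed.

Lemma cvg_comp_theta (T : Type) (F : set_system T) {FF : Filter F}
    (f : T -> R[i]) (l : R[i]) :
  l != 0 -> f x @[x --> F] --> l -> theta q (f x) @[x --> F] --> theta q l.
Proof.
move=> l0 fl; rewrite /theta; apply: cvg_complexM; apply: (cvg_comp_qpoch q01).
  exact: fl.
by apply: cvg_complexM; [exact: cvg_cst|exact: cvg_complexV].
Qed.

Lemma cvg_comp_expz (K : numFieldType) (T : Type) (F : set_system T) {FF : Filter F}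
    (f : T -> K) (l : K) j :
  l != 0 -> f x @[x --> F] --> l -> f x ^ j @[x --> F] --> l ^ j.
Proof.
move=> l0 fl.
have fX n : f x ^+ n @[x --> F] --> l ^+ n.
  elim: n => [|n IH]; first exact: cvg_cst.
  rewrite exprS (_ : (fun y : T => _) = fun y : T => f y * f y ^+ n).
    exact: cvgM.
  by apply/funext => y; rewrite exprS.
by case: j => n; [exact: fX|apply: cvgV => //; rewrite expf_neq0].
Qed.

(** Residue of W(y)/y at y = D q^j, where D stands for d t. The factors (x^2, q/x^2; q)_oo have been
    cancelled against theta(D x), leaving [1 - x^-2]; the formula is therefore continuous also where
    D^2 is a power of q, which is what extending the weights requires. *)
Definition residue_val j a b c d D : R :=
  let x := D * q ^ j in
  (1 - x ^- 2) * (rp (q * x / d) * rp (q / (d * x))) * q ^ (j * (j + 1)) /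
  (x ^ j * x ^ j * (rp (a * x) * rp (a / x)) * (rp (b * x) * rp (b / x)) *
   (rp (c * x) * rp (c / x)) * (rp q) ^+ 2).

(* [W y / y] times [y - y0], as a function without singularity at the pole
   [y0 = D q^j] of [1 / theta (D / y)]; [k] is the constant of [theta_expz]. *)
Let g j (k : R) a b c d D (y0 : R[i]) w :=
  (qp (w ^+ 2) * qp (w ^- 2)) /
   (qp (a%:C * w) * qp (a%:C / w) * (qp (b%:C * w) * qp (b%:C / w)) *
    (qp (c%:C * w) * qp (c%:C / w)) * (qp (d%:C * w) * qp (d%:C / w))) *
   ((theta q (d%:C * w) * theta q (d%:C / w)) /
    (theta q (D%:C * w) * (k%:C * (y0 / w) ^ j * (qp (y0 / w * q%:C) * qp (q%:C / (y0 / w)))))).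

Let g_measurable j k a b c d D y0 (f : R -> R[i]) : cmeasurable f ->
  cmeasurable (fun th => g j k a b c d D y0 (f th)).
Proof.
move=> mf.
have mM z : cmeasurable (fun th => z * f th).
  by apply: cmeasurableM => //; exact: cmeasurable_cst.
have mV z : cmeasurable (fun th => z / f th).
  by apply: cmeasurableM; [exact: cmeasurable_cst|exact: cmeasurableV].
have mQ z : cmeasurable (fun th => qp (z * f th) * qp (z / f th)).
  by apply: cmeasurableM; exact: cmeasurable_qpoch.
apply: cmeasurableM; apply: cmeasurableM.
- apply: cmeasurableM; apply: cmeasurable_qpoch => //; first exact: cmeasurableX.
  by apply: cmeasurableV; exact: cmeasurableX.
- by apply: cmeasurableV; do 3![apply: cmeasurableM => //].
- by apply: cmeasurableM; exact: cmeasurable_theta.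
- apply: cmeasurableV; apply: cmeasurableM; first exact: cmeasurable_theta.
  apply: cmeasurableM.
    by apply: cmeasurableM; [exact: cmeasurable_cst|exact: cmeasurableXz].
  apply: cmeasurableM; apply: cmeasurable_qpoch => //.
    by apply: cmeasurableM => //; exact: cmeasurable_cst.
  by apply: cmeasurableM; [exact: cmeasurable_cst|exact: cmeasurableV].
Qed.

Let rpN u : u < 1 -> rp u != 0.
Proof. by move=> u1; rewrite gt_eqF// rpoch_gt0. Qed.

Lemma residue_W j a b c d t : 0 < a -> 0 < b -> 0 < c -> 0 < d -> t < 0 ->
  (forall n : int, (d * t) ^+ 2 != q ^ n) ->
  residue (fun y => W q (a, b, c, d, t) y / y) (d * t * q ^ j)%:C =
  (residue_val j a b c d (d * t))%:C.
Proof.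
move=> a0 b0 c0 d0 t0 Dq; set D := d * t; set x := D * q ^ j.
have D0 : D < 0 by rewrite pmulr_rlt0.
have qj0 : 0 < q ^ j by rewrite exprz_gt0.
have x0 : x < 0 by rewrite pmulr_llt0.
have xn0 : x != 0 by rewrite lt_eqF.
have xc0 : x%:C != 0 :> R[i] by rewrite fmorph_eq0.
have qc0 : q%:C != 0 :> R[i] by rewrite fmorph_eq0.
have [k k2 kE] := theta_expz q01 j.
have k0 : k != 0.
  by rewrite -sqrf_eq0 k2 invr_eq0 gt_eqF// exprz_gt0.
have neg (u : R) : 0 < u -> u * x < 1 /\ u / x < 1.
  move=> u0; split; apply: (@lt_trans _ _ 0) => //; first by rewrite pmulr_rlt0.
  by rewrite pmulr_rlt0// invr_lt0.
(* Since x = D q^j, a power of q equal to x^2 would make D^2 one. So neither (x^2; q)_oo nor (q/x^2;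
   q)_oo vanishes, and theta(D x) is nonzero. *)
have x2 (n : int) : x ^+ 2 != q ^ n.
  apply: contra (Dq (n - j - j)) => /eqP xn; apply/eqP.
  rewrite -/D !expfzDr// -xn /x -!invr_expz.
  by have := gt_eqF qj0; move: (q ^ j) => y /negbT y0; field.
have rx2 : rp (x ^+ 2) != 0.
  have : qp (x ^+ 2)%:C != 0.
    apply: qpoch_neq0 => // i; rewrite -rmorphM/= -(rmorph1 (real_complex R)).
    rewrite (inj_eq (@complexI R)); apply: contra (x2 (- i%:Z)) => /eqP xi.
    by rewrite -invr_expz -exprnP -[X in _ == X]mul1r -xi mulfK// expf_neq0.
  by rewrite qpoch_real// fmorph_eq0.
have rqx2 : rp (q / x ^+ 2) != 0.
  have : qp (q / x ^+ 2)%:C != 0.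
    apply: qpoch_neq0 => // i; rewrite -rmorphM/= -(rmorph1 (real_complex R)).
    rewrite (inj_eq (@complexI R)); apply: contra (x2 i.+1) => /eqP xi.
    have x2n0 : x ^+ 2 != 0 by rewrite expf_neq0.
    apply/eqP; rewrite -exprnP [in RHS]exprS.
    transitivity (x ^+ 2 * (q / x ^+ 2 * q ^+ i)); first by rewrite xi mulr1.
    by move: x2n0; move: (x ^+ 2) (q ^+ i) => u v u0; field.
  by rewrite qpoch_real// fmorph_eq0.
(* As D x = x^2 / q^j, quasi-periodicity reduces this theta function to theta(x^2), which is to
   cancel against (x^2, 1/x^2; q)_oo in Delta. *)
have thDx : theta q (D * x)%:C =
    (k * (x ^+ 2) ^ j * (rp (x ^+ 2) * rp (q / x ^+ 2)))%:C.
  have -> : (D * x)%:C = (x ^+ 2)%:C / (q ^ j)%:C :> R[i].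
    rewrite -fmorphV -rmorphM/=; congr _%:C; have qjn0 : q ^ j != 0 by rewrite gt_eqF.
    by apply: (mulIf qjn0); rewrite divfK// mulrAC -/x -expr2.
  rewrite kE ?fmorph_eq0 ?expf_neq0// /theta -fmorphV -rmorphM/= !qpoch_real//.
  move: (x ^+ 2) => y; rewrite (rmorphM (real_complex R) (k * _)).
  rewrite (rmorphM (real_complex R) k) (rmorphM (real_complex R) (rp y)).
  by rewrite (fmorphXz (real_complex R)).
pose h := g j k a b c d D x%:C.
have gx : h x%:C = (residue_val j a b c d D)%:C.
  rewrite /h /g divff// exp1rz mul1r divr1.
  have M (u : R) : u%:C * x%:C = (u * x)%:C by rewrite (rmorphM (real_complex R) u x).
  have V (u : R) : u%:C / x%:C = (u / x)%:C.
    by rewrite (rmorphM (real_complex R) u x^-1) fmorphV.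
  have X2 : x%:C ^+ 2 = (x ^+ 2)%:C by rewrite rmorphXn.
  have X2V : x%:C ^- 2 = (x ^- 2)%:C by rewrite X2 fmorphV.
  have thE (u : R) : u != 0 -> theta q u%:C = (rp u * rp (q / u))%:C.
    by move=> u0; rewrite /theta -fmorphV -rmorphM/= !qpoch_real// rmorphM.
  have dx0 : d * x != 0 by rewrite mulf_neq0// gt_eqF.
  have dxV0 : d / x != 0 by rewrite mulf_neq0// ?invr_eq0// gt_eqF.
  rewrite X2V X2 !M !V thDx !thE// !qpoch_real// mulr1.
  rewrite -!(rmorphM (real_complex R)) -!(fmorphV (real_complex R)).
  rewrite -!(rmorphM (real_complex R)); congr _%:C; rewrite /residue_val -/x.
  have -> : rp (x ^- 2) = (1 - x ^- 2) * rp (q / x ^+ 2).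
    by rewrite (rpoch_shift q01 1) big_ord1 expr0 mulr1 expr1 (mulrC q).
  have -> : q / (d / x) = q * x / d by rewrite invf_div mulrA.
  have -> : (x ^+ 2) ^ j = x ^ j * x ^ j by rewrite expr2 expfzMl.
  have -> : q ^ (j * (j + 1)) = (k ^+ 2)^-1 by rewrite k2 invrK.
  have [ax aX] := neg _ a0; have [bx bX] := neg _ b0; have [cx cX] := neg _ c0.
  have [dx dX] := neg _ d0.
  have := rpN ax; have := rpN aX; have := rpN bx; have := rpN bX.
  have := rpN cx; have := rpN cX; have := rpN dx; have := rpN dX.
  have xj0 : x ^ j != 0 by rewrite expfz_neq0.
  have := rpN q1; move: rx2 rqx2 xj0.
  move: (rp (x ^+ 2)) (rp (q / x ^+ 2)) (x ^ j) (rp q) => r1 r2 r3 r4.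
  move: (rp (a * x)) (rp (a / x)) (rp (b * x)) (rp (b / x)) => a1 a2 b1 b2.
  move: (rp (c * x)) (rp (c / x)) (rp (d * x)) (rp (d / x)) => c1 c2 d1 d2.
  move: (rp (q * x / d)) (rp (q / (d * x))) (x ^- 2) => e1 e2 e3.
  move=> r10 r20 r30 r40 d20 d10 c20 c10 b20 b10 a20 a10; field.
  by rewrite r10 r20 r30 r40 d20 d10 c20 c10 b20 b10 a20 a10 k0.
rewrite -gx; apply: (@residue_simple_pole _ _ h _ `|x|).
- by rewrite normr_gt0.
- move=> w /andP[w1 w2].
  have w0 : w != 0.
    apply: contraTneq w2 => ->; rewrite sub0r cabsN cabsR ltxx//.
  rewrite /h /g /W /bigDelta /Defs.bigTheta.
  (* D / w = (x/w) / q^j, and theta(x/w) contains the factor 1 - x/w = (w - x)/w: this is the simple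
     pole. *)
  have -> : theta q ((d * t)%:C / w) = k%:C * (x%:C / w) ^ j * (qp (x%:C / w * q%:C) *
      qp (q%:C / (x%:C / w))) * ((w - x%:C) / w).
    have -> : (d * t)%:C / w = x%:C / w / (q ^ j)%:C.
      rewrite (rmorphM (real_complex R) D (q ^ j) : x%:C = D%:C * (q ^ j)%:C).
      by rewrite mulrAC mulfK// fmorph_eq0 gt_eqF.
    have -> : (w - x%:C) / w = 1 - x%:C / w by rewrite mulrBl divff.
    rewrite kE ?mulf_neq0 ?invr_eq0// thetaE//.
    move: (qp _) (qp _) (_ ^ j) (1 - _) => r1 r2 r3 r4.
    by rewrite -!mulrA (mulrC _ r4) !mulrA; ring.
  have E (u v s : R[i]) : u / (v * (s * ((w - x%:C) / w))) / w = u / (v * s) / (w - x%:C).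
    rewrite !(invfM, invf_div) -!mulrA; congr (_ * (_ * (_ * _))).
    by rewrite invrK divff ?mulr1.
  by rewrite -mulrA E mulrA.
- suff : forall F : set_system R[i], Filter F -> w @[w --> F] --> x%:C ->
      h w @[w --> F] --> h x%:C.
    by move=> H; apply: (H _ (nbhs_filter _)); exact: cvg_id.
  move=> F FF cI.
  have cM z : z * w @[w --> F] --> z * x%:C.
    by apply: cvg_complexM; [exact: cvg_cst|exact: cI].
  have cV z : z / w @[w --> F] --> z / x%:C.
    by apply: cvg_complexM; [exact: cvg_cst|apply: cvg_complexV => //; exact: cI].
  have cQ z : qp (z * w) * qp (z / w) @[w --> F] --> qp (z * x%:C) * qp (z / x%:C).
    by apply: cvg_complexM; apply: (cvg_comp_qpoch q01); [exact: cM|exact: cV].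
  have nQ (u : R) : 0 < u -> qp (u%:C * x%:C) * qp (u%:C / x%:C) != 0.
    move=> /neg[u1 u2]; rewrite -fmorphV -!rmorphM/= !qpoch_real//.
    by rewrite -rmorphM fmorph_eq0 mulf_neq0// rpN.
  have c2 : w ^+ 2 @[w --> F] --> x%:C ^+ 2.
    by rewrite expr2; apply: cvg_complexM; exact: cI.
  apply: cvg_complexM; apply: cvg_complexM.
  + apply: cvg_complexM; apply: (cvg_comp_qpoch q01); first exact: c2.
    by apply: cvg_complexV; [rewrite expf_neq0|exact: c2].
  + apply: cvg_complexV.
      by do 3![apply: mulf_neq0; last exact: nQ]; exact: nQ.
    by do 3![apply: cvg_complexM; last exact: cQ]; exact: cQ.
  + have dc0 : d%:C != 0 :> R[i] by rewrite fmorph_eq0 gt_eqF.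
    apply: cvg_complexM; apply: cvg_comp_theta.
    * by rewrite mulf_neq0.
    * exact: cM.
    * by rewrite mulf_neq0// invr_eq0.
    * exact: cV.
  + apply: cvg_complexV.
      rewrite -rmorphM/= thDx divff// exp1rz mul1r divr1 qpoch_real//.
      rewrite !mulf_neq0// fmorph_eq0// ?rpN// !mulf_neq0//.
      by rewrite expfz_neq0// expf_neq0.
    apply: cvg_complexM.
      apply: cvg_comp_theta; last exact: cM.
      by rewrite mulf_neq0// fmorph_eq0 lt_eqF.
    apply: cvg_complexM.
      apply: cvg_complexM; first exact: cvg_cst.
      by apply: cvg_comp_expz; [rewrite divff// oner_eq0|exact: cV].
    apply: cvg_complexM; apply: (cvg_comp_qpoch q01).
      by apply: cvg_complexM; [exact: cV|exact: cvg_cst].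
    apply: cvg_complexM; first exact: cvg_cst.
    by apply: cvg_complexV; [rewrite divff// oner_eq0|exact: cV].
- move=> r; apply: g_measurable; apply: cmeasurableD; first exact: cmeasurable_cst.
  by apply: cmeasurableM; [exact: cmeasurable_cst|exact: cmeas_expi].
Qed.

Lemma cvg_residue_val (T : Type) (F : set_system T) {FF : Filter F}
    (fa fb fc fd fD : T -> R) a b c d D j :
  0 < a -> 0 < b -> 0 < c -> 0 < d -> D < 0 ->
  fa x @[x --> F] --> a -> fb x @[x --> F] --> b -> fc x @[x --> F] --> c ->
  fd x @[x --> F] --> d -> fD x @[x --> F] --> D ->
  residue_val j (fa x) (fb x) (fc x) (fd x) (fD x) @[x --> F] -->
  residue_val j a b c d D.
Proof.
move=> a0 b0 c0 d0 D0 ca cb cc cd cD; rewrite /residue_val.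
have X : fD x * q ^ j @[x --> F] --> D * q ^ j.
  by apply: cvgM => //; exact: cvg_cst.
set x := D * q ^ j in X *.
have x0 : x < 0 by rewrite pmulr_llt0// exprz_gt0.
have xn0 : x != 0 by rewrite lt_eqF.
have neg (u : R) : 0 < u -> u * x < 1 /\ u / x < 1.
  move=> u0; split; apply: (@lt_trans _ _ 0) => //; first by rewrite pmulr_rlt0.
  by rewrite pmulr_rlt0// invr_lt0.
have cQ (f : T -> R) (u : R) : f x @[x --> F] --> u ->
    rp (f y * (fD y * q ^ j)) * rp (f y / (fD y * q ^ j)) @[y --> F] -->
    rp (u * x) * rp (u / x).
  move=> fu; apply: cvgM; apply: cvg_comp_rpoch => //; first exact: cvgM.
  by apply: cvgM => //; exact: cvgV.
have nQ (u : R) : 0 < u -> rp (u * x) * rp (u / x) != 0.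
  by move=> /neg[u1 u2]; rewrite mulf_neq0// rpN.
apply: cvgM.
  apply: cvgM; last exact: cvg_cst.
  apply: cvgM.
    apply: cvgB; first exact: cvg_cst.
    by apply: cvgV; [rewrite expf_neq0|apply: (cvg_comp_expz (j := 2%:Z))].
  apply: cvgM; apply: cvg_comp_rpoch => //.
    apply: cvgM; first by apply: cvgM => //; exact: cvg_cst.
    by apply: cvgV => //; rewrite gt_eqF.
  apply: cvgM; first exact: cvg_cst.
  by apply: cvgV; [rewrite mulf_neq0// gt_eqF|exact: cvgM].
apply: cvgV.
  apply/mulf_neq0; last by rewrite expf_neq0// rpN.
  do 3![apply/mulf_neq0; last exact: nQ].
  by rewrite mulf_neq0// expfz_neq0.
apply: cvgM; last exact: cvg_cst.
apply: cvgM; last exact: cQ.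
apply: cvgM; last exact: cQ.
apply: cvgM; last exact: cQ.
by apply: cvgM; exact: cvg_comp_expz.
Qed.

(** An interval has positive Lebesgue measure and a countable set has none. The index [k] lets
    several families of forbidden values be avoided at once. *)
Lemma avoid_countable (u v : R) (F : nat -> int -> R) : u < v ->
  exists2 x, u < x < v & forall k n, x != F k n.
Proof.
move=> uv; apply: contrapT => h.
pose S := range (fun p : nat * int => F p.1 p.2).
have cS : countable S by apply: sub_countable (countableP (@setT (nat * int)%type)); exact: card_image_le.
have : `]u, v[ `<=` S.
  move=> x /=; rewrite in_itv/= => xuv; apply: contrapT => xS; apply: h; exists x => //.
  by move=> k n; apply/negP => /eqP xE; apply: xS; exists (k, n).
move=> sub; have cI : countable `]u, v[%classic.
  by apply: sub_countable cS; exact: subset_card_le.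
have := countable_lebesgue_measure0 cI.
rewrite lebesgue_measure_itv/= lte_fin uv -EFinB => /eqP.
by rewrite eqe subr_eq0 gt_eqF.
Qed.

(** The constraints that may be tight are [b, c <= a] and [q <= bd, cd]. They survive when b and c
    are raised by less than h, a by more than h, and d is kept; the strict ones survive for small h.
    The coordinates are chosen successively, each avoiding the countably many values that the
    earlier ones forbid. *)
Lemma generic_dense beta : admissible q beta -> closure (generic q) beta.
Proof.
case: beta => [[[[a b] c] d] t] [t0 [b0 c0 ba ca] ad [bd cd] [ab ac]].
have a0 : 0 < a := lt_le_trans b0 ba.
have d0 : 0 < d by have := lt_trans a0 ad; rewrite pmulr_lgt0// invr_gt0.
move=> B /nbhs_ballP[e /= e0 eB].
have [h [[h0 he] [hd [hb hc]] h1]] : exists h : R, [/\ 0 < h /\ h < e / 3,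
    h < (d / q - a) / 3 /\ h < (1 - a * b) / (4 * (a + b + 2)) /\
      h < (1 - a * c) / (4 * (a + c + 2)) & h < 1 / 4].
  have ac0 (u : R) : 0 < u -> 0 < a + u + 2 by move=> u0; rewrite !addr_gt0.
  apply: (@filter_ex _ (0 : R)^'+); near=> h.
  split; [split|split; [|split]|]; near: h.
  - exact: nbhs_right_gt.
  - by apply: nbhs_right_lt; rewrite divr_gt0.
  - by apply: nbhs_right_lt; rewrite divr_gt0// subr_gt0.
  - by apply: nbhs_right_lt; rewrite divr_gt0 ?subr_gt0// mulr_gt0// ac0.
  - by apply: nbhs_right_lt; rewrite divr_gt0 ?subr_gt0// mulr_gt0// ac0.
  - exact: nbhs_right_lt.
pose s (n : int) : R := Num.sqrt (q ^ n).
have sE (u : R) n : 0 < u -> u != s n -> u ^+ 2 != q ^ n.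
  by move=> u0; apply: contra => /eqP un; rewrite /s -un sqrtr_sqr gtr0_norm.
have dE (u v : R) n : 0 < v -> u != q ^ n / v -> u * v != q ^ n.
  by move=> v0; apply: contra => /eqP <-; rewrite mulfK// gt_eqF.
have mE (u v : R) n : 0 < v -> u != q ^ n * v -> u / v != q ^ n.
  by move=> v0; apply: contra => /eqP <-; rewrite divfK// gt_eqF.
have [c' /andP[c1 c2] cF] : exists2 x, c < x < c + h & forall (k : nat) n, x != s n.
  by apply: avoid_countable; rewrite ltrDl.
have c'0 := lt_trans c0 c1.
have [b' /andP[b1 b2] bF] : exists2 x, b < x < b + h & forall k n,
    x != nth 0 [:: s n; q ^ n / c'; q ^ n * c'] k.
  by apply: (avoid_countable (fun k n => nth 0 [:: s n; q ^ n / c'; q ^ n * c'] k));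
    rewrite ltrDl.
have b'0 := lt_trans b0 b1.
have [a' /andP[a1 a2] aF] : exists2 x, a + h < x < a + 2 * h & forall k n,
    x != nth 0 [:: s n; q ^ n / c'; q ^ n * c'; q ^ n / b'; q ^ n * b'] k.
  apply: (avoid_countable (fun k n =>
    nth 0 [:: s n; q ^ n / c'; q ^ n * c'; q ^ n / b'; q ^ n * b'] k)); lra.
have a'0 : 0 < a' by rewrite (lt_trans _ a1)// addr_gt0.
have [t' /andP[t1 t2] tF] : exists2 x, t < x < Num.min 0 (t + e) &
    forall (k : nat) n, x != - (s n / d).
  by apply: avoid_countable; rewrite lt_min t0 ltrDl.
have t'0 : t' < 0 by move: t2; rewrite lt_min => /andP[].
have t'e : t' < t + e by move: t2; rewrite lt_min => /andP[].
(* [(a + 2h)(u + h)] exceeds [a u] by [h (a + 2u + 2h)], which is less than [4h (a + u + 2)] because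
   h < 1/4. *)
have prod1 (u u' : R) : 0 < u -> a * u < 1 -> h < (1 - a * u) / (4 * (a + u + 2)) ->
    u < u' < u + h -> a' * u' < 1.
  move=> u0 au; have K0 : 0 < 4 * (a + u + 2) by rewrite mulr_gt0// !addr_gt0.
  rewrite ltr_pdivlMr// => hu /andP[u1 u2].
  have : a' * u' <= (a + 2 * h) * (u + h) by apply: ler_pM; apply: ltW => //; exact: lt_trans u1.
  move=> /le_lt_trans; apply.
  have hh : h * h < h * (1 / 4) by rewrite ltr_pM2l.
  by have := mulr_gt0 h0 a0; have := mulr_gt0 h0 u0; lra.
exists (a', b', c', d, t'); split; last first.
  apply: eB; split; [split; [split; [split|]|]|] => /=.
  - by rewrite -ball_normE/= ltr_distlC; apply/andP; split; lra.
  - by rewrite -ball_normE/= ltr_distlC; apply/andP; split; lra.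
  - by rewrite -ball_normE/= ltr_distlC; apply/andP; split; lra.
  - exact: ballxx.
  - by rewrite -ball_normE/= ltr_distlC; apply/andP; split; lra.
split.
  split => //.
  - by split => //; apply: ltW; lra.
  - lra.
  - split; [apply: (le_trans bd)|apply: (le_trans cd)]; rewrite ler_pM2r//; exact: ltW.
  - by split; [apply: (prod1 b)|apply: (prod1 c)] => //; apply/andP; split.
move=> u n; rewrite !inE => /or4P[/eqP->|/eqP->|/eqP->|].
- by apply: sE => //; exact: (aF 0%N).
- by apply: sE => //; exact: (bF 0%N).
- by apply: sE => //; exact: (cF 0%N).
move=> /or4P[/eqP->|/eqP->|/eqP->|].
- by apply: dE => //; exact: (aF 3%N).
- by apply: dE => //; exact: (aF 1%N).
- by apply: dE => //; exact: (bF 1%N).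
move=> /or4P[/eqP->|/eqP->|/eqP->|/eqP->].
- by apply: mE => //; exact: (aF 4%N).
- by apply: mE => //; exact: (aF 2%N).
- by apply: mE => //; exact: (bF 2%N).
apply/eqP => dt; have /eqP := tF 0%N n; apply.
by rewrite /s -dt sqrtr_sqr ltr0_norm ?pmulr_rlt0// mulNr opprK mulrC mulKf// gt_eqF.
Unshelve. all: by end_near. Qed.

Lemma cvg_pair1 (U V : topologicalType) (T : Type) (F : set_system T)
    {FF : Filter F} (f : T -> U * V) (p : U * V) :
  f x @[x --> F] --> p -> (f x).1 @[x --> F] --> p.1.
Proof. by move=> fp; apply: (cvg_comp f fst fp); exact: cvg_fst. Qed.

Lemma cvg_pair2 (U V : topologicalType) (T : Type) (F : set_system T)
    {FF : Filter F} (f : T -> U * V) (p : U * V) :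
  f x @[x --> F] --> p -> (f x).2 @[x --> F] --> p.2.
Proof. by move=> fp; apply: (cvg_comp f snd fp); exact: cvg_snd. Qed.

(** Density of the generic parameters makes the filter in [ext_residue] proper, so its limit is
    unique and is found by continuity of [residue_val]. *)
Lemma ext_residue_pole_minus j a b c d t :
  admissible q (a, b, c, d, t) ->
  ext_residue q (pole_minus q j) (a, b, c, d, t) =
  (residue_val j a b c d (d * t))%:C.
Proof.
move=> adm; have cl := generic_dense adm.
have [t0 [b0 c0 ba ca] ad [bd cd] [ab ac]] := adm.
have a0 : 0 < a := lt_le_trans b0 ba.
have d0 : 0 < d by have := lt_trans a0 ad; rewrite pmulr_lgt0// invr_gt0.
have PF : ProperFilter (within (generic q) (nbhs ((a, b, c, d, t) : params R))).
  exact: within_nbhs_proper.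
set F := within _ _ in PF *.
have h1 : x.1 @[x --> F] --> (a, b, c, d).
  by apply: cvg_within_filter; exact: cvg_fst.
have FF : Filter F by exact: filter_filter.
have h2 := @cvg_pair1 _ _ _ _ FF _ _ h1; have h3 := @cvg_pair1 _ _ _ _ FF _ _ h2.
have ca' := @cvg_pair1 _ _ _ _ FF _ _ h3; have cb' := @cvg_pair2 _ _ _ _ FF _ _ h3.
have cc' := @cvg_pair2 _ _ _ _ FF _ _ h2; have cd' := @cvg_pair2 _ _ _ _ FF _ _ h1.
have ct' : x.2 @[x --> F] --> t by apply: cvg_within_filter; exact: cvg_snd.
apply/cvg_lim; first exact: norm_hausdorff.
have dt0 : d * t < 0 by rewrite pmulr_rlt0.
have := @cvg_real_complex R _ _ FF _ _ (@cvg_residue_val _ _ FF _ _ _ _ _ _ _ _ _ _ j a0 b0 c0 d0 dt0 ca' cb' cc' cd' (cvgM cd' ct')).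
move=> /(_ FF); apply: cvg_trans; apply: near_eq_cvg.
have gF : F (generic q) by exact: withinT.
apply: filterS gF => -[[[[a' b'] c'] d'] t'] [[t'0 [b'0 c'0 ba' ca''] ad' _ _] g'] /=.
have a'0 : 0 < a' := lt_le_trans b'0 ba'.
rewrite residue_W//.
  by have := lt_trans a'0 ad'; rewrite pmulr_lgt0// invr_gt0.
by move=> n; apply: g'; rewrite !inE eqxx !orbT.
Qed.

(** Hence the modulus in [minus_weight] does not alter the residue. *)
Lemma residue_val_gt0 j a b c d D : 0 < a -> 0 < b -> 0 < c -> 0 < d ->
  D * q ^ j < -1 -> 0 < residue_val j a b c d D.
Proof.
move=> a0 b0 c0 d0; rewrite /residue_val; set x := D * q ^ j => x1.
have x0 : x < 0 by rewrite (lt_trans x1)// ltrN10.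
have xn0 : x != 0 by rewrite lt_eqF.
have neg (u : R) : 0 < u -> u * x < 1 /\ u / x < 1.
  move=> u0; split; apply: (@lt_trans _ _ 0) => //; first by rewrite pmulr_rlt0.
  by rewrite pmulr_rlt0// invr_lt0.
have pQ (u : R) : 0 < u -> 0 < rp (u * x) * rp (u / x).
  by move=> /neg[u1 u2]; rewrite mulr_gt0// rpoch_gt0.
rewrite divr_gt0//.
  rewrite mulr_gt0 ?exprz_gt0// mulr_gt0//.
    rewrite subr_gt0 invf_lt1 ?exprn_even_gt0//.
    by rewrite -sqrrN expr_gt1 ?oppr_ge0 ?(ltW x0)// ltrNr.
  rewrite mulr_gt0// rpoch_gt0//; apply: (@lt_trans _ _ 0) => //.
    by rewrite pmulr_llt0 ?invr_gt0// pmulr_rlt0.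
  by rewrite pmulr_rlt0// invr_lt0 pmulr_rlt0.
rewrite mulr_gt0 ?exprn_gt0 ?rpoch_gt0//.
do 3![rewrite mulr_gt0 ?pQ//].
by rewrite -expr2 exprn_even_gt0// expfz_neq0.
Qed.

Lemma minus_weightE j a b c d t : admissible q (a, b, c, d, t) ->
  minus_weight q (a, b, c, d, t) j =
  if d * t * q ^ j < -1 then residue_val j a b c d (d * t) / 2 else 0.
Proof.
move=> adm; rewrite /minus_weight /= ext_residue_pole_minus//.
case: ifPn => // x1; rewrite cabsR ger0_norm//; apply: ltW.
have [t0 [b0 c0 ba ca] ad _ _] := adm.
have a0 : 0 < a := lt_le_trans b0 ba.
apply: residue_val_gt0 => //.
by have := lt_trans a0 ad; rewrite pmulr_lgt0// invr_gt0.
Qed.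

End minus_weights.

(** * Growth of the weights and of G^tau along D_- *)

Section strange_weights.
Context {R : realType} (q : R) (q01 : 0 < q < 1).

Let q0 : 0 < q. Proof. by case/andP: q01. Qed.
Let q1 : q < 1. Proof. by case/andP: q01. Qed.
Let q_neq0 : q != 0. Proof. by rewrite gt_eqF. Qed.
Local Notation rp := (rpoch q).

(** The number q^(-n(n+1)/2), as a product so that no exponent has to be halved. *)
Definition tri n : R := \prod_(i < n) (q ^+ i.+1)^-1.

Lemma tri_gt0 n : 0 < tri n.
Proof. by apply: prodr_gt0 => i _; rewrite invr_gt0 exprn_gt0. Qed.

Lemma tri_sqr n : tri n ^+ 2 = (q ^+ (n * n.+1))^-1.
Proof.
elim: n => [|n IH]; first by rewrite /tri big_ord0 expr1n invr1.
rewrite /tri big_ord_recr/= exprMn -/(tri n) IH -!exprVn -!exprM -exprD.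
by congr (_ ^+ _); ring.
Qed.

Lemma rpoch_le1 u : 0 <= u <= 1 -> rp u <= 1.
Proof.
move=> /andP[u0 u1]; apply: (cvgr_to_le (cvg_rpoch q01 u)); apply: nearW => n.
apply: prodr_ile1 => i _; rewrite subr_ge0 gerBl.
by rewrite mulr_ge0 ?exprn_ge0 ?(ltW q0)//= andbT mulr_ile1 ?exprn_ge0 ?exprn_ile1 ?(ltW q0) ?(ltW q1).
Qed.

Lemma rpoch_le_prod n : rp q <= \prod_(i < n) (1 - q ^+ i.+1).
Proof.
rewrite (rpoch_shift q01 n); under eq_bigr do rewrite -exprS.
rewrite ler_piMr//.
  by apply: prodr_ge0 => i _; rewrite subr_ge0 exprn_ile1// ltW.
by apply: rpoch_le1; rewrite -exprS exprn_ge0 ?exprn_ile1// ltW.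
Qed.

Lemma rpochN_divS n v :
  rp (- (v / q ^+ n.+1)) = (1 + v / q ^+ n.+1) * rp (- (v / q ^+ n)).
Proof.
rewrite (rpoch_shift q01 1) big_ord1 expr0 mulr1 opprK expr1; congr (_ * rp _).
by rewrite exprSr; field; rewrite q_neq0 expf_neq0.
Qed.

(** The first n factors of (-v/q^n; q)_oo are 1 + v/q^i for 1 <= i <= n, each at least v/q^i. The
    resulting order v^n q^(-n(n+1)/2) is exact up to a constant: pulling v/q^i out of these factors
    leaves (-q/v; q)_n, a bounded increasing sequence, as [rpochN_le] shows. *)
Lemma rpochN_ge n v : 0 < v -> v ^+ n * tri n <= rp (- (v / q ^+ n)).
Proof.
move=> v0; elim: n => [|n IH].
  rewrite /tri big_ord0 !expr0 mulr1 rpoch_ge1// oppr_le0 divr1; exact: ltW.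
rewrite rpochN_divS exprS /tri big_ord_recr/= -/(tri n).
have -> : v * v ^+ n * (tri n * (q ^+ n.+1)^-1) =
  (v / q ^+ n.+1) * (v ^+ n * tri n) by ring.
have vq : 0 <= v / q ^+ n.+1 by rewrite divr_ge0 ?exprn_ge0 ?ltW.
apply: ler_pM => //; last by rewrite lerDr.
by rewrite mulr_ge0 ?exprn_ge0 ?(ltW v0)// ltW// tri_gt0.
Qed.

Lemma rpochN_le n v : 0 < v ->
  rp (- (v / q ^+ n)) <= v ^+ n * tri n * (rp (- (q / v)) * rp (- v)).
Proof.
move=> v0.
suff -> : rp (- (v / q ^+ n)) =
    v ^+ n * tri n * (\prod_(i < n) (1 + q / v * q ^+ i) * rp (- v)).
  have n1 : - v < 1 by rewrite (lt_trans _ ltr01)// oppr_lt0.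
  apply: ler_wpM2l; first by rewrite mulr_ge0 ?exprn_ge0 ?(ltW v0)// ltW// tri_gt0.
  rewrite ler_wpM2r ?(ltW (rpoch_gt0 _ _))//.
  by apply: prod_le_rpoch => //; rewrite divr_ge0// ltW.
elim: n => [|n IH]; first by rewrite /tri !big_ord0 !expr0 divr1 !mul1r.
rewrite rpochN_divS IH /tri !big_ord_recr/= [v ^+ n.+1]exprS [q ^+ n.+1]exprS.
by field; rewrite expf_neq0// q_neq0 gt_eqF.
Qed.

End strange_weights.

Lemma ltz_exists_nat (j k : int) : (k < j)%R -> exists n : nat, j = (k + n.+1%:Z)%R.
Proof. by move=> kj; exists (absz (j - k - 1)%R); rewrite intS gez0_abs; lia. Qed.

Lemma ler_pM4 (R : numDomainType) (u1 u2 u3 u4 v1 v2 v3 v4 : R) :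
  [/\ 0 <= u1, 0 <= u2, 0 <= u3 & 0 <= u4] ->
  u1 <= v1 -> u2 <= v2 -> u3 <= v3 -> u4 <= v4 ->
  u1 * u2 * u3 * u4 <= v1 * v2 * v3 * v4.
Proof.
by case=> ? ? ? ? ? ? ? ?; rewrite !ler_pM ?mulr_ge0.
Qed.

Section strange_mass.
Context {R : realType} (q : R) (q01 : 0 < q < 1) (a b c d t : R).
Context (adm : admissible q (a, b, c, d, t)).

Let q0 : 0 < q. Proof. by case/andP: q01. Qed.
Let q1 : q < 1. Proof. by case/andP: q01. Qed.
Let q_neq0 : q != 0. Proof. by rewrite gt_eqF. Qed.
Local Notation rp := (rpoch q).
Local Notation k := (kexp q (a, b, c, d, t)).
Let b0 : 0 < b. Proof. by case: adm => _ []. Qed.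
Let c0 : 0 < c. Proof. by case: adm => _ []. Qed.
Let a0 : 0 < a. Proof. by case: adm => _ [? _ ? _ _ _ _]; apply: lt_le_trans; eassumption. Qed.
Let t0 : t < 0. Proof. by case: adm. Qed.
Let d0 : 0 < d.
Proof.
by case: adm => _ _ /(lt_trans a0) + _ _; rewrite pmulr_lgt0// invr_gt0.
Qed.
Let dt0 : d * t < 0. Proof. by rewrite pmulr_rlt0. Qed.

(** Modulus of the point of D_- closest to -1. It lies in (1, 1/q] by the choice of k, and D_-
    consists of the points -xzero/q^n. *)
Definition xzero : R := `|d * t * q ^ k|.
Definition xminus n : R := d * t * q ^ (k - n%:Z).

Lemma xzero_itv : 1 < xzero <= q^-1.
Proof. by have := kexpP q01 adm k; rewrite eqxx. Qed.

Let X1 : 1 < xzero. Proof. by case/andP: xzero_itv. Qed.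
Let X0 : 0 < xzero. Proof. exact: lt_trans X1. Qed.

Lemma xminusE n : xminus n = - (xzero / q ^+ n).
Proof.
rewrite /xzero ltr0_norm; last by rewrite pmulr_llt0// exprz_gt0.
by rewrite mulNr opprK /xminus expfzDr// mulrA -invr_expz.
Qed.

Lemma xminusS n : xminus n.+1 = xminus n / q.
Proof. by rewrite !xminusE exprSr invfM mulNr mulrA. Qed.

Lemma xminus_lt n : xminus n < -1.
Proof.
rewrite xminusE ltrN2; apply: (lt_le_trans X1).
rewrite ler_pdivlMr ?exprn_gt0// ler_piMr ?(ltW X0)//.
by rewrite exprn_ile1// ltW.
Qed.

Lemma pole_minus_lt (j : int) : (d * t * q ^ j < -1) = (j <= k).
Proof.
apply/idP/idP => [|jk]; last first.
  have [n nE] : exists n : nat, k - j = n%:Z.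
    by exists `|k - j|%N; rewrite gez0_abs// subr_ge0.
  by have := xminus_lt n; rewrite /xminus -nE opprB addrCA subrr addr0.
apply: contraTT; rewrite -ltNge -leNgt => kj.
have [n nE] := ltz_exists_nat kj.
rewrite nE expfzDr// mulrA -exprnP.
have -> : d * t * q ^ k = - xzero.
  by rewrite /xzero ltr0_norm ?opprK// pmulr_llt0// exprz_gt0.
have [_ Xq] := andP xzero_itv.
rewrite mulNr lerN2 exprS mulrA mulr_ile1 ?exprn_ge0 ?exprn_ile1 ?(ltW q0) ?(ltW q1)//.
  by rewrite mulr_ge0 ?(ltW q0) ?(ltW X0).
by rewrite -(mulVf q_neq0) ler_wpM2r// ltW.
Qed.

Let rpQ_gt0 n u : 0 < u -> 0 < rp (u * xminus n) * rp (u / xminus n).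
Proof.
move=> u0; have x0 : xminus n < 0 by rewrite (lt_trans (xminus_lt n))// ltrN10.
rewrite mulr_gt0// rpoch_gt0//; apply: (@lt_trans _ _ 0) => //.
  by rewrite pmulr_rlt0.
by rewrite pmulr_rlt0// invr_lt0.
Qed.

(** The argument u x_n = -u xzero/q^n is of the form treated by [rpochN_ge] and [rpochN_le], while
    u/x_n stays in [-u, 0] and contributes a bounded factor that is at least 1. *)
Let rpQ_bounds u : 0 < u -> exists2 K, 0 < K & forall n,
  (u * xzero) ^+ n * tri q n <= rp (u * xminus n) * rp (u / xminus n) <=
  (u * xzero) ^+ n * tri q n * K.
Proof.
move=> u0; have v0 : 0 < u * xzero by rewrite mulr_gt0.
have neg (w : R) : 0 < w -> - w < 1 by move=> w0; rewrite (lt_trans _ ltr01)// oppr_lt0.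
exists (rp (- (q / (u * xzero))) * rp (- (u * xzero)) * rp (- u)).
  by rewrite !mulr_gt0 ?rpoch_gt0// neg// divr_gt0.
move=> n; have xE : u * xminus n = - (u * xzero / q ^+ n).
  by rewrite xminusE mulrN mulrA.
have ux : - u <= u / xminus n <= 0.
  have x1 := xminus_lt n; have xn0 : xminus n < 0 by rewrite (lt_trans x1)// ltrN10.
  rewrite pmulr_rle0// invr_le0 (ltW xn0) andbT -mulrN1 ler_pM2l//.
  by rewrite -[leLHS]invrN1 lef_nV2 ?negrE// ltW.
have [ux1 ux2] := andP ux.
have r1 : 1 <= rp (u / xminus n) by apply: rpoch_ge1.
have r2 : rp (u / xminus n) <= rp (- u).
  rewrite -[rp (u / _)]ger0_norm ?(le_trans ler01)// -cabsR -qpoch_real//.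
  by apply: cabs_qpoch_le => //; rewrite cabsR ler0_norm// lerNl.
have tri0 := tri_gt0 q01 n.
have h1 := rpochN_ge q01 n v0; have h2 := rpochN_le q01 n v0.
have L0 : 0 <= (u * xzero) ^+ n * tri q n by rewrite mulr_ge0 ?exprn_ge0 ?ltW.
rewrite xE; apply/andP; split.
  by apply: (le_trans h1); rewrite ler_peMr// (le_trans L0).
rewrite (mulrA _ (_ * _) (rp (- u))); apply: ler_pM => //; first exact: le_trans h1.
exact: le_trans r1.
Qed.

(* [dual_bound] says that [q^2 <= tau2]; see [dual_boundE]. *)
Definition tau2 : R := a * b * c * q * xzero ^+ 2 / d.

Lemma tau2_gt0 : 0 < tau2.
Proof. by rewrite /tau2 divr_gt0// !mulr_gt0// exprn_gt0. Qed.

(** The common value of [Gtau] at x_n and 1/x_n; see [Gtau_xminus]. *)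
Definition gtau n : R := (rp (q / d * xminus n) * rp (q / d / xminus n))^-1.

(** The pure power factor of [residue_val] at j = k - n. Passing from n to n + 1 multiplies it by
    xzero^2 / q^(2n+2). *)
Let rfac n : R := let x := xminus n in
  q ^ ((k - n%:Z) * (k - n%:Z + 1)) / (x ^ (k - n%:Z) * x ^ (k - n%:Z)).

Let rfacE n : rfac n = rfac 0 * (xzero ^+ 2) ^+ n / q ^+ (n * n.+1).
Proof.
elim: n => [|n IH]; first by rewrite !expr0 mulr1 divr1.
have -> : rfac n.+1 = rfac n * (xzero ^+ 2 / q ^+ (n.+1).*2).
  rewrite /rfac xminusS; set j := k - n%:Z.
  have -> : k - n.+1%:Z = j - 1 by rewrite /j -addrA -opprD -addn1 PoszD.
  clearbody j.
  have -> : (j - 1) * (j - 1 + 1) = j * (j + 1) + - j + - j by ring.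
  set x := xminus n.
  have x0 : x != 0 by rewrite lt_eqF// (lt_trans (xminus_lt n))// ltrN10.
  have -> : xzero ^+ 2 / q ^+ (n.+1).*2 = x ^+ 2 / q ^+ 2.
    have -> : q ^+ (n.+1).*2 = (q ^+ n) ^+ 2 * q ^+ 2.
      by rewrite -exprM -exprD muln2 addn2 doubleS.
    by rewrite /x xminusE; field; rewrite expf_neq0// q_neq0.
  have xj0 : x ^ j != 0 by rewrite expfz_neq0.
  have qj0 : q ^ j != 0 by rewrite expfz_neq0.
  have -> : q ^ (j * (j + 1) + - j + - j) = q ^ (j * (j + 1)) / q ^ j / q ^ j.
    by rewrite !expfzDr// -!invr_expz.
  have -> : (x / q) ^ (j - 1) = x ^ j / q ^ j / (x / q).
    have xq0 : x / q != 0 by rewrite mulf_neq0// invr_eq0.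
    apply: (mulIf xq0); rewrite divfK// -{2}[x / q]expr1z -expfzDr// subrK.
    by rewrite expfzMl exprz_inv -invr_expz.
  move: (x ^ j) (q ^ j) (q ^ (j * (j + 1))) xj0 qj0 => y z w y0 z0.
  by field; rewrite y0 z0 x0 q_neq0.
rewrite IH (_ : n.+1 * n.+2 = n * n.+1 + (n.+1).*2)%N; last by rewrite -muln2; ring.
move: (rfac 0) (xzero ^+ 2) => r X; rewrite (exprS X) exprD.
by field; rewrite !expf_neq0.
Qed.

(** The weight has the pair (q x/d, q/(d x); q)_oo once in its numerator and gtau^2 has it twice in
    the denominator, so four pairs remain below, with parameters a, b, c and q/d. By [rpQ_bounds]
    their product is of order tau2^n xzero^(2n) q^(-2n(n+1)), which explains the form of [tau2];
    [rfac] supplies xzero^(2n) q^(-n(n+1)) above. *)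
Lemma strange_mass_bounds : exists C1 C2 : R, [/\ 0 < C1, 0 < C2 & forall n,
  C1 * (q ^+ (n * n.+1) / tau2 ^+ n) <=
  minus_weight q (a, b, c, d, t) (k - n%:Z) * gtau n ^+ 2 <=
  C2 * (q ^+ (n * n.+1) / tau2 ^+ n)].
Proof.
have qd0 : 0 < q / d by rewrite divr_gt0.
have [Ka Ka0 Ha] := rpQ_bounds a0; have [Kb Kb0 Hb] := rpQ_bounds b0.
have [Kc Kc0 Hc] := rpQ_bounds c0; have [Kd Kd0 Hd] := rpQ_bounds qd0.
have r0 : 0 < rfac 0.
  rewrite divr_gt0 ?exprz_gt0// -expr2 exprn_even_gt0//= expfz_neq0//.
  by rewrite lt_eqF// (lt_trans (xminus_lt 0))// ltrN10.
have rq0 : 0 < rp q ^+ 2 by rewrite exprn_gt0// rpoch_gt0.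
have X20 : 0 < 1 - xzero ^- 2.
  by rewrite subr_gt0 invf_lt1 ?exprn_gt0// expr_gt1// ltW.
pose C2 := rfac 0 / (2 * rp q ^+ 2).
exists ((1 - xzero ^- 2) * C2 / (Ka * Kb * Kc * Kd)), C2.
have C20 : 0 < C2 by rewrite divr_gt0// mulr_gt0.
have K0 : 0 < Ka * Kb * Kc * Kd by rewrite !mulr_gt0.
split => //; first exact: divr_gt0 (mulr_gt0 X20 C20) K0.
move=> n; rewrite minus_weightE// pole_minus_lt gerBl// -/(xminus n).
have x1 := xminus_lt n; have xn0 : xminus n < 0 by rewrite (lt_trans x1)// ltrN10.
have x0 : xminus n != 0 by rewrite lt_eqF.
have gE : rp (q * xminus n / d) * rp (q / (d * xminus n)) =
    rp (q / d * xminus n) * rp (q / d / xminus n).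
  by congr (rp _ * rp _); field; rewrite ?x0 gt_eqF.
rewrite /residue_val -/(xminus n) gE /gtau.
move: (Ha n) (Hb n) (Hc n) (Hd n) (rpQ_gt0 n a0) (rpQ_gt0 n b0) (rpQ_gt0 n c0) (rpQ_gt0 n qd0).
set A := rp (a * _) * _; set B := rp (b * _) * _; set C := rp (c * _) * _.
set D := rp (q / d * _) * _.
set La := (a * _) ^+ n * _; set Lb := (b * _) ^+ n * _; set Lc := (c * _) ^+ n * _.
set Ld := (q / d * _) ^+ n * _.
move=> /andP[A1 A2] /andP[B1 B2] /andP[Cl1 Cl2] /andP[D1 D2] A0 B0 C0 D0.
clearbody A B C D.
have L0 u : 0 < u -> 0 < (u * xzero) ^+ n * tri q n.
  by move=> u0; rewrite mulr_gt0 ?tri_gt0// exprn_gt0// mulr_gt0.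
have La0 := L0 _ a0; have Lb0 := L0 _ b0; have Lc0 := L0 _ c0; have Ld0 := L0 _ qd0.
set Q := q ^+ _ / _.
have Q0 : 0 < Q by rewrite divr_gt0 ?exprn_gt0// tau2_gt0.
have rE : rfac n = rfac 0 * (Q * (La * Lb * Lc * Ld)).
  rewrite rfacE -mulrA; congr (_ * _).
  have -> : La * Lb * Lc * Ld = tau2 ^+ n * (xzero ^+ 2) ^+ n * (tri q n ^+ 2) ^+ 2.
    rewrite -exprMn (_ : tau2 * xzero ^+ 2 = a * xzero * (b * xzero) * (c * xzero) * (q / d * xzero)); last first.
      by rewrite /tau2; field; rewrite gt_eqF.
    by rewrite !exprMn /La /Lb /Lc /Ld !exprMn; ring.
  rewrite tri_sqr// /Q.
  have := expf_neq0 n (lt0r_neq0 tau2_gt0); have := expf_neq0 (n * n.+1) q_neq0.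
  move: (tau2 ^+ n) (q ^+ (n * n.+1)) (xzero ^+ 2 ^+ n) => u v w v0 u0.
  by field; rewrite u0 v0.
have LP : La * Lb * Lc * Ld <= A * B * C * D.
  by apply: ler_pM4 => //; split; exact: ltW.
have PL : A * B * C * D <= La * Lb * Lc * Ld * (Ka * Kb * Kc * Kd).
  have -> : La * Lb * Lc * Ld * (Ka * Kb * Kc * Kd) = La * Ka * (Lb * Kb) * (Lc * Kc) * (Ld * Kd) by ring.
  by apply: ler_pM4 => //; split; exact: ltW.
have ME : (1 - xminus n ^- 2) * D * q ^ ((k - n%:Z) * (k - n%:Z + 1)) /
    (xminus n ^ (k - n%:Z) * xminus n ^ (k - n%:Z) * A * B * C * rp q ^+ 2) / 2 *
    D^-1 ^+ 2 = (1 - xminus n ^- 2) * (C2 * Q) * (La * Lb * Lc * Ld / (A * B * C * D)).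
  transitivity ((1 - xminus n ^- 2) * rfac n / (2 * rp q ^+ 2) / (A * B * C * D)).
    rewrite /rfac; have := expfz_neq0 (k - n%:Z) x0.
    have [] : [/\ A != 0, B != 0, C != 0, D != 0 & rp q != 0].
      by rewrite !gt_eqF// rpoch_gt0.
    move: (xminus n ^ _) (q ^ (_ * _)) (1 - _) (rp q) => u v w z.
    move=> Ax Bx Cx Dx zx ux; field.
    by rewrite Ax Bx Cx Dx zx ux.
  rewrite rE /C2.
  have : A * B * C * D != 0 by rewrite gt_eqF// !mulr_gt0.
  move: rq0 => /lt0r_neq0; move: (A * B * C * D) (rp q ^+ 2) => u v v0 u0.
  by field; rewrite u0 v0.
rewrite ME; have P0 : 0 < A * B * C * D by rewrite !mulr_gt0.
have X2 : 1 - xzero ^- 2 <= 1 - xminus n ^- 2.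
  have xx0 : 0 < xminus n ^+ 2 by rewrite exprn_even_gt0//= x0.
  rewrite lerD2l lerN2 lef_pV2 ?posrE ?(exprn_gt0 _ X0)//.
  rewrite -[xminus n ^+ 2]sqrrN ler_pXn2r ?nnegrE ?oppr_ge0 ?(ltW X0) ?(ltW xn0)//.
  by rewrite xminusE opprK ler_pdivlMr ?exprn_gt0// ler_piMr ?(ltW X0)// exprn_ile1// ltW.
have x2 : 1 - xminus n ^- 2 <= 1 by rewrite gerBl invr_ge0 exprn_even_ge0.
have CQ : 0 < C2 * Q by exact: mulr_gt0.
apply/andP; split.
  rewrite (_ : _ / _ * Q = (1 - xzero ^- 2) * (C2 * Q) * (Ka * Kb * Kc * Kd)^-1); last first.
    by rewrite -[LHS]mulrA [_^-1 * Q]mulrC !mulrA.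
  apply: ler_pM; rewrite ?invr_ge0 ?(ltW K0)//.
  - by rewrite mulr_ge0// ltW.
  - by rewrite ler_wpM2r// ltW.
  - by rewrite ler_pdivlMr// ler_pdivrMl// [leRHS]mulrC.
rewrite -[leRHS]mulr1; apply: ler_pM.
- by rewrite mulr_ge0 ?(ltW CQ)// (le_trans (ltW X20)).
- rewrite divr_ge0 ?(ltW P0)//.
  exact: ltW (mulr_gt0 (mulr_gt0 (mulr_gt0 La0 Lb0) Lc0) Ld0).
- by rewrite ler_piMl// ltW.
- by rewrite ler_pdivrMr// mul1r.
Qed.

End strange_mass.

(** * Interpolation on the lattice x + 1/x, x in D_- *)

Section lagrange_sum.
Context {K : fieldType}.
Implicit Types (p : {poly K}) (y : nat -> K).

(** The sum is the divided difference of p at the N nodes, that is, the coefficient of X^(N-1) in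
    the Lagrange interpolation polynomial of p. That polynomial is p itself, whose degree is too
    small. *)
Lemma lagrange_sum0 N y p : (forall i j, (i < N)%N -> (j < N)%N -> i != j -> y i != y j) ->
  (size p < N)%N ->
  \sum_(n < N) p.[y n] / \prod_(i < N | (i : nat) != n) (y n - y i) = 0.
Proof.
move=> yI pN; pose w (n : nat) := \prod_(i < N | (i : nat) != n) (y n - y i).
pose l (n : nat) := \prod_(i < N | (i : nat) != n) ('X - (y i)%:P).
have wn0 (n : 'I_N) : w n != 0.
  by apply/prodf_neq0 => i ni; rewrite subr_eq0 yI// eq_sym.
have lE (n m : 'I_N) : (l n).[y m] = if m == n then w n else 0.
  rewrite horner_prod; under eq_bigr do rewrite !hornerE.
  have [->//|mn] := eqVneq m n.
  by rewrite (bigD1 m)//= subrr mul0r.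
have size_l (n : 'I_N) : size (l n) = N.
  rewrite /l -big_filter size_prod_XsubC -sum1_size big_filter sum1_card.
  rewrite (_ : #|_| = #|predC1 n|); last by apply: eq_card => i; rewrite !inE -val_eqE.
  by rewrite cardC1 card_ord prednK// (leq_ltn_trans (leq0n n)).
have monic_l (n : 'I_N) : l n \is monic by apply: monic_prod_XsubC.
pose L := \sum_(n < N) (p.[y n] / w n) *: l n.
have pL : p = L.
  apply/eqP; rewrite -subr_eq0; apply/eqP.
  apply: (@roots_geq_poly_eq0 _ _ [seq y (i : 'I_N) | i <- enum 'I_N]).
  - apply/allP => _ /mapP[m _ ->]; rewrite rootE hornerD hornerN horner_sum.
    rewrite (bigD1 m)//= hornerZ lE eqxx divfK// big1 ?addr0 ?subrr// => n nm.
    by rewrite hornerZ lE eq_sym (negbTE nm) mulr0.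
  - rewrite map_inj_in_uniq ?enum_uniq// => i j _ _ /eqP yij; apply/val_inj/eqP.
    by apply: contraTT yij => ij; rewrite yI.
  - rewrite size_map size_enum_ord (leq_trans (size_polyD _ _))// geq_max.
    rewrite (ltnW pN) size_polyN (leq_trans (size_sum _ _ _))//.
    by apply/bigmax_leqP => n _; rewrite (leq_trans (size_scale_leq _ _))// size_l.
have := congr1 (fun r : {poly K} => r`_N.-1) pL.
rewrite nth_default; last by case: N pN {yI w l wn0 lE size_l monic_l L pL}.
move=> L0; transitivity L`_N.-1; last by [].
rewrite /L coef_sum; apply: eq_bigr => n _; rewrite coefZ.
have := monicP (monic_l n); rewrite lead_coefE size_l => ->.
by rewrite mulr1.
Qed.

End lagrange_sum.

Section lattice_products.
Context {R : realType} (q : R) (q01 : 0 < q < 1) (X : R) (X1 : 1 < X).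

Let q0 : 0 < q. Proof. by case/andP: q01. Qed.
Let q1 : q < 1. Proof. by case/andP: q01. Qed.
Let q_neq0 : q != 0. Proof. by rewrite gt_eqF. Qed.
Let X0 : 0 < X. Proof. exact: lt_trans X1. Qed.
Let qX0 n : 0 < q ^+ n. Proof. by rewrite exprn_gt0. Qed.

Definition ylat n : R := - (X / q ^+ n) + (- (X / q ^+ n))^-1.

(** The difference factors as -(X/q^n) (1 - q^(n-i)) (1 - q^(n+i)/X^2). Since X > 1 and q^(n+i) <=
    q^(n-i), the last factor is at least the middle one, whence the square in the lower bound. *)
Let ylat_ltn i n : (i < n)%N ->
  X / q ^+ n * (1 - q ^+ (n - i)) ^+ 2 <= `|ylat n - ylat i| <= X / q ^+ n.
Proof.
move=> lt_in.
have -> : ylat n - ylat i =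
    - (X / q ^+ n * ((1 - q ^+ (n - i)) * (1 - q ^+ (n + i) / X ^+ 2))).
  have nE : q ^+ n = q ^+ (n - i) * q ^+ i by rewrite -exprD subnK// ltnW.
  rewrite /ylat exprD nE; move: (lt0r_neq0 X0) (lt0r_neq0 (qX0 (n - i))) (lt0r_neq0 (qX0 i)).
  by move: X (q ^+ (n - i)) (q ^+ i) => x u v x0 u0 v0; field; rewrite x0 u0 v0.
have xn0 : 0 < X / q ^+ n by rewrite divr_gt0.
have qni : q ^+ (n - i) <= 1 by rewrite exprn_ile1// ltW.
have qni' : q ^+ (n + i) / X ^+ 2 <= q ^+ (n - i).
  rewrite ler_pdivrMr ?exprn_gt0// (@le_trans _ _ (q ^+ (n - i) * 1))//.
    by rewrite mulr1; apply: ler_wiXn2l; rewrite ?(ltW q0) ?(ltW q1)// leq_subLR addnCA leq_addr.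
  by rewrite ler_pM2l// exprn_ege1// ltW.
have qp : 0 <= q ^+ (n + i) / X ^+ 2 by rewrite divr_ge0 ?exprn_ge0// ltW.
have q2 : 0 <= 1 - q ^+ (n - i) by rewrite subr_ge0.
have q3 : 0 <= 1 - q ^+ (n + i) / X ^+ 2 by rewrite subr_ge0 (le_trans qni').
have P0 : 0 <= X / q ^+ n * ((1 - q ^+ (n - i)) * (1 - q ^+ (n + i) / X ^+ 2)).
  by rewrite mulr_ge0 ?(ltW xn0)// mulr_ge0.
rewrite normrN ger0_norm//; apply/andP; split.
  by rewrite ler_pM2l// expr2 ler_wpM2l// lerD2l lerN2.
by rewrite ler_piMr ?(ltW xn0)// mulr_ile1// gerBl// exprn_ge0 ?ltW.
Qed.

(** With truncated subtraction, [n - i + (i - n)] is the distance |n - i|. *)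
Lemma ylat_dist i n : i != n ->
  X / q ^+ maxn i n * (1 - q ^+ (n - i + (i - n))) ^+ 2 <= `|ylat n - ylat i|
    <= X / q ^+ maxn i n.
Proof.
case: (ltngtP i n) => [lt_in _|lt_ni _|//].
  by have /eqP -> : (i - n == 0)%N; [rewrite subn_eq0 ltnW|rewrite addn0 ylat_ltn].
have /eqP -> : (n - i == 0)%N by rewrite subn_eq0 ltnW.
by rewrite add0n distrC ylat_ltn.
Qed.

Lemma ylat_inj i n : i != n -> ylat i != ylat n.
Proof.
move=> ni; rewrite eq_sym -subr_eq0 -normr_gt0.
have /andP[+ _] := ylat_dist ni; apply: lt_le_trans.
rewrite mulr_gt0 ?divr_gt0// exprn_gt0// subr_gt0 exprn_ilt1 ?(ltW q0)//.
by rewrite addn_eq0 !subn_eq0 -eqn_leq eq_sym.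
Qed.

(** The indices below n and those above n each give a partial product of (q; q)_oo. *)
Let prod_dist N n : (n < N)%N ->
  rpoch q q ^+ 2 <= \prod_(i < N | (i : nat) != n) (1 - q ^+ (n - i + (i - n))).
Proof.
move=> nN; pose g i : R := 1 - q ^+ (n - i + (i - n)).
have -> : \prod_(i < N | (i : nat) != n) (1 - q ^+ (n - i + (i - n))) =
    \prod_(0 <= i < N | i != n) g i by rewrite big_mkord.
have g0 i : 0 <= g i by rewrite subr_ge0 exprn_ile1// ltW.
have rq0 : 0 < rpoch q q by exact: rpoch_gt0.
rewrite (big_cat_nat (leq0n n) (ltnW nN))/= [X in _ <= _ * X]big_ltn_cond// eqxx/= expr2.
apply: ler_pM; rewrite ?(ltW rq0)//.
  rewrite (_ : \prod_(0 <= i < n | _) _ = \prod_(i < n) (1 - q ^+ i.+1)).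
    exact: rpoch_le_prod.
  rewrite big_mkord [RHS](reindex_inj rev_ord_inj)/=.
  apply: eq_big => [i|i _]; first by rewrite neq_ltn ltn_ord.
  by rewrite subnSK// /g; congr (1 - q ^+ _); have := ltn_ord i; lia.
rewrite (_ : \prod_(n.+1 <= i < N | _) _ = \prod_(i < N - n.+1) (1 - q ^+ i.+1)).
  exact: rpoch_le_prod.
rewrite -{1}[n.+1]add0n big_addn big_mkord; apply: eq_big => [i|i _]; first by rewrite /=; lia.
by rewrite /g; congr (1 - q ^+ _); lia.
Qed.

Let rp4 : R := rpoch q q ^+ 4.
Let rp4_gt0 : 0 < rp4. Proof. by rewrite exprn_gt0// rpoch_gt0. Qed.

Lemma prod_ylat_ge N n : (n < N)%N ->
  rp4 * \prod_(i < N | (i : nat) != n) (X / q ^+ maxn i n) <=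
  \prod_(i < N | (i : nat) != n) `|ylat n - ylat i|.
Proof.
move=> nN; apply: (@le_trans _ _ (\prod_(i < N | (i : nat) != n)
    (X / q ^+ maxn i n * (1 - q ^+ (n - i + (i - n))) ^+ 2))).
  rewrite [leRHS]big_split/= [leLHS]mulrC; apply: ler_pM => //.
  - by apply: prodr_ge0 => i _; rewrite divr_ge0// ltW.
  - exact: ltW.
  - rewrite prodrXl /rp4 (exprM _ 2 2) ler_pXn2r ?nnegrE ?prod_dist//.
      by rewrite exprn_ge0// ltW// rpoch_gt0.
    by apply: prodr_ge0 => i _; rewrite subr_ge0 exprn_ile1// ltW.
apply: ler_prod => i ni; have /andP[-> _] := ylat_dist ni.
by rewrite mulr_ge0 ?divr_ge0 ?exprn_ge0 ?(ltW X0)// ?(ltW q0)// subr_ge0 exprn_ile1// ltW.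
Qed.

Lemma prodX_sqr N : (\prod_(i < N) q ^+ i) ^+ 2 = q ^+ (N * N.-1).
Proof.
elim: N => [|N IH]; first by rewrite big_ord0 expr1n.
rewrite big_ord_recr/= exprMn IH -exprM -exprD; congr (_ ^+ _).
by case: N {IH} => //= N; ring.
Qed.

Let bigD1_nat N n (f : nat -> R) : (n < N)%N ->
  \prod_(i < N) f i = f n * \prod_(i < N | (i : nat) != n) f i.
Proof.
move=> nN; rewrite (bigD1 (Ordinal nN))//=; congr (_ * _).
Qed.

(** At a point beyond the nodes every factor of the numerator is at most X/q^n, and in the
    denominator X/q^max(i,j) may be weakened to X/q^i. The powers of X cancel, leaving the product
    of q^i/q^n over i != j. *)
Lemma interp_bound j N n : (j < N)%N -> (N <= n)%N ->
  (\prod_(i < N | (i : nat) != j) (`|ylat n - ylat i| / `|ylat j - ylat i|)) ^+ 2 <=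
  rp4 ^- 2 * (q ^+ n.*2 / q ^+ j.*2 * (q ^+ (N * N.-1) / q ^+ (n * N).*2)).
Proof.
move=> jN Nn.
have nat_pos (P : pred 'I_N) (f : nat -> nat) : 0 < \prod_(i < N | P i) (X / q ^+ f i).
  by apply: prodr_gt0 => i _; rewrite divr_gt0.
have num : \prod_(i < N | (i : nat) != j) `|ylat n - ylat i| <=
    \prod_(i < N | (i : nat) != j) (X / q ^+ n).
  apply: ler_prod => i _; rewrite normr_ge0/=.
  have lt_in := leq_trans (ltn_ord i) Nn.
  by have /andP[_] := ylat_ltn lt_in.
have den : rp4 * \prod_(i < N | (i : nat) != j) (X / q ^+ i) <=
    \prod_(i < N | (i : nat) != j) `|ylat j - ylat i|.
  apply: le_trans (prod_ylat_ge jN); rewrite ler_pM2l//; apply: ler_prod => i _.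
  rewrite divr_ge0 ?(ltW X0) ?exprn_ge0 ?(ltW q0)//= ler_pM2l// lef_pV2 ?posrE//.
  by apply: ler_wiXn2l; rewrite ?(ltW q0) ?(ltW q1)// leq_maxl.
rewrite prodf_div.
have den0 : 0 < \prod_(i < N | (i : nat) != j) `|ylat j - ylat i|.
  by apply: lt_le_trans den; rewrite mulr_gt0// (nat_pos _ id).
have step : \prod_(i < N | (i : nat) != j) `|ylat n - ylat i| /
      \prod_(i < N | (i : nat) != j) `|ylat j - ylat i| <=
    rp4^-1 * (q ^+ n / q ^+ j * (\prod_(i < N) q ^+ i / (q ^+ n) ^+ N)).
  apply: (@le_trans _ _ (\prod_(i < N | (i : nat) != j) (X / q ^+ n) /
      (rp4 * \prod_(i < N | (i : nat) != j) (X / q ^+ i)))).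
    apply: ler_pM => //.
    - by apply: prodr_ge0 => i _; rewrite normr_ge0.
    - by rewrite invr_ge0 ltW.
    - by rewrite lef_pV2 ?posrE// mulr_gt0// (nat_pos _ id).
  rewrite invfM mulrCA ler_pM2l ?invr_gt0// -prodf_div.
  have -> : \prod_(i < N | (i : nat) != j) (X / q ^+ n / (X / q ^+ i)) =
      \prod_(i < N | (i : nat) != j) (q ^+ i / q ^+ n).
    by apply: eq_bigr => i _; field; rewrite !expf_neq0// gt_eqF.
  have : \prod_(i < N) (q ^+ i / q ^+ n) = q ^+ j / q ^+ n *
      \prod_(i < N | (i : nat) != j) (q ^+ i / q ^+ n).
    exact: (bigD1_nat (fun i => q ^+ i / q ^+ n) jN).
  rewrite prodf_div prodr_const card_ord => ->.
  rewrite mulrA (_ : q ^+ n / q ^+ j * (q ^+ j / q ^+ n) = 1) ?mul1r//.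
  by field; rewrite !expf_neq0.
apply: le_trans (_ : (rp4^-1 * (q ^+ n / q ^+ j * (\prod_(i < N) q ^+ i / (q ^+ n) ^+ N))) ^+ 2 <= _).
  rewrite ler_pXn2r ?nnegrE//; first by rewrite divr_ge0 ?(ltW den0)// prodr_ge0.
  have T0 : 0 < \prod_(i < N) q ^+ i by apply: prodr_gt0.
  by rewrite ltW// mulr_gt0 ?invr_gt0// mulr_gt0// divr_gt0// exprn_gt0.
rewrite le_eqVlt; apply/orP; left; apply/eqP; rewrite -prodX_sqr.
have -> : q ^+ (n * N).*2 = ((q ^+ n) ^+ N) ^+ 2 by rewrite -!exprM mulnA muln2.
have -> : q ^+ n.*2 = (q ^+ n) ^+ 2 by rewrite -exprM muln2.
have -> : q ^+ j.*2 = (q ^+ j) ^+ 2 by rewrite -exprM muln2.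
have := expf_neq0 N (lt0r_neq0 (qX0 n)).
move: (lt0r_neq0 rp4_gt0) (lt0r_neq0 (qX0 n)) (lt0r_neq0 (qX0 j)).
move: rp4 (q ^+ n) (q ^+ j) (\prod_(_ < N) _) => r u v w r0 u0 v0.
by move: (u ^+ N) => z z0; field; rewrite r0 v0 z0.
Qed.

(** The nodes beyond n contribute the same powers of q to both products, so N disappears from the
    bound; what remains before squaring is q^(n(n-1)/2) up to a constant. *)
Lemma lagrange_weight_bound N n : (n < N)%N ->
  (\prod_(i < N | (i : nat) != 0%N) `|ylat 0 - ylat i| /
   \prod_(i < N | (i : nat) != n) `|ylat n - ylat i|) ^+ 2 <=
  rp4 ^- 2 * q ^+ (n * n.-1).
Proof.
move=> nN.
have nat_pos (P : pred 'I_N) (f : nat -> nat) : 0 < \prod_(i < N | P i) (X / q ^+ f i).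
  by apply: prodr_gt0 => i _; rewrite divr_gt0.
have num : \prod_(i < N | (i : nat) != 0%N) `|ylat 0 - ylat i| <=
    \prod_(i < N | (i : nat) != 0%N) (X / q ^+ i).
  apply: ler_prod => i i0; rewrite normr_ge0/=.
  by have /andP[_] := ylat_dist i0; rewrite maxn0.
have den := prod_ylat_ge nN.
have den0 : 0 < \prod_(i < N | (i : nat) != n) `|ylat n - ylat i|.
  by apply: lt_le_trans den; rewrite mulr_gt0// (nat_pos _ (maxn ^~ n)).
have N0 : (0 < N)%N := leq_ltn_trans (leq0n n) nN.
have step : \prod_(i < N | (i : nat) != 0%N) `|ylat 0 - ylat i| /
   \prod_(i < N | (i : nat) != n) `|ylat n - ylat i| <=
   rp4^-1 * ((q ^+ n) ^+ n / (q ^+ n * \prod_(i < n) q ^+ i)).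
  apply: (@le_trans _ _ (\prod_(i < N | (i : nat) != 0%N) (X / q ^+ i) /
      (rp4 * \prod_(i < N | (i : nat) != n) (X / q ^+ maxn i n)))).
    apply: ler_pM => //.
    - by apply: prodr_ge0 => i _; rewrite normr_ge0.
    - by rewrite invr_ge0 ltW.
    - by rewrite lef_pV2 ?posrE// mulr_gt0// (nat_pos _ (maxn ^~ n)).
  rewrite invfM mulrCA ler_pM2l ?invr_gt0//.
  have E1 := bigD1_nat (fun i => X / q ^+ i) N0.
  have E2 := bigD1_nat (fun i => X / q ^+ maxn i n) nN.
  rewrite /= expr0 divr1 in E1; rewrite /= maxnn in E2.
  have E3 : \prod_(i < N) (X / q ^+ i) =
      \prod_(i < N) (X / q ^+ maxn i n) * ((q ^+ n) ^+ n / \prod_(i < n) q ^+ i).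
    have -> : (q ^+ n) ^+ n / \prod_(i < n) q ^+ i = \prod_(i < N) (q ^+ maxn i n / q ^+ i).
      rewrite -(big_mkord xpredT (fun i => q ^+ maxn i n / q ^+ i)).
      rewrite (big_cat_nat (leq0n n) (ltnW nN))/= [X in _ = _ * X]big_nat_cond.
      rewrite [X in _ = _ * X]big1 ?mulr1; last first.
        by move=> i /andP[/andP[ni _] _]; rewrite (maxn_idPl ni) divff// expf_neq0.
      rewrite big_mkord prodf_div; congr (_ / _).
      under eq_bigr => i _ do rewrite (maxn_idPr (ltnW (ltn_ord i))).
      by rewrite prodr_const card_ord.
    by rewrite -big_split/=; apply: eq_bigr => i _; field; rewrite !expf_neq0.
  move: E3; rewrite E1 E2.
  have P0 := nat_pos (fun i : 'I_N => (i : nat) != n) (maxn ^~ n).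
  have Q0 : 0 < \prod_(i < n) q ^+ i by apply: prodr_gt0.
  move: P0 Q0; set A := \prod_(i < N | _) _; set B := \prod_(i < N | _) _ => B0 /lt0r_neq0 Q0.
  move=> E; rewrite -(ler_pM2l X0) (mulrA X B) E le_eqVlt; apply/orP; left; apply/eqP.
  by field; rewrite Q0 (lt0r_neq0 B0) expf_neq0.
apply: le_trans (_ : (rp4^-1 * ((q ^+ n) ^+ n / (q ^+ n * \prod_(i < n) q ^+ i))) ^+ 2 <= _).
  rewrite ler_pXn2r ?nnegrE//; first by rewrite divr_ge0 ?(ltW den0)// prodr_ge0.
  have T0 : 0 < \prod_(i < n) q ^+ i by apply: prodr_gt0.
  by rewrite ltW// mulr_gt0 ?invr_gt0// divr_gt0 ?exprn_gt0// mulr_gt0.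
rewrite le_eqVlt; apply/orP; left; apply/eqP.
have -> : q ^+ (n * n.-1) = ((q ^+ n) ^+ n) ^+ 2 / (q ^+ n) ^+ 2 / q ^+ (n * n.-1).
  apply: (mulIf (expf_neq0 (n * n.-1) q_neq0)); rewrite divfK ?expf_neq0//.
  apply: (mulIf (expf_neq0 2 (expf_neq0 n q_neq0))); rewrite divfK ?expf_neq0//.
  by rewrite -!exprM -!exprD; congr (_ ^+ _); case: (n) => //= m; ring.
rewrite -prodX_sqr.
have Q0 : \prod_(i < n) q ^+ i != 0 by apply/prodf_neq0 => i _; rewrite expf_neq0.
move: (lt0r_neq0 rp4_gt0) Q0 (expf_neq0 n q_neq0).
move: rp4 (\prod_(_ < _) _) ((q ^+ n) ^+ n) (q ^+ n) => r u v w r0 u0 w0.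
by field; rewrite r0 u0 w0.
Qed.

End lattice_products.

(** * Density of polynomials in a finite measure space *)

Section polynomial_density.
Context d (T : measurableType d) {R : realType}.
Context (mu : {measure set T -> \bar R}) (muoo : (mu setT < +oo)%E).
Context (y : T -> R) (my : measurable_fun setT y) (M : R).
Context (yM : forall x, `|y x| <= M).
Implicit Types (u v : T -> R) (p : {poly R}).

Definition sqint u : \bar R := (\int[mu]_x (u x ^+ 2)%:E)%E.

Definition poly_approx u := measurable_fun setT u /\
  forall e : R, 0 < e -> exists p, (sqint (fun x => u x - p.[y x])%R < e%:E)%E.

Let measurable_sqr u : measurable_fun setT u ->
  measurable_fun setT (fun x => (u x ^+ 2)%:E).
Proof. by move=> mu'; apply/measurable_EFinP; exact: measurable_funX. Qed.

Lemma sqintZ k u : measurable_fun setT u ->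
  sqint (fun x => k * u x) = ((k ^+ 2)%:E * sqint u)%E.
Proof.
move=> mu'; rewrite /sqint; under eq_integral do rewrite exprMn EFinM.
by rewrite ge0_integralZl// ?lee_fin ?sqr_ge0//; [exact: measurable_sqr|
  move=> x _; rewrite lee_fin sqr_ge0].
Qed.

Lemma sqintD_le u v : measurable_fun setT u -> measurable_fun setT v ->
  (sqint (fun x => u x + v x)%R <= 2%:E * sqint u + 2%:E * sqint v)%E.
Proof.
move=> mu' mv; rewrite /sqint -!ge0_integralZl//; try (by move=> x _; rewrite lee_fin sqr_ge0);
  try exact: measurable_sqr.
rewrite -ge0_integralD//; try (by move=> x _; rewrite -EFinM lee_fin mulr_ge0// sqr_ge0);
  try (by apply: measurable_funeM; exact: measurable_sqr).
apply: ge0_le_integral => //.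
- by move=> x _; rewrite lee_fin sqr_ge0.
- by apply: measurable_sqr; exact: measurable_funD.
- by apply: emeasurable_funD; apply: measurable_funeM; exact: measurable_sqr.
- move=> x _; rewrite -!EFinM -EFinD lee_fin.
  by have := sqr_ge0 (u x - v x); nra.
Qed.

Lemma measurable_poly p : measurable_fun setT (fun x => p.[y x]).
Proof.
under eq_fun do rewrite horner_coef.
by apply: measurable_sum => i; apply: measurable_funM => //; exact: measurable_funX.
Qed.

Lemma poly_approx_poly p : poly_approx (fun x => p.[y x]).
Proof.
split=> [|e e0]; first exact: measurable_poly.
exists p; rewrite /sqint; under eq_integral do rewrite subrr expr0n/=.
by rewrite integral0 lte_fin.
Qed.

Lemma poly_approx_cvg u : measurable_fun setT u ->
  (forall e : R, 0 < e -> exists v, poly_approx v /\ (sqint (fun x => u x - v x)%R < e%:E)%E) ->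
  poly_approx u.
Proof.
move=> mu' h; split => // e e0.
have [|v [[mv av] uv]] := h (e / 4); first by rewrite divr_gt0.
have [|p pv] := av (e / 4); first by rewrite divr_gt0.
exists p; have mp := measurable_poly p.
have -> : (fun x => u x - p.[y x]) = fun x => (u x - v x) + (v x - p.[y x]).
  by apply/funext => x; rewrite addrA subrK.
apply: le_lt_trans (sqintD_le _ _) _; try exact: measurable_funB.
have -> : e%:E = (2%:E * (e / 4)%:E + 2%:E * (e / 4)%:E)%E.
  by rewrite -!EFinM -EFinD; congr _%:E; field.
by apply: lteD; rewrite lte_pmul2l// lte_fin.
Qed.

Lemma poly_approxD u v : poly_approx u -> poly_approx v ->
  poly_approx (fun x => u x + v x).
Proof.
move=> [mu' au] [mv av]; split=> [|e e0]; first exact: measurable_funD.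
have [|p pu] := au (e / 4); first by rewrite divr_gt0.
have [|r rv] := av (e / 4); first by rewrite divr_gt0.
exists (p + r); have mp := measurable_poly p; have mr := measurable_poly r.
have -> : (fun x => u x + v x - (p + r).[y x]) =
    fun x => (u x - p.[y x]) + (v x - r.[y x]).
  by apply/funext => x; rewrite hornerD opprD addrACA.
apply: le_lt_trans (sqintD_le _ _) _; try exact: measurable_funB.
have -> : e%:E = (2%:E * (e / 4)%:E + 2%:E * (e / 4)%:E)%E.
  by rewrite -!EFinM -EFinD; congr _%:E; field.
by apply: lteD; rewrite lte_pmul2l// lte_fin.
Qed.

Lemma poly_approxZ k u : poly_approx u -> poly_approx (fun x => k * u x).
Proof.
move=> [mu' au]; split=> [|e e0]; first exact: measurable_funM.
have k1 : 0 < k ^+ 2 + 1 by rewrite ltr_wpDl ?sqr_ge0.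
have [|p pu] := au (e / (k ^+ 2 + 1)); first by rewrite divr_gt0.
exists (k *: p); have mp := measurable_poly p.
have -> : (fun x => k * u x - (k *: p).[y x]) = fun x => k * (u x - p.[y x]).
  by apply/funext => x; rewrite hornerZ mulrBr.
rewrite sqintZ; last exact: measurable_funB.
apply: (@le_lt_trans _ _ ((k ^+ 2)%:E * (e / (k ^+ 2 + 1))%:E)%E).
  by apply: lee_wpmul2l; [rewrite lee_fin sqr_ge0|exact: ltW].
rewrite -EFinM lte_fin mulrA ltr_pdivrMr// mulrC ltr_pM2l//.
by rewrite ltrDl.
Qed.

(** Dominated convergence: the measure is finite, so the constant (2B)^2 is an integrable majorant
    of the squared errors. *)
Lemma poly_approx_bounded_cvg (un : nat -> T -> R) u B :
  (forall n, poly_approx (un n)) -> (forall n x, `|un n x| <= B) ->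
  (forall x, un n x @[n --> \oo] --> u x) -> poly_approx u.
Proof.
move=> aun unB unu.
have mun n : measurable_fun setT (un n) by case: (aun n).
have mu' : measurable_fun setT u.
  by apply: (measurable_fun_cvg mun) => x _; exact: unu.
have uB x : `|u x| <= B.
  by apply: (cvgr_to_le (cvg_norm (unu x))); apply: nearW => n; exact: unB.
apply: poly_approx_cvg => // e e0.
pose f n x := ((u x - un n x) ^+ 2)%:E.
have mf n : measurable_fun setT (f n).
  by apply: measurable_sqr; exact: measurable_funB.
have ig : mu.-integrable setT (EFin \o (fun _ : T => (2 * B) ^+ 2)).
  by apply: measurable_bounded_integrable => //; exact: bounded_cst.
have cvf : {ae mu, forall x, setT x -> f ^~ x @ \oo --> (cst 0%E x)}.
  apply: aeW => x _; apply: cvg_EFin; first by apply: nearW.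
  rewrite (_ : 0 = (u x - u x) ^+ 2); last by rewrite subrr expr0n.
  have cB : u x - un n x @[n --> \oo] --> u x - u x.
    by apply: cvgB; [exact: cvg_cst|exact: unu].
  rewrite expr2; have -> : fine \o f^~ x = (fun n => (u x - un n x) * (u x - un n x)).
    by apply/funext => n; rewrite /f/= expr2.
  exact: cvgM.
have domf : {ae mu, forall x n, setT x -> (`|f n x| <= (EFin \o (fun _ : T => ((2 * B) ^+ 2)%R)) x)%E}.
  apply: aeW => x n _; rewrite /f/= lee_fin ger0_norm ?sqr_ge0//.
  rewrite -real_normK ?num_real// ler_pXn2r ?nnegrE//.
    by rewrite (le_trans (ler_normB _ _))// mulr_natl mulr2n lerD.
  by rewrite mulr_ge0// (le_trans (normr_ge0 (u x))).
have [_ _] := dominated_convergence measurableT mf (measurable_cst _) cvf ig domf.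
rewrite integral0 => /fine_cvgP[fin_near /cvgrPdist_lt/(_ _ e0) dist_near].
have [n [fn dn]] : exists n, (\int[mu]_x f n x)%E \is a fin_num /\
    `|0 - fine (\int[mu]_x f n x)%E| < e.
  by apply: (@filter_ex _ \oo); apply: filterI.
exists (un n); split => //; rewrite /sqint -[X in (X < _)%E](fineK fn) lte_fin.
by move: dn; rewrite sub0r normrN; apply: le_lt_trans; exact: ler_norm.
Qed.

Let bernoulli_le (h : R) m : 0 <= h <= 1 -> 1 - m%:R * h <= (1 - h) ^+ m.
Proof.
move=> /andP[h0 h1]; elim: m => [|m IH]; first by rewrite mul0r subr0 expr0.
rewrite exprS; apply: (@le_trans _ _ ((1 - h) * (1 - m%:R * h))).
  have : 0 <= m%:R * h * h by rewrite !mulr_ge0.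
  by rewrite -natr1; lra.
by rewrite ler_wpM2l// subr_ge0.
Qed.

Let bernoulli_ge (h : R) m : 0 <= h -> 1 + m%:R * h <= (1 + h) ^+ m.
Proof.
move=> h0; elim: m => [|m IH]; first by rewrite mul0r addr0 expr0.
rewrite exprS; apply: (@le_trans _ _ ((1 + h) * (1 + m%:R * h))).
  have : 0 <= m%:R * h * h by rewrite !mulr_ge0.
  by rewrite -natr1; lra.
by rewrite ler_wpM2l// addr_ge0.
Qed.

(* [Q n s] tends to the indicator of [s < 1/2], by Bernoulli's inequality. *)
Let Q n (s : R) := (1 - s ^+ n) ^+ (2 ^ n).

Let Q_itv n s : 0 <= s <= 1 -> 0 <= Q n s <= 1.
Proof.
move=> /andP[s0 s1]; have sn0 : 0 <= 1 - s ^+ n by rewrite subr_ge0 exprn_ile1.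
by rewrite exprn_ge0// exprn_ile1// gerBl exprn_ge0.
Qed.

Let Q_lt s : 0 <= s < 2^-1 -> Q n s @[n --> \oo] --> (1 : R).
Proof.
move=> /andP[s0 s2]; have s1 : s <= 1 by lra.
apply: (@squeeze_cvgr _ _ _ _ (fun n => 1 - (2 * s) ^+ n) (fun=> 1)).
- apply: nearW => n; have /andP[_ ->] := @Q_itv n s (introT andP (conj s0 s1)).
  rewrite andbT (le_trans _ (bernoulli_le _ _))//.
    by rewrite natrX exprMn.
  by rewrite exprn_ge0//= exprn_ile1.
- rewrite -[X in _ --> X]subr0; apply: cvgB; first exact: cvg_cst.
  by apply: cvg_expr; rewrite ger0_norm; lra.
- exact: cvg_cst.
Qed.

Let Q_gt s : 2^-1 < s <= 1 -> Q n s @[n --> \oo] --> (0 : R).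
Proof.
move=> /andP[s2 s1]; have s0 : 0 < s by lra.
apply: (@squeeze_cvgr _ _ _ _ (fun=> 0) (fun n => ((2 * s)^-1) ^+ n)).
- apply: nearW => n; have /andP[-> _] := @Q_itv n s (introT andP (conj (ltW s0) s1)).
  have sn0 : 0 < s ^+ n by rewrite exprn_gt0.
  have sn1 : s ^+ n <= 1 by rewrite exprn_ile1// ltW.
  rewrite exprVn /= -[leRHS]mul1r ler_pdivlMr ?exprn_gt0//; last lra.
  apply: (@le_trans _ _ (Q n s * (1 + s ^+ n) ^+ (2 ^ n))).
    apply: ler_wpM2l; first by rewrite exprn_ge0// subr_ge0.
    apply: le_trans (bernoulli_ge _ (ltW sn0)).
    by rewrite natrX exprMn lerDr.
  rewrite /Q -exprMn exprn_ile1//.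
    by rewrite mulr_ge0 ?subr_ge0// addr_ge0// ltW.
  by have := sqr_ge0 (s ^+ n); rewrite expr2; lra.
- exact: cvg_cst.
- apply: cvg_expr; rewrite ger0_norm ?invr_ge0; last lra.
  by rewrite invf_lt1; lra.
Qed.

Let Q_eq : cvgn (fun n => Q n 2^-1).
Proof.
apply: (@nondecreasing_is_cvgn _ _); last first.
  exists 1 => _ [n _ <-]; have h01 : 0 <= (2^-1 : R) <= 1 by lra.
  by have /andP[] := Q_itv n h01.
apply/nondecreasing_seqP => n; rewrite /Q expnS exprM ler_pXn2r ?nnegrE ?exprn_ge0 ?subr_ge0//.
- rewrite [2^-1 ^+ n.+1]exprS; move: (2^-1 ^+ n) => u; have := sqr_ge0 u; rewrite !expr2; lra.
- by rewrite expn_gt0.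
- by rewrite exprn_ile1//; lra.
- by rewrite exprn_ile1//; lra.
Qed.

Let half : R := limn (fun n => Q n 2^-1).

Let step (c : R) x : R := if y x < c then 1 else if y x == c then half else 0.

Let half_itv (z : R) : `|z| <= 2^-1 -> 0 <= 2^-1 + z <= 1.
Proof. by rewrite ler_norml => /andP[]; lra. Qed.

Let poly_approx_step (c : R) : poly_approx (step c).
Proof.
(* With this K the affine map [s] sends the range of y into [0, 1] and c to 1/2. That M is
   nonnegative is known only from a point of T, hence the argument [x] of [M0] and [K0]. *)
pose K := 2 * (M + `|c| + 1).
have M0 x : 0 <= M := le_trans (normr_ge0 (y x)) (yM x).
pose s x := 2^-1 + (y x - c) / K.
have K0 (x : T) : 0 < K by rewrite mulr_gt0// ltr_wpDl// addr_ge0// (M0 x).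
have s01 x : 0 <= s x <= 1.
  have : `|(y x - c) / K| <= 2^-1.
    rewrite normrM [`|K^-1|]ger0_norm ?invr_ge0 ?(ltW (K0 x))// ler_pdivrMr ?(K0 x)//.
    rewrite (le_trans (ler_normB _ _))// /K mulrA mulVf// mul1r.
    by rewrite (le_trans (lerD (yM x) (lexx _)))// lerDl.
  exact: half_itv.
apply: (@poly_approx_bounded_cvg (fun n x => Q n (s x)) _ 1).
- move=> n; pose p : {poly R} := (1 - (2^-1%:P + K^-1 *: ('X - c%:P)) ^+ n) ^+ (2 ^ n).
  rewrite (_ : (fun x => _) = fun x => p.[y x]); first exact: poly_approx_poly.
  by apply/funext => x; rewrite /p /Q /s !hornerE (mulrC K^-1).
- by move=> n x; have /andP[h0 h1] := Q_itv n (s01 x); rewrite ger0_norm.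
- move=> x; have /andP[sx0 sx1] := s01 x; have Kx := K0 x.
  rewrite /step; case: ltgtP => yc.
  + by apply: Q_lt; rewrite sx0/= /s gtrDl ltr_pdivrMr// mul0r subr_lt0.
  + by apply: Q_gt; rewrite sx1 andbT /s ltrDl divr_gt0// subr_gt0.
  + by rewrite /s yc subrr mul0r addr0; exact: Q_eq.
Qed.

(** The thresholds approach c from below, so at each point the intermediate value [half] occurs for
    at most one n and does not affect the limit. *)
Let poly_approx_lt (c : R) : poly_approx (fun x => \1_(`]-oo, c[%classic) (y x)).
Proof.
apply: (@poly_approx_bounded_cvg (fun n => step (c - n.+1%:R^-1)) _ (1 + `|half|)).
- by move=> n; exact: poly_approx_step.
- move=> n x; rewrite /step; have h0 := normr_ge0 half.
  by case: ifP => _; [rewrite normr1 lerDl|case: ifP => _; rewrite ?normr0 ?addr_ge0// lerDr].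
- move=> x; apply: cvg_near_cst; rewrite indicE.
  have [yc|cy] := ltP (y x) c.
    rewrite mem_set; last by rewrite /= in_itv.
    have yc0 : 0 < c - y x by rewrite subr_gt0.
    near=> n; rewrite /step ifT// ltrBrDr -ltrBrDl.
    by near: n; exact: near_infty_natSinv_lt (PosNum yc0).
  rewrite memNset; last by rewrite /= in_itv/= ltNge cy.
  apply: nearW => n; have cn : c - n.+1%:R^-1 < y x.
    by apply: lt_le_trans cy; rewrite gtrBl invr_gt0.
  by rewrite /step ltNge (ltW cn)/= gt_eqF.
Unshelve. all: by end_near. Qed.

(** Dynkin's theorem: the sets whose indicator is approximable form a lambda-system, and it contains
    the open left rays, which are stable under intersection and generate the Borel sets. *)
Lemma poly_approx_indic (A : set R) : measurable A ->
  poly_approx (fun x => \1_A (y x)).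
Proof.
pose H := [set A : set R | poly_approx (fun x => \1_A (y x) : R)].
have one : poly_approx (cst 1).
  rewrite (_ : cst 1 = fun x => (1 : {poly R}).[y x]); first exact: poly_approx_poly.
  by apply/funext => x; rewrite hornerE.
have lH : lambda_system setT H.
  split => //.
  - rewrite /H/= (_ : (fun x => _) = cst 1)//.
    by apply/funext => x; rewrite indicT.
  - move=> B {}A AB HB HA; rewrite /H/=.
    rewrite (_ : (fun x => _) = fun x => \1_B (y x) + (-1) * \1_A (y x)).
      by apply: poly_approxD => //; exact: poly_approxZ.
    apply/funext => x; rewrite !indicE in_setD mulN1r.
    have [/set_mem/AB/mem_set ->|] := boolP (y x \in A); first by rewrite andbF subrr.
    by rewrite andbT subr0.
  - move=> F ndF HF; rewrite /H/=.
    apply: (@poly_approx_bounded_cvg (fun n x => \1_(F n) (y x)) _ 1) => //.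
      by move=> n x; rewrite ger0_norm// indicE; case: (_ \in _).
    move=> x; apply: cvg_near_cst.
    have [[n _ Fn]|nF] := pselect ((\bigcup_n F n) (y x)).
      exists n => // m /= nm; rewrite !indicE !mem_set//; first by exists n.
      by have /subsetPset := ndF _ _ nm; apply.
    apply: nearW => m; rewrite !indicE !memNset// => Fm; apply: nF.
    by exists m.
move=> mA; have : (@measurable_realfun.RGenInftyO.G R).-sigma.-measurable A.
  by rewrite -measurable_realfun.RGenInftyO.measurableE.
apply: (@lambda_system_subset _ (@measurable_realfun.RGenInftyO.G R) _ setT H lH) => //.
- move=> _ _ [a ->] [b ->]; exists (Num.min a b).
  by apply/seteqP; split => x /=; rewrite !in_itv/= lt_min => /andP.
- by move=> _ [c ->]; exact: poly_approx_lt.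
Qed.

Lemma poly_approx_simple (s : seq R) (A : R -> set R) :
  (forall z, measurable (A z)) ->
  poly_approx (fun x => \sum_(z <- s) z * \1_(A z) (y x)).
Proof.
move=> mA; elim: s => [|z s IH].
  rewrite (_ : (fun x => _) = fun x => (0 : {poly R}).[y x]); first exact: poly_approx_poly.
  by apply/funext => x; rewrite big_nil horner0.
under eq_fun do rewrite big_cons.
by apply: poly_approxD => //; apply: poly_approxZ; exact: poly_approx_indic.
Qed.

Import HBNNSimple.

(** Adding B makes g nonnegative, hence an increasing limit of simple functions that are all bounded
    by 2B; the constant is subtracted again as a polynomial. *)
Lemma poly_approx_comp (g : R -> R) B : measurable_fun setT g ->
  (forall r, `|g r| <= B) -> poly_approx (g \o y).
Proof.
move=> mg gB.
have mg' : measurable_fun setT (fun r => (g r + B)%:E).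
  by apply/measurable_EFinP; exact: measurable_funD.
have g0 r : setT r -> (0 <= (g r + B)%:E)%E.
  by move=> _; rewrite lee_fin; have := gB r; rewrite ler_norml => /andP[]; lra.
pose G := nnsfun_approx measurableT mg'.
have cG r : G n r @[n --> \oo] --> g r + B.
  have /fine_cvgP[_] := cvg_nnsfun_approx measurableT mg' g0 (I : setT r).
  exact.
have GB n r : `|G n r| <= 2 * B.
  rewrite ger0_norm//; apply: (@le_trans _ _ (g r + B)).
    rewrite -(cvg_lim (@Rhausdorff R) (cG r)).
    apply: (nondecreasing_cvgn_le (u_ := fun n => G n r)).
      by move=> i j ij; exact/lefP/nd_nnsfun_approx.
    by apply/cvg_ex; exists (g r + B); exact: cG.
  by have := gB r; rewrite ler_norml => /andP[]; lra.
rewrite (_ : g \o y = fun x => (g (y x) + B) + (- B) * 1); last first.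
  by apply/funext => x /=; rewrite mulr1 addrK.
apply: poly_approxD; last first.
  rewrite (_ : (fun x => _) = fun x => ((- B)%:P).[y x]); first exact: poly_approx_poly.
  by apply/funext => x; rewrite hornerC mulr1.
apply: (@poly_approx_bounded_cvg (fun n x => G n (y x)) _ (2 * B)) => // n.
rewrite (_ : (fun x => _) = fun x => \sum_(z <- finmap.enum_fset (fset_set (range (G n))))
    z * \1_(G n @^-1` [set z]) (y x)).
  by apply: poly_approx_simple => z; exact: measurable_funPTI.
by apply/funext => x; rewrite {1}fimfunE fsbig_finite.
Qed.

Local Open Scope complex_scope.

Lemma complex_poly_dense (G : R -> R[i]) B (e : R) : cmeasurable G ->
  (forall r, cabs (G r) <= B) -> 0 < e -> exists p : {poly R[i]},
  (\int[mu]_x (cabs (G (y x) - p.[(y x)%:C]) ^+ 2)%:E < e%:E)%E.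
Proof.
move=> [mr mi] GB e0.
have Re_le z : `|complex.Re z| <= cabs z :> R.
  by rewrite cabsE -sqrtr_sqr ler_wsqrtr// lerDl sqr_ge0.
have Im_le z : `|complex.Im z| <= cabs z :> R.
  by rewrite cabsE -sqrtr_sqr ler_wsqrtr// lerDr sqr_ge0.
have [mr' ar] := poly_approx_comp mr (fun r => le_trans (Re_le _) (GB r)).
have [mi' ai] := poly_approx_comp mi (fun r => le_trans (Im_le _) (GB r)).
have e2 : 0 < e / 2 by rewrite divr_gt0.
have [p pr] := ar _ e2; have [s si] := ai _ e2.
exists (map_poly (real_complex R) p + 'i%C *: map_poly (real_complex R) s).
have E x : (cabs (G (y x) - (map_poly (real_complex R) p +
    'i%C *: map_poly (real_complex R) s).[(y x)%:C]) ^+ 2)%:E =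
    (((complex.Re (G (y x)) - p.[y x]) ^+ 2)%:E + ((complex.Im (G (y x)) - s.[y x]) ^+ 2)%:E)%E.
  rewrite -EFinD hornerD hornerZ !horner_map cabsE sqr_sqrtr ?addr_ge0 ?sqr_ge0//.
  by case: (G (y x)) => u v /=; congr (_ ^+ 2 + _ ^+ 2)%:E; ring.
under eq_integral do rewrite E.
have mp := measurable_poly p; have ms := measurable_poly s.
rewrite ge0_integralD//; first last.
- by apply: measurable_sqr; exact: measurable_funB.
- by move=> x _; rewrite lee_fin sqr_ge0.
- by apply: measurable_sqr; exact: measurable_funB.
- by move=> x _; rewrite lee_fin sqr_ge0.
by rewrite [e]splitr EFinD; apply: lteD.
Qed.

End polynomial_density.

(** * Polynomials multiplied by a weight, for complex functions *)

Section L2_norm.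
Local Open Scope complex_scope.
Context {R : realType}.
Implicit Types (m : {measure set R[i] -> \bar R}) (f g : R[i] -> R[i]).

Lemma measurable_sqr_cabs d (T : measurableType d) (f : T -> R[i]) : cmeasurable f ->
  measurable_fun setT (fun x => (cabs (f x) ^+ 2)%:E).
Proof.
by move=> mf; apply/measurable_EFinP; apply: measurable_funX; exact: cmeasurable_cabs.
Qed.

Lemma sqr_cabs_ge0 (z : R[i]) : (0 <= (cabs z ^+ 2)%:E)%E.
Proof. by rewrite lee_fin sqr_ge0. Qed.

Lemma sqr_cabsD_le (z w : R[i]) :
  cabs (z + w) ^+ 2 <= 2 * cabs z ^+ 2 + 2 * cabs w ^+ 2.
Proof.
have := cabsD z w; have := cabs_ge0 (z + w); have := sqr_ge0 (cabs z - cabs w).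
by move: (cabs _) (cabs z) (cabs w) => r s t; nra.
Qed.

Lemma norm2sq_ge0 m f : (0 <= norm2sq m f)%E.
Proof. by apply: integral_ge0 => x _; exact: sqr_cabs_ge0. Qed.

Lemma norm2sq_add m1 m2 f : cmeasurable f ->
  norm2sq (measure_add m1 m2) f = (norm2sq m1 f + norm2sq m2 f)%E.
Proof.
move=> mf; rewrite /norm2sq ge0_integral_measure_add//.
  by move=> x _; exact: sqr_cabs_ge0.
exact: measurable_sqr_cabs.
Qed.

Lemma norm2sqD_le m f g : cmeasurable f -> cmeasurable g ->
  (norm2sq m (fun x => f x + g x)%R <= 2%:E * norm2sq m f + 2%:E * norm2sq m g)%E.
Proof.
move=> mf mg; rewrite /norm2sq -!ge0_integralZl//;
  try (by move=> x _; exact: sqr_cabs_ge0); try exact: measurable_sqr_cabs.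
rewrite -ge0_integralD//; try (by move=> x _; rewrite mule_ge0// sqr_cabs_ge0);
  try (by apply: measurable_funeM; exact: measurable_sqr_cabs).
apply: ge0_le_integral => //.
- by move=> x _; exact: sqr_cabs_ge0.
- by apply: measurable_sqr_cabs; exact: cmeasurableD.
- by apply: emeasurable_funD; apply: measurable_funeM; exact: measurable_sqr_cabs.
- by move=> x _; rewrite -!EFinM -EFinD lee_fin sqr_cabsD_le.
Qed.

Lemma cabs_horner_le (p : {poly R[i]}) (M : R) : exists B : R,
  forall z, cabs z <= M -> cabs p.[z] <= B.
Proof.
exists (\sum_(i < size p) cabs p`_i * M ^+ i) => z zM; rewrite horner_coef.
elim/big_ind2: _ => [|z1 r1 z2 r2 h1 h2|i _].
- by rewrite (cabsR 0) normr0.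
- by rewrite (le_trans (cabsD _ _))// lerD.
rewrite cabsM ler_wpM2l ?cabs_ge0//.
have -> : cabs (z ^+ i) = cabs z ^+ i.
  by elim: (nat_of_ord i) => [|n IH]; rewrite ?(cabsR 1) ?normr1// !exprS cabsM IH.
by rewrite lerXn2r ?nnegrE ?cabs_ge0 ?(le_trans (cabs_ge0 _) zM).
Qed.

End L2_norm.

Section section_of_joukowski.
Local Open Scope complex_scope.
Context {R : realType}.

(* Inverse, up to [x |-> 1/x], of [x |-> x + 1/x] on the unit circle and on the
   positive reals; it relies on [Num.sqrt] vanishing at negative arguments. *)
Definition jsec (r : R) : R[i] :=
  ((r + Num.sqrt (r ^+ 2 - 4)) / 2) +i* Num.sqrt (1 - r ^+ 2 / 4).

Lemma measurable_jsec : measurable_fun setT jsec.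
Proof.
apply: (@measurability _ _ _ _ _ _ (@open R[i])) => // _ [A oA <-].
rewrite setTI; apply: open_measurable.
apply: open_comp => // x _; apply: cvg_complex => /=.
  apply: cvgM; last exact: cvg_cst.
  apply: cvgD; first exact: cvg_id.
  apply: continuous_cvg; first exact: sqrt_continuous.
  by apply: cvgB; [apply: exprn_continuous|exact: cvg_cst].
apply: continuous_cvg; first exact: sqrt_continuous.
apply: cvgB; first exact: cvg_cst.
by apply: cvgM; [apply: exprn_continuous|exact: cvg_cst].
Qed.

Definition circle_or_pos (x : R[i]) := cabs x = 1 \/ exists2 r : R, 0 < r & x = r%:C.

Lemma circle_inv (x : R[i]) : cabs x = 1 -> x^-1 = conjc x.
Proof.
move=> x1; have nx : `|x| = 1 by rewrite normc_cabs x1.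
have z0 : x != 0 by rewrite -normr_eq0 nx oner_eq0.
by apply: (mulfI z0); rewrite divff// -sqr_normc nx expr1n.
Qed.

Lemma jouk_real x : circle_or_pos x -> x + x^-1 = (complex.Re (x + x^-1))%:C.
Proof.
case=> [/circle_inv ->|[r r0 ->]]; last by rewrite -fmorphV -rmorphD.
by case: x => u v; apply/eqP; rewrite eq_complex /= subrr !eqxx.
Qed.

Lemma jsecP x : circle_or_pos x ->
  jsec (complex.Re (x + x^-1)) = x \/ jsec (complex.Re (x + x^-1)) = x^-1.
Proof.
case=> [x1|[r r0 ->]].
  rewrite circle_inv//; move: x1; case: x => u v; rewrite cabsE/= => uv.
  have {}uv : u ^+ 2 + v ^+ 2 = 1.
    by rewrite -[LHS]sqr_sqrtr ?addr_ge0 ?sqr_ge0// uv expr1n.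
  have v0 := sqr_ge0 v; rewrite /jsec.
  have -> : Num.sqrt ((u + u) ^+ 2 - 4) = 0.
    by apply: ler0_sqrtr; move: uv v0; rewrite !expr2; nra.
  have -> : 1 - (u + u) ^+ 2 / 4 = v ^+ 2.
    have -> : v ^+ 2 = 1 - u ^+ 2 by rewrite -uv [RHS]addrC addKr.
    by field.
  rewrite sqrtr_sqr addr0 -mulr2n -(mulr_natr u) mulfK ?pnatr_eq0//.
  by have [_|_] := ger0P v; [left|right].
rewrite -fmorphV -rmorphD /jsec /=.
have E : (r + r^-1) ^+ 2 - 4 = (r - r^-1) ^+ 2 by field; rewrite gt_eqF.
have -> : Num.sqrt (1 - (r + r^-1) ^+ 2 / 4) = 0.
  apply: ler0_sqrtr; have := sqr_ge0 (r - r^-1); rewrite -E.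
  by move: ((r + r^-1) ^+ 2) => z; lra.
rewrite E sqrtr_sqr; have [_|_] := ger0P (r - r^-1).
  by left; congr (_ +i* _); field; rewrite gt_eqF.
by right; congr (_ +i* _); field; rewrite gt_eqF.
Qed.

End section_of_joukowski.

Section weighted_polynomials.
Local Open Scope complex_scope.
Context {R : realType} (nu : {measure set R[i] -> \bar R}) (nuoo : (nu setT < +oo)%E).
Context (h : R[i] -> R[i]) (mh : cmeasurable h) (M H : R).
Context (hK : {ae nu, forall x, [/\ circle_or_pos x, `|complex.Re (x + x^-1)| <= M,
  h x != 0, cabs (h x) <= H & h x^-1 = h x]}).

(** x + 1/x clipped to [-M, M]: [complex_poly_dense] asks for a real function bounded everywhere,
    while the bound by M holds only almost everywhere. *)
Let yy (x : R[i]) : R := Num.max (- M) (Num.min M (complex.Re (x + x^-1))).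

Let cm_jouk : cmeasurable (fun x : R[i] => x + x^-1).
Proof.
by apply: cmeasurableD; [|apply: cmeasurableV]; exact: cmeasurable_id.
Qed.

Let myy : measurable_fun setT yy.
Proof.
have [mr _] := cm_jouk.
by apply: measurable_maxr => //; exact: measurable_minr.
Qed.

Let yyE x : `|complex.Re (x + x^-1)| <= M -> yy x = complex.Re (x + x^-1).
Proof. by rewrite ler_norml /yy => /andP[h1 h2]; rewrite (min_idPr h2) (max_idPr h1). Qed.

Let yyM x : `|yy x| <= `|M|.
Proof.
rewrite /yy; have [M0|M0] := leP 0 M.
  rewrite (ger0_norm M0) ler_norml le_max lexx/= ge_max ge_min lexx andbT.
  by rewrite (le_trans _ M0)// oppr_le0.
rewrite (max_idPl _) ?normrN// ge_min; apply/orP; left.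
by rewrite (le_trans (ltW M0))// oppr_ge0 ltW.
Qed.

Let weighted_poly_meas (p : {poly R[i]}) :
  cmeasurable (fun x : R[i] => p.[x + x^-1] * h x).
Proof. by apply: cmeasurableM => //; exact: cmeasurable_horner. Qed.

Section truncation.
Context (u : R[i] -> R[i]) (mu : cmeasurable u) (mus : cmeasurable (u \o jsec)).
Context (us : {ae nu, forall x, u x = u x^-1}) (ufin : (norm2sq nu u < +oo)%E).

(** The quotient u/h is read as a function of r = x + 1/x through [jsec], which is harmless because
    u and h are invariant under inversion almost everywhere. It is cut off where |h| < 1/n or |u| >
    n, so as to be bounded. *)
Let good n r := (1 <= n%:R * cabs (h (jsec r))) && (cabs (u (jsec r)) <= n%:R).
Let trunc n r : R[i] := if good n r then u (jsec r) / h (jsec r) else 0.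

Let mhs : cmeasurable (h \o jsec).
Proof.
have [h1 h2] := mh; split; [apply: (measurableT_comp h1)|apply: (measurableT_comp h2)];
  exact: measurable_jsec.
Qed.

Let mgood n : measurable_fun setT (good n).
Proof.
apply: measurable_and.
  apply: measurable_fun_ler => //; apply: measurable_funM => //.
  exact: cmeasurable_cabs mhs.
by apply: measurable_fun_ler => //; exact: cmeasurable_cabs mus.
Qed.

Let mtrunc n : cmeasurable (trunc n).
Proof.
have [m1 m2] : cmeasurable (fun r => (u \o jsec) r / (h \o jsec) r).
  by apply: cmeasurableM => //; exact: cmeasurableV.
split.
  rewrite (_ : (fun x => _) = fun r => if good n r then
    complex.Re ((u \o jsec) r / (h \o jsec) r) else 0).
    exact: measurable_fun_ifT.
  by apply/funext => r; rewrite /trunc; case: ifP.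
rewrite (_ : (fun x => _) = fun r => if good n r then
  complex.Im ((u \o jsec) r / (h \o jsec) r) else 0).
  exact: measurable_fun_ifT.
by apply/funext => r; rewrite /trunc; case: ifP.
Qed.

Let trunc_le n r : cabs (trunc n r) <= n%:R * n%:R.
Proof.
rewrite /trunc; case: ifP => [/andP[h1 u1]|_]; last by rewrite (cabsR 0) normr0 mulr_ge0.
rewrite cabsM cabsV ler_pM ?cabs_ge0 ?invr_ge0 ?cabs_ge0//.
have hp : 0 < cabs (h (jsec r)).
  rewrite lt_neqAle cabs_ge0 andbT; apply/eqP => h0.
  by move: h1; rewrite -h0 mulr0 ler10.
by rewrite -[leLHS]mul1r ler_pdivrMr.
Qed.

Let rest n x : R[i] := u x - trunc n (yy x) * h x.

Let mtyy n : cmeasurable (trunc n \o yy).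
Proof.
have [m1 m2] := mtrunc n.
by split; [exact: (measurableT_comp m1)|exact: (measurableT_comp m2)].
Qed.

Let mrest n : cmeasurable (rest n).
Proof. by apply: cmeasurableB => //; apply: cmeasurableM => //; exact: mtyy. Qed.

Let restE : {ae nu, forall x n, h x != 0 /\ rest n x =
  if (1 <= n%:R * cabs (h x)) && (cabs (u x) <= n%:R) then 0 else u x}.
Proof.
apply: filterS2 hK us => x [Kx xM h0 _ hs] uV n; split=> //.
rewrite /rest /trunc /good yyE//.
have [-> ->] : h (jsec (complex.Re (x + x^-1))) = h x /\ u (jsec (complex.Re (x + x^-1))) = u x.
  by have [->|->] := jsecP Kx.
by case: ifP => _; rewrite ?mul0r ?subr0// divfK// subrr.
Qed.

(** As h is nonzero almost everywhere, almost every point eventually passes both cutoffs; the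
    remainder is dominated by |u|^2. *)
Let rest_cvg (e : R) : 0 < e -> exists n, (norm2sq nu (rest n) < e%:E)%E.
Proof.
move=> e0; pose f n x := (cabs (rest n x) ^+ 2)%:E.
have mf n : measurable_fun setT (f n) by exact: measurable_sqr_cabs.
have ig : nu.-integrable setT (fun x => (cabs (u x) ^+ 2)%:E).
  apply/integrableP; split; first exact: measurable_sqr_cabs.
  by under eq_integral do rewrite gee0_abs ?sqr_cabs_ge0//.
have cvf : {ae nu, forall x, setT x -> f ^~ x @ \oo --> (cst 0%E x)}.
  apply: filterS restE => x rE _; apply: cvg_near_cst.
  have h0 : 0 < cabs (h x) by rewrite cabs_gt0; case: (rE 0%N).
  near=> n; rewrite /f/=; have [_ ->] := rE n.
  rewrite ifT ?(cabsR 0) ?normr0 ?expr0n//; apply/andP; split.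
    rewrite -ler_pdivrMr//; near: n; exact: nbhs_infty_ger.
  near: n; exact: nbhs_infty_ger.
have domf : {ae nu, forall x n, setT x -> (`|f n x| <= (cabs (u x) ^+ 2)%:E)%E}.
  apply: filterS restE => x rE n _; rewrite gee0_abs ?sqr_cabs_ge0// /f.
  have [_ ->] := rE n; rewrite lee_fin; case: ifP => // _.
  by rewrite (cabsR 0) normr0 expr0n/= sqr_ge0.
have [_ _] := dominated_convergence measurableT mf (measurable_cst _) cvf ig domf.
rewrite integral0 => /fine_cvgP[fin_near /cvgrPdist_lt/(_ _ e0) dist_near].
have [n [fn dn]] : exists n, (\int[nu]_x f n x)%E \is a fin_num /\
    `|0 - fine (\int[nu]_x f n x)%E| < e.
  by apply: (@filter_ex _ \oo); apply: filterI.
exists n; rewrite /norm2sq -[X in (X < _)%E](fineK fn) lte_fin.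
by move: dn; rewrite sub0r normrN; apply: le_lt_trans; exact: ler_norm.
Unshelve. all: by end_near. Qed.

(** u - p h = [rest] + ([trunc] - p) h: truncation makes the first term small, and polynomial
    density makes the second small because |h| <= H. *)
Lemma weighted_poly_dense (e : R) : 0 < e -> exists p : {poly R[i]},
  (norm2sq nu (fun x => u x - p.[x + x^-1] * h x)%R < e%:E)%E.
Proof.
move=> e0; have e4 : 0 < e / 4 by rewrite divr_gt0.
have H0 : 0 < H ^+ 2 + 1 by rewrite ltr_wpDl ?sqr_ge0.
have eH : 0 < e / 4 / (H ^+ 2 + 1) by rewrite divr_gt0.
have [n rn] := rest_cvg e4.
have [p pn] := complex_poly_dense nuoo myy yyM (mtrunc n) (trunc_le n) eH.
exists p.
have mp : cmeasurable (fun x => p.[(yy x)%:C]).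
  by apply: cmeasurable_horner; exact: cmeasurable_real.
have md : cmeasurable (fun x => trunc n (yy x) - p.[(yy x)%:C]).
  by apply: cmeasurableB => //; exact: mtyy.
pose g x := (trunc n (yy x) - p.[(yy x)%:C]) * h x.
have mg : cmeasurable g by exact: cmeasurableM.
have gE : {ae nu, forall x, u x - p.[x + x^-1] * h x = rest n x + g x}.
  apply: filterS hK => x [Kx xM _ _ _]; rewrite /g /rest yyE// -jouk_real//; ring.
have -> : norm2sq nu (fun x => u x - p.[x + x^-1] * h x) =
    norm2sq nu (fun x => rest n x + g x).
  apply: ae_eq_integral => //.
  - by apply: measurable_sqr_cabs; apply: cmeasurableB.
  - by apply: measurable_sqr_cabs; exact: cmeasurableD.
  - by apply: filterS gE => x -> _.
apply: (le_lt_trans (norm2sqD_le _ (mrest n) mg)).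
have gn : (norm2sq nu g < (e / 4)%:E)%E.
  apply: (@le_lt_trans _ _ (\int[nu]_x ((H ^+ 2)%:E * (cabs (trunc n (yy x) - p.[(yy x)%:C]) ^+ 2)%:E))%E).
    apply: ae_ge0_le_integral => //.
    - by move=> x _; exact: sqr_cabs_ge0.
    - exact: measurable_sqr_cabs.
    - by move=> x _; rewrite mule_ge0 ?sqr_cabs_ge0// lee_fin sqr_ge0.
    - by apply: measurable_funeM; exact: measurable_sqr_cabs.
    - apply: filterS hK => x [_ _ _ hH _] _; rewrite -EFinM lee_fin /g cabsM exprMn mulrC.
      rewrite ler_wpM2r ?sqr_ge0// lerXn2r ?nnegrE ?cabs_ge0//.
      exact: le_trans (cabs_ge0 _) hH.
  rewrite ge0_integralZl//; first last.
  - by rewrite lee_fin sqr_ge0.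
  - by move=> x _; exact: sqr_cabs_ge0.
  - exact: measurable_sqr_cabs.
  apply: (@le_lt_trans _ _ ((H ^+ 2)%:E * (e / 4 / (H ^+ 2 + 1))%:E)%E).
    by apply: lee_wpmul2l; [rewrite lee_fin sqr_ge0|exact: ltW].
  by rewrite -EFinM lte_fin mulrA ltr_pdivrMr// mulrC ltr_pM2l// ltrDl.
have -> : e%:E = (2%:E * (e / 4)%:E + 2%:E * (e / 4)%:E)%E.
  by rewrite -!EFinM -EFinD; congr _%:E; field.
by apply: lteD; rewrite lte_pmul2l// lte_fin.
Qed.

End truncation.
End weighted_polynomials.

(** * The measure off D_- *)

Section nneseries_int.
Context {R : realType}.
Implicit Types (g : int -> \bar R).
Local Open Scope ereal_scope.

(** Both series equal the unordered sum of g over the integers: the left one enumerates it by [Posz]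
    and [Negz], the right one by k - n, outside of whose range g vanishes. *)
Lemma nneseries_int_rev g (k : int) : (forall j, 0 <= g j) ->
  (forall j, (k < j)%R -> g j = 0) ->
  \sum_(0 <= n <oo) (g (Posz n) + g (Negz n)) = \sum_(0 <= n <oo) g (k - n%:Z)%R.
Proof.
move=> g0 gk; rewrite nneseriesD//.
transitivity (\esum_(j in [set: int]) g j).
  rewrite (esumID (range Posz))// setTI; congr (_ + _).
    rewrite -esum_pred_image//; last by move=> i j _ _ [].
    by congr (esum _ _); apply/seteqP; split => j [n _ <-]; exists n.
  rewrite setTI (_ : ~` range Posz = range Negz); last first.
    apply/seteqP; split => [[n|n]|_ [n _ <-]]//=; last by move=> [].
    - by move=> h; exfalso; apply: h; exists n.
    - by exists n.
  rewrite -esum_pred_image//; last by move=> i j _ _ [].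
  by congr (esum _ _); apply/seteqP; split => j [n _ <-]; exists n.
rewrite (esumID (range (fun n : nat => (k - n%:Z)%R)))// setTI.
rewrite [X in _ + X]esum1 ?adde0; last first.
  move=> j [_ /= h]; apply: gk; rewrite ltNge; apply/negP => jk.
  apply: h; exists `|k - j|%N => //.
  by rewrite gez0_abs ?subr_ge0// subKr.
rewrite -esum_pred_image//; last by move=> i j _ _ /addrI/oppr_inj[].
by congr (esum _ _); apply/seteqP; split => j [n _ <-]; exists n.
Qed.

End nneseries_int.

Section discrete_integrals.
Local Open Scope complex_scope.
Local Open Scope ereal_scope.
Context {R : realType} (q : R).
Implicit Types (beta : params R) (F : R[i] -> \bar R).

Lemma ge0_integral_pair_mass (x : R[i]) F : measurable_fun setT F -> (forall z, 0 <= F z) ->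
  \int[pair_mass x]_z F z = F x + F x^-1%R.
Proof.
move=> mF F0; rewrite /pair_mass ge0_integral_measure_add//.
by rewrite !integral_dirac// !diracT !mul1e.
Qed.

Lemma ge0_integral_plus_part beta F : measurable_fun setT F -> (forall z, 0 <= F z) ->
  \int[plus_part q beta]_z F z = \sum_(0 <= n <oo) ((plus_weight q beta n)%:E *
    (F (pole_plus q n beta)%:C + F (pole_plus q n beta)%:C^-1%R)).
Proof.
move=> mF F0; rewrite /plus_part ge0_integral_measure_series//.
apply: eq_eseriesr => n _; rewrite ge0_integral_mscale//.
by rewrite ge0_integral_pair_mass.
Qed.

Lemma ge0_integral_minus_part beta (k : int) F : measurable_fun setT F -> (forall z, 0 <= F z) ->
  (forall j, (pole_minus q j beta < -1)%R -> (j <= k)%R) ->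
  \int[minus_part q beta]_z F z = \sum_(0 <= n <oo) ((minus_weight q beta (k - n%:Z))%:E *
    (F (pole_minus q (k - n%:Z) beta)%:C + F (pole_minus q (k - n%:Z) beta)%:C^-1%R)).
Proof.
move=> mF F0 hk; rewrite /minus_part ge0_integral_measure_series//.
pose g j := (minus_weight q beta j)%:E *
    (F (pole_minus q j beta)%:C + F (pole_minus q j beta)%:C^-1%R).
rewrite -(nneseries_int_rev (g := g)); first last.
- move=> j kj; rewrite /g /minus_weight ifF ?mul0e//; apply/negbTE/negP => /hk.
  by rewrite leNgt kj.
- by move=> j; rewrite mule_ge0 ?adde_ge0// lee_fin minus_weight_ge0.
have mE j : \int[minus_mass q beta j]_z F z = g j.
  rewrite /minus_mass (ge0_integral_mscale (pair_mass _) measurableT _ mF) => [|? _]; last exact: F0.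
  by rewrite (ge0_integral_pair_mass _ mF F0).
by apply: eq_eseriesr => n _; rewrite ge0_integral_measure_add// -!mE.
Qed.

End discrete_integrals.

(** Separates the factors of W in x from those in 1/x. As 1/0 = 0, the regrouping also holds at
    zeros of the denominators, so no case distinction arises. *)
Lemma fieldAC14 (K : fieldType) (u1 u2 a1 a2 b1 b2 c1 c2 d1 d2 s1 s2 t1 t2 : K) :
  u1 * u2 / (a1 * a2 * (b1 * b2) * (c1 * c2) * (d1 * d2)) * (s1 * s2 / (t1 * t2)) =
  u1 / (a1 * b1 * c1 * d1) * (s1 / t1) * (u2 / (a2 * b2 * c2 * d2) * (s2 / t2)).
Proof. by rewrite !invfM; ring. Qed.

(** The quotient [d / d] stays because it stands for (d x; q)_oo divided by itself, which may be 0/0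
    = 0; its modulus is at most 1 in all cases. *)
Lemma fieldAC8 (K : fieldType) (u a b c d e t : K) :
  u / (a * b * c * d) * (d * e / t) = u / (a * t) * (b * c)^-1 * (d / d) * e.
Proof. by rewrite !invfM; ring. Qed.

(** * Bounds for W, 1/(G Theta) and G^tau on the circle and on D_+ *)

Section circle_bounds.
Local Open Scope complex_scope.
Context {R : realType} (q : R) (q01 : 0 < q < 1).
Implicit Types (x z : R[i]) (a b c d D t : R).

Let q0 : 0 < q. Proof. by case/andP: q01. Qed.
Let q1 : q < 1. Proof. by case/andP: q01. Qed.

Lemma cabs_inv_circle x : cabs x = 1 -> cabs x^-1 = 1.
Proof. by move=> x1; rewrite cabsV x1 invr1. Qed.

Let cabsrM (s : R) x : cabs x = 1 -> cabs (s%:C * x) = `|s|.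
Proof. by move=> x1; rewrite cabsM x1 mulr1 cabsR. Qed.

Let cabs_1B_circle (s : R) x : 0 <= s -> cabs x = 1 -> `|1 - s| <= cabs (1 - s%:C * x).
Proof.
move=> s0 x1; rewrite -[leLHS]cabsR rmorphB/=.
have := cabs_ge0 (1 - s%:C * x); have := cabs_ge0 (1%:C - s%:C).
have x2 : complex.Re x ^+ 2 + complex.Im x ^+ 2 = 1.
  by rewrite -[LHS]sqr_sqrtr ?addr_ge0 ?sqr_ge0// -cabsE x1 expr1n.
move=> h1 h2; rewrite -(ler_pXn2r (n:=2))// ?nnegrE// !cabsE !sqr_sqrtr ?addr_ge0 ?sqr_ge0//.
case: x {h1 h2 x1} x2 => u v /= uv.
have u1 : u <= 1 by have := sqr_ge0 v; have := sqr_ge0 (u - 1); rewrite !expr2 in uv *; nra.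
have -> : (1 - (s * u - 0 * v)) ^+ 2 + (0 - (s * v + 0 * u)) ^+ 2 =
  1 - 2 * s * u + s ^+ 2 * (u ^+ 2 + v ^+ 2) by ring.
rewrite uv; have : 0 <= s * (1 - u) by rewrite mulr_ge0// subr_ge0.
by rewrite !expr2; nra.
Qed.

(* The only factor of [(a x; q)_oo] that may vanish on the unit circle is [1 - x]. *)
Lemma cabs_qpoch_circle_ge a : 0 <= a -> exists2 C, 0 < C &
  forall x, cabs x = 1 -> C * cabs (1 - x) <= cabs (qpoch q (a%:C * x)).
Proof.
move=> a0; have [m [hm am]] : exists m, a * q ^+ m <= q /\ (forall i, (m <= i)%N -> a * q ^+ i != 1).
  have [m hm] := expq_lt q01 (divr_gt0 q0 (ltr_wpDl a0 ltr01)).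
  have am : a * q ^+ m <= q.
    move: hm; rewrite ltr_pdivlMr ?ltr_wpDl// => /ltW; apply: le_trans.
    by rewrite mulrDr mulr1 mulrC lerDl exprn_ge0// ltW.
  exists m; split=> // i mi; rewrite lt_eqF// (le_lt_trans _ q1)// (le_trans _ am)//.
  by rewrite ler_wpM2l// ler_wiXn2l// ltW.
pose f i : R := if a * q ^+ i == 1 then 1 else `|1 - a * q ^+ i|.
have f0 i : 0 < f i.
  by rewrite /f; case: eqP => // /eqP ne; rewrite normr_gt0 subr_eq0 eq_sym.
have rq : 0 < rpoch q q by exact: rpoch_gt0.
have tail x : cabs x = 1 -> rpoch q q <= cabs (qpoch q (a%:C * x * (q ^+ m)%:C)).
  move=> x1; apply: (cabs_qpoch_ge q01) (ltW q1).
  by rewrite mulrAC -rmorphM cabsrM// ger0_norm// mulr_ge0// exprn_ge0// ltW.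
(* The factor 1/2 compensates |1 - x| <= 2 when no [a q^i] equals 1. When one does, the
   corresponding [f i] is 1 and the factor is 1 - x itself. *)
exists (\prod_(i < m) f i * rpoch q q / 2).
  by rewrite divr_gt0// mulr_gt0// prodr_gt0.
move=> x x1; rewrite (qpoch_shift q01 m) cabsM cabs_prod_1B.
have x2 : cabs (1 - x) <= 2.
  by rewrite (le_trans (cabsD _ _))// cabsN x1 (cabsR 1) normr1.
have fi i : cabs (1 - a%:C * x * (q ^+ i)%:C) >= if a * q ^+ i == 1 then cabs (1 - x) else f i.
  rewrite mulrAC -rmorphM /f; case: eqP => [->|_]; first by rewrite mul1r.
  by apply: cabs_1B_circle => //; rewrite mulr_ge0// exprn_ge0// ltW.
suff P : \prod_(i < m) f i / 2 * cabs (1 - x) <= \prod_(i < m) cabs (1 - a%:C * x * (q ^+ i)%:C).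
  have -> : \prod_(i < m) f i * rpoch q q / 2 * cabs (1 - x) =
    \prod_(i < m) f i / 2 * cabs (1 - x) * rpoch q q by ring.
  apply: ler_pM => //; [|exact: ltW|exact: tail].
  by rewrite mulr_ge0 ?cabs_ge0// divr_ge0// prodr_ge0// => i _; exact: ltW.
have [/existsP[i0 /eqP ai]|/existsPn ne] := boolP [exists i : 'I_m, a * q ^+ i == 1].
  have fi0 : f i0 = 1 by rewrite /f ai eqxx.
  rewrite (bigD1 i0)//= [leRHS](bigD1 i0)//= fi0 mul1r.
  rewrite mulrC; apply: ler_pM; rewrite ?cabs_ge0 ?divr_ge0//.
  - by rewrite prodr_ge0// => i _; exact: ltW (f0 i).
  - by have := fi i0; rewrite ai eqxx.
  apply: (@le_trans _ _ (\prod_(i < m | i != i0) f i)).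
    rewrite ler_pdivrMr// ler_peMr ?ler1n// prodr_ge0// => i _; exact: ltW.
  apply: ler_prod => i ii0; rewrite (ltW (f0 i))/=.
  have := fi i; case: eqP => // ai2; exfalso; move: ii0 => /eqP; apply.
  apply/val_inj/eqP; have := ai; rewrite -ai2 => /(mulfI _) => /=.
  have an0 : a != 0 by apply: contra_eq_neq ai => ->; rewrite mul0r eq_sym oner_eq0.
  move=> /(_ an0)/eqP; rewrite eq_sym => /eqP E.
  rewrite eqn_leq -!(ler_iXn2l q0 q1) E lexx //.
apply: (@le_trans _ _ (\prod_(i < m) f i)).
  rewrite mulrAC ler_pdivrMr// ler_wpM2l// prodr_ge0// => i _; exact: ltW.
by apply: ler_prod => i _; rewrite (ltW (f0 i))/=; have := fi i; rewrite (negbTE (ne i)).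
Qed.

(** Quasi-periodicity moves D to -E with q < E <= 1. There one of the two q-factorials is bounded
    below by (q/E; q)_oo > 0, and the other can vanish on the circle only at x = -1. *)
Lemma cabs_theta_circle_ge D : D < 0 -> exists2 C, 0 < C &
  forall x, cabs x = 1 -> C * cabs (1 + x) <= cabs (theta q (D%:C * x)).
Proof.
move=> D0; have nD : 0 < - D by rewrite oppr_gt0.
have [k [/andP[k1 k2] _]] := exists_unique_kexp q01 nD.
pose E := - D * q ^ (k + 1).
have EE : E = - D * q ^ k * q by rewrite /E expfzDr ?gt_eqF// expr1z mulrA.
have E1 : E <= 1 by rewrite EE -ler_pdivlMr// div1r.
have Eq : q < E by rewrite EE ltr_pMl.
have E0 : 0 < E by exact: lt_trans Eq.
have [c c2 cE] := theta_expz q01 (k + 1).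
have c0 : c != 0 by rewrite -sqrf_eq0 c2 invr_eq0 expfz_neq0// gt_eqF.
have [C C0 CE] := cabs_qpoch_circle_ge (ltW E0).
have rE : 0 < rpoch q (q / E) by rewrite rpoch_gt0// ltr_pdivrMr// mul1r.
exists (C * rpoch q (q / E) * (`|c| * E ^ (k + 1))).
  by rewrite !mulr_gt0// ?normr_gt0// exprz_gt0.
move=> x x1; have x0 : x != 0.
  by apply: contra_eq_neq x1 => ->; rewrite (cabsR 0) normr0 eq_sym oner_eq0.
have -> : D%:C * x = (- E)%:C * x / (q ^ (k + 1))%:C.
  have DE : D = - E / q ^ (k + 1).
    by rewrite /E !mulNr opprK mulfK// expfz_neq0// gt_eqF.
  by rewrite mulrAC -fmorphV -rmorphM/= -DE.
rewrite cE; last by rewrite mulf_neq0// fmorph_eq0 oppr_eq0 gt_eqF.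
rewrite cabsM cabsM cabsR.
have -> : cabs (((- E)%:C * x) ^ (k + 1)) = E ^ (k + 1).
  have -> : cabs (((- E)%:C * x) ^ (k + 1)) = cabs ((- E)%:C * x) ^ (k + 1).
    move: (_ * x) (k + 1) => z [] n.
      by elim: n => [|n IH]; rewrite ?(cabsR 1) ?normr1// !exprSz cabsM IH.
    rewrite !NegzE -!exprnN cabsV; congr (_^-1).
    by elim: n => [|n IH]; rewrite ?expr1// exprS [RHS]exprS cabsM IH.
  by rewrite cabsrM// normrN ger0_norm// ltW.
have cE0 : 0 <= `|c| * E ^ (k + 1) by rewrite mulr_ge0// exprz_ge0// ltW.
rewrite mulrAC [leRHS]mulrC; apply: ler_wpM2r => //.
rewrite /theta cabsM mulrAC; apply: ler_pM; rewrite ?mulr_ge0 ?cabs_ge0 ?(ltW C0) ?(ltW rE)//.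
  have -> : 1 + x = 1 - (- x) by rewrite opprK.
  by rewrite rmorphN/= mulNr -mulrN CE// cabsN.
apply: (cabs_qpoch_ge q01); last by rewrite ler_pdivrMr// mul1r ltW.
by rewrite cabsM cabsV cabsrM// normrN cabsR !ger0_norm// ltW.
Qed.

(** The zeros at 1 and -1 make up for the possible zeros of (a x; q)_oo and of theta(d t x) in the
    denominator of W. *)
Lemma cabs_qpoch_sqr_le : exists2 C, 0 < C & forall x, cabs x = 1 ->
  cabs (qpoch q (x ^+ 2)) <= C * (cabs (1 - x) * cabs (1 + x)).
Proof.
exists (rpoch q (- q)); first by rewrite rpoch_gt0// (lt_trans _ ltr01)// oppr_lt0.
move=> x x1; rewrite (qpochS q01) cabsM -[cabs (1 - x) * _]cabsM -subr_sqr expr1n mulrC.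
by rewrite ler_wpM2r ?cabs_ge0// cabs_qpoch_le// !cabsM x1 !mul1r cabsR ger0_norm// ltW.
Qed.

Let cabs_divself z : cabs (z / z) <= 1.
Proof.
have [->|z0] := eqVneq z 0; first by rewrite mul0r (cabsR 0) normr0.
by rewrite divff// (cabsR 1) normr1.
Qed.

Context (a b c d t : R) (adm : admissible q (a, b, c, d, t)).

(** b^2 <= ab < 1, and likewise for c, so among a, b, c only a can produce a zero of the denominator
    on the circle. The inequality q max(1, a) < d keeps q/(d x) inside the unit disc on the circle
    and for x or 1/x in D_+. *)
Let bounds : [/\ 0 < a, 0 < b < 1, 0 < c < 1, q * Num.max 1 a < d & d * t < 0].
Proof.
case: adm => t0 [b0 c0 ba ca] ad [bd cd] [ab ac].
have a0 : 0 < a by exact: lt_le_trans ba.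
have d0 : 0 < d.
  have : 0 < d / q by exact: lt_trans ad.
  by rewrite pmulr_lgt0 ?invr_gt0.
have sq1 u : 0 < u -> u <= a -> a * u < 1 -> u < 1.
  move=> u0 ua au; rewrite -(ltr_pXn2r (n:=2))// ?nnegrE ?(ltW u0)// expr1n expr2.
  by rewrite (le_lt_trans _ au)// ler_pM2r.
have b1 := sq1 _ b0 ba ab; have c1 := sq1 _ c0 ca ac.
split => //; rewrite ?b0 ?c0//.
  rewrite maxr_pMr ?(ltW q0)// mulr1 gt_max; apply/andP; split.
    by rewrite (le_lt_trans bd)// gtr_pMl.
  by rewrite mulrC -ltr_pdivlMr.
by rewrite pmulr_rlt0.
Qed.

(** The half of W that contains x rather than 1/x. Inversion preserves the circle, so bounding this
    half bounds W. *)
Let wh x : R[i] := qpoch q (x ^+ 2) / (qpoch q (a%:C * x) * qpoch q (b%:C * x) *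
  qpoch q (c%:C * x) * qpoch q (d%:C * x)) * (theta q (d%:C * x) / theta q ((d * t)%:C * x)).

Let W_half x : W q (a, b, c, d, t) x = wh x * wh x^-1.
Proof.
by rewrite /W /bigDelta /Defs.bigTheta /wh -!exprVn fieldAC14.
Qed.

Let wh_bounded : exists B, forall x, cabs x = 1 -> cabs (wh x) <= B.
Proof.
have [a0 /andP[b0 b1] /andP[c0 c1] qd D0] := bounds.
have d0 : 0 < d by rewrite (lt_trans _ qd)// mulr_gt0// lt_max ltr01.
have [C C0 hC] := cabs_qpoch_sqr_le.
have [Ca Ca0 hCa] := cabs_qpoch_circle_ge (ltW a0).
have [CD CD0 hCD] := cabs_theta_circle_ge D0.
have rb := rpoch_gt0 q01 b1; have rc := rpoch_gt0 q01 c1.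
have B0 : 0 <= C / (Ca * CD) * (rpoch q b * rpoch q c)^-1 by rewrite !mulr_ge0 ?invr_ge0 ?mulr_ge0// ltW.
have rd : 0 <= rpoch q (- (q / d)).
  by rewrite ltW// rpoch_gt0// (lt_trans _ ltr01)// oppr_lt0 divr_gt0.
exists (C / (Ca * CD) * (rpoch q b * rpoch q c)^-1 * 1 * rpoch q (- (q / d))) => x x1.
have := hCD _ x1; rewrite /wh {2}/theta fieldAC8.
move: (theta q ((d * t)%:C * x)) => z hz; rewrite !cabsM !cabsV !cabsM.
have bx u : 0 < u -> u < 1 -> rpoch q u <= cabs (qpoch q (u%:C * x)).
  by move=> u0 u1; apply: (cabs_qpoch_ge q01) (ltW u1); rewrite cabsrM// ger0_norm// ltW.
apply: ler_pM; rewrite ?cabs_ge0 ?mulr_ge0 ?invr_ge0 ?mulr_ge0 ?cabs_ge0//; last first.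
  apply: (cabs_qpoch_le q01).
  by rewrite cabsM cabsV cabsrM// cabsR !ger0_norm// ltW.
apply: ler_pM; rewrite ?cabs_ge0 ?mulr_ge0 ?invr_ge0 ?mulr_ge0 ?cabs_ge0//; last first.
  by have := cabs_divself (qpoch q (d%:C * x)); rewrite cabsM cabsV.
apply: ler_pM; rewrite ?cabs_ge0 ?mulr_ge0 ?invr_ge0 ?mulr_ge0 ?cabs_ge0//; last first.
  have bb := bx _ b0 b1; have cc := bx _ c0 c1; have rbc := mulr_gt0 rb rc.
  have le := ler_pM (ltW rb) (ltW rc) bb cc.
  by rewrite lef_pV2 ?posrE// (lt_le_trans rbc le).
have := hC _ x1; have := hCa _ x1; move: hz.
have := cabs_ge0 (1 - x); have := cabs_ge0 (1 + x).
have := cabs_ge0 (qpoch q (x ^+ 2)).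
move: (cabs (1 - x)) (cabs (1 + x)) (cabs (qpoch q (x ^+ 2))) (cabs (qpoch q (a%:C * x))) (cabs z) => e f u v w.
rewrite le_eqVlt => /predU1P[<- _ _ _ _ _|u0]; first by rewrite mul0r divr_ge0 ?mulr_ge0// ltW.
(* The numerator is now nonzero, so its upper bound excludes x = 1 and x = -1, and both denominators
   are positive. *)
rewrite le_eqVlt => /predU1P[<- _ _ _|f0]; first by rewrite !mulr0 leNgt u0.
rewrite le_eqVlt => /predU1P[<- _ _|e0 hw hv hu]; first by rewrite mul0r mulr0 leNgt u0.
have v0 : 0 < v by apply: lt_le_trans hv; exact: mulr_gt0.
have w0 : 0 < w by apply: lt_le_trans hw; exact: mulr_gt0.
rewrite ler_pdivrMr ?mulr_gt0//; apply: (le_trans hu).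
have -> : C * (e * f) = C / (Ca * CD) * ((Ca * e) * (CD * f)) by field; rewrite !gt_eqF.
by rewrite ler_wpM2l ?divr_ge0 ?mulr_ge0 ?(ltW C0) ?(ltW Ca0) ?(ltW CD0)// ler_pM// mulr_ge0// ltW.
Qed.

Lemma W_circle_bounded : exists B, forall x, cabs x = 1 -> cabs (W q (a, b, c, d, t) x) <= B.
Proof.
have [B hB] := wh_bounded; exists (B * B) => x x1.
by rewrite W_half cabsM ler_pM ?cabs_ge0 ?hB// cabs_inv_circle.
Qed.

Lemma circle_part_finite : (circle_part q01 (a, b, c, d, t) setT < +oo)%E.
Proof.
have [B hB] := W_circle_bounded; rewrite /circle_part preimage_setT setIT.
have p0 : 0 <= (4 * pi)^-1 :> R by rewrite invr_ge0 mulr_ge0// pi_ge0.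
apply: (@le_lt_trans _ _ (\int[lebesgue_measure]_(x in `[0%R, (2 * pi)%R]) (cst ((4 * pi)^-1 * B)%:E x))%E).
  apply: ge0_le_integral => //.
  - by move=> th _; rewrite lee_fin mulr_ge0// cabs_ge0.
  - apply/measurable_EFinP; apply: measurable_funTS; apply: measurable_funM => //.
    exact: measurable_cabs_W.
  - by move=> th _; rewrite lee_fin ler_wpM2l// hB// cabs_expi.
rewrite integral_cst//= lebesgue_measure_itv/= lte_fin.
by case: ifP => _; rewrite ?mule0 ?ltry// -EFinD -EFinM ltry.
Qed.

(** Only finitely many points [a q^n] exceed 1, so the values of their weights do not matter. *)
Lemma plus_part_finite : (plus_part q (a, b, c, d, t) setT < +oo)%E.
Proof.
have [a0 _ _ _ _] := bounds.
have := @ge0_integral_plus_part R q (a, b, c, d, t) (cst 1%E) (measurable_cst _) (fun _ => @lee01 R).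
rewrite integral_cst//= mul1e => ->.
have [m hm] : exists m, forall n, (m <= n)%N -> a * q ^+ n <= 1.
  have [m hm] := expq_lt q01 (divr_gt0 ltr01 a0); exists m => n mn.
  rewrite mulrC -ler_pdivlMr// (le_trans _ (ltW hm))// ler_wiXn2l// ltW//.
rewrite (_ : limn _ = \sum_(0 <= n < m) ((plus_weight q (a, b, c, d, t) n)%:E * (1 + 1))%E).
  by under eq_bigr do rewrite -EFinD -EFinM; rewrite sumEFin ltry.
apply/cvg_lim => //; apply: cvg_near_cst; exists m => // n /= mn.
rewrite (@big_cat_nat _ _ _ m)//= [X in (_ + X)%E]big_nat_cond [X in (_ + X)%E]big1 ?adde0//.
move=> i /andP[/andP[mi _] _]; rewrite /plus_weight ifF ?mul0e//.
by rewrite /pole_plus ltNge hm.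
Qed.

Let A := Num.max 1 a.
Let A1 : 1 <= A. Proof. by rewrite le_max lexx. Qed.
Let A0 : 0 < A. Proof. exact: lt_le_trans A1. Qed.

(* Carries the circle and the [D_+] parts of the measure; [-1], a zero of
   [GThetaV], is removed. *)
Definition classical_support : set R[i] := [set x : R[i] |
  (cabs x = 1 /\ x != -1) \/ exists2 r, A^-1 <= r <= A & x = r%:C].

Let supp_inv x : classical_support x -> classical_support x^-1.
Proof.
case=> [[x1 xN1]|[r /andP[r1 r2] ->]].
  left; rewrite cabs_inv_circle//; split => //.
  by apply: contra_neq xN1 => h; rewrite -[x]invrK h invrN invr1.
have r0 : 0 < r by apply: lt_le_trans r1; rewrite invr_gt0.
right; exists r^-1; last by rewrite fmorphV.
apply/andP; split; first by rewrite lef_pV2 ?posrE ?A0.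
by rewrite -[leRHS]invrK lef_pV2 ?posrE ?invr_gt0 ?A0.
Qed.

Let supp_le x : classical_support x -> cabs x <= A.
Proof.
case=> [[-> _]|[r /andP[r1 r2] ->]]; first exact: A1.
by rewrite cabsR ger0_norm// (le_trans _ r1)// invr_ge0 ltW// A0.
Qed.

Lemma measurable_classical_support : measurable classical_support.
Proof.
have [mr mi] := @cmeasurable_id R.
have mc := cmeasurable_cabs (@cmeasurable_id R).
have meq (f : R[i] -> R) (B : set R) : measurable_fun setT f -> measurable B -> measurable (f @^-1` B).
  by move=> mf mB; rewrite -[X in measurable X]setTI; exact: mf.
rewrite (_ : classical_support = ((@cabs R @^-1` [set 1]) `&`
   ~` ((fun x : R[i] => complex.Re x) @^-1` [set -1] `&` (fun x : R[i] => complex.Im x) @^-1` [set 0])) `|`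
   ((fun x : R[i] => complex.Re x) @^-1` `[A^-1, A]%classic `&` (fun x : R[i] => complex.Im x) @^-1` [set 0])).
  by apply: measurableU; apply: measurableI; rewrite ?setCI;
    try apply: measurableU; try apply: measurableC; apply: meq.
apply/seteqP; split => x.
  case=> [[x1 xN1]|[r rA ->]]; [left; split => //|right].
    by case: x xN1 {x1} => u v /= /eqP h [h1 h2]; apply: h; rewrite h1 h2 -[RHS]/(- 1 +i* - 0) oppr0.
  by split => //=; rewrite in_itv.
case=> [[x1 h]|[]]; [left; split => //|].
  by apply/eqP => xN; apply: h; rewrite xN /= oppr0.
by case: x => u v /=; rewrite in_itv/= => uA ->; right; exists u.
Qed.

(** The only point of the circle outside the support is -1, where the density vanishes through the
    factor (x^2; q)_oo = (1; q)_oo = 0. *)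
Lemma circle_part_support : circle_part q01 (a, b, c, d, t) (~` classical_support) = 0%E.
Proof.
apply: integral0_eq => th [_ /= h].
have xN1 : expi th = -1.
  apply: contrapT => hN; apply: h; left; rewrite cabs_expi; split => //; exact/eqP.
rewrite xN1 /W /bigDelta sqrrN expr1n (qpochS q01 1) subrr !mul0r.
by rewrite (cabsR 0) normr0 mulr0.
Qed.

Lemma plus_part_support : plus_part q (a, b, c, d, t) (~` classical_support) = 0%E.
Proof.
have mA := measurableC measurable_classical_support.
have [a0 _ _ _ _] := bounds.
have <- : (\int[plus_part q (a, b, c, d, t)]_x (\1_(~` classical_support) x)%:E)%E =
    plus_part q (a, b, c, d, t) (~` classical_support).
  by rewrite integral_indic// setIT.
rewrite ge0_integral_plus_part//; last first.
  by apply/measurable_EFinP; exact: measurable_indic.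
apply: eseries0 => n _ _; rewrite /plus_weight; case: ifPn => [pn|_]; last by rewrite mul0e.
have sp : classical_support (pole_plus q n (a, b, c, d, t))%:C.
  right; exists (a * q ^+ n) => //.
  rewrite (le_trans _ (ltW pn)) ?invf_le1//= le_max; apply/orP; right.
  by rewrite ler_piMr ?(ltW a0)// exprn_ile1// ltW.
have sV := supp_inv sp.
by rewrite !indicE !memNset ?adde0 ?mule0//; exact.
Qed.

Definition classical_measure : {measure set R[i] -> \bar R} :=
  measure_add (circle_part q01 (a, b, c, d, t)) (plus_part q (a, b, c, d, t)).

Lemma classical_measure_finite : (classical_measure setT < +oo)%E.
Proof. have -> : classical_measure setT =
  (circle_part q01 (a, b, c, d, t) setT + plus_part q (a, b, c, d, t) setT)%E by exact: measure_addE.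
by rewrite lte_add_pinfty ?circle_part_finite ?plus_part_finite. Qed.

Lemma ae_classical_support : {ae classical_measure, forall x, classical_support x}.
Proof.
exists (~` classical_support); split => //.
  by apply: measurableC; exact: measurable_classical_support.
have -> : classical_measure (~` classical_support) = (circle_part q01 (a, b, c, d, t) (~` classical_support) +
  plus_part q (a, b, c, d, t) (~` classical_support))%E by exact: measure_addE.
by rewrite circle_part_support plus_part_support adde0.
Qed.

Let den x : R[i] := qpoch q (q%:C / (d%:C * x)).

Let rA : 0 < rpoch q (q * A / d).
Proof.
have [_ _ _ qd _] := bounds; have d0 : 0 < d by rewrite (lt_trans _ qd)// mulr_gt0.
by rewrite rpoch_gt0// ltr_pdivrMr// mul1r.
Qed.

Let den_ge x : classical_support x -> rpoch q (q * A / d) <= cabs (den x).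
Proof.
have [_ _ _ qd _] := bounds; have d0 : 0 < d by rewrite (lt_trans _ qd)// mulr_gt0.
move=> /supp_inv/supp_le xA; apply: (cabs_qpoch_ge q01).
  rewrite invfM mulrA mulrAC !cabsM -fmorphV !cabsR (ger0_norm (ltW q0)) ger0_norm ?invr_ge0 ?(ltW d0)//.
  by apply: ler_wpM2r; rewrite ?invr_ge0 ?(ltW d0)//; apply: ler_wpM2l => //; exact: ltW.
by rewrite ler_pdivrMr// mul1r ltW.
Qed.

Let den_le x : classical_support x -> cabs (den x)^-1 <= (rpoch q (q * A / d))^-1.
Proof.
move=> Kx; rewrite cabsV lef_pV2 ?posrE ?rA ?den_ge//.
exact: lt_le_trans rA (den_ge Kx).
Qed.

Let GthE x : GThetaV q (a, b, c, d, t) x =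
  theta q ((d * t)%:C * x) * theta q ((d * t)%:C * x^-1) * ((den x)^-1 * (den x^-1)^-1).
Proof. by rewrite /GThetaV /den invfM. Qed.

Let theta_neq0 x : classical_support x -> theta q ((d * t)%:C * x) != 0.
Proof.
have [_ _ _ _ D0] := bounds.
case=> [[x1 xN1]|[r /andP[r1 _] ->]].
  have x0 : 0 < cabs (1 + x) by rewrite cabs_gt0 addrC addr_eq0.
  have [C C0 hC] := cabs_theta_circle_ge D0.
  by rewrite -cabs_gt0 (lt_le_trans _ (hC _ x1))// mulr_gt0.
have r0 : 0 < r by apply: lt_le_trans r1; rewrite invr_gt0.
have Dr : d * t * r < 0 by rewrite pmulr_llt0.
rewrite /theta -rmorphM -fmorphV -rmorphM !qpoch_real// -rmorphM fmorph_eq0 mulf_neq0//.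
  by rewrite gt_eqF// (lt_le_trans ltr01)// rpoch_ge1// ltW.
rewrite gt_eqF// (lt_le_trans ltr01)// rpoch_ge1//.
by rewrite pmulr_rle0// invr_le0 ltW.
Qed.

Let theta_bounded : exists B, forall x, classical_support x -> cabs (theta q ((d * t)%:C * x)) <= B.
Proof.
have [_ _ _ _ D0] := bounds; have Dn : d * t != 0 by rewrite lt_eqF.
exists (rpoch q (- (`|d * t| * A)) * rpoch q (- (q / `|d * t| * A))) => x Kx.
rewrite /theta cabsM ler_pM ?cabs_ge0//.
  by apply: (cabs_qpoch_le q01); rewrite cabsM cabsR ler_wpM2l// supp_le.
apply: (cabs_qpoch_le q01); rewrite invfM mulrA cabsM cabsM -fmorphV !cabsR.
rewrite normfV (ger0_norm (ltW q0)) ler_wpM2l ?divr_ge0 ?(ltW q0)//.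
exact/supp_le/supp_inv.
Qed.

(** Supplies the hypotheses of [weighted_poly_dense] for the weight 1/(G Theta). *)
Lemma classical_support_facts : exists M H, forall x, classical_support x ->
  [/\ circle_or_pos x, `|complex.Re (x + x^-1)| <= M, GThetaV q (a, b, c, d, t) x != 0,
     cabs (GThetaV q (a, b, c, d, t) x) <= H &
     GThetaV q (a, b, c, d, t) x^-1 = GThetaV q (a, b, c, d, t) x].
Proof.
have [B hB] := theta_bounded.
exists (A + A), (B * B * ((rpoch q (q * A / d))^-1 * (rpoch q (q * A / d))^-1)) => x Kx.
have KV := supp_inv Kx; split.
- case: Kx => [[x1 _]|[r /andP[r1 _] ->]]; [by left|right; exists r => //].
  by rewrite (lt_le_trans _ r1)// invr_gt0.
- apply: (@le_trans _ _ (cabs (x + x^-1))).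
    by rewrite cabsE -sqrtr_sqr ler_wsqrtr// lerDl sqr_ge0.
  by rewrite (le_trans (cabsD _ _))// lerD// supp_le.
- rewrite GthE; apply: mulf_neq0; first by apply: mulf_neq0; exact: theta_neq0.
  by apply: mulf_neq0; rewrite invr_eq0 -cabs_gt0; [apply: lt_le_trans rA (den_ge Kx)|apply: lt_le_trans rA (den_ge KV)].
- rewrite GthE; have := hB _ KV; have := hB _ Kx; have := den_le Kx; have := den_le KV.
  move: (theta q _) (theta q _) (den x)^-1 (den x^-1)^-1 => z1 z2 w1 w2 h1 h2 h3 h4.
  by rewrite !cabsM; apply: ler_pM; rewrite ?mulr_ge0 ?cabs_ge0//; apply: ler_pM; rewrite ?cabs_ge0.
- by rewrite !GthE invrK; congr (_ * _); exact: mulrC.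
Qed.

Let GtauE x : Gtau q (a, b, c, d, t) x = (den x^-1)^-1 * (den x)^-1.
Proof.
rewrite /Gtau /Gfun /den -invfM; congr (_ * _)^-1; congr qpoch; rewrite fmorph_div invfM ?invrK//=.
  by rewrite mulrA.
by rewrite mulrA.
Qed.

Lemma Gtau_bounded : exists H, forall x, classical_support x ->
  cabs (Gtau q (a, b, c, d, t) x) <= H.
Proof.
exists ((rpoch q (q * A / d))^-1 * (rpoch q (q * A / d))^-1) => x Kx.
by rewrite GtauE cabsM; apply: ler_pM; rewrite ?cabs_ge0 ?den_le//; exact: supp_inv.
Qed.

Lemma Gtau_inv x : Gtau q (a, b, c, d, t) x^-1 = Gtau q (a, b, c, d, t) x.
Proof. by rewrite !GtauE invrK mulrC. Qed.

Lemma cmeasurable_GThetaV disp (T : measurableType disp) (F : T -> R[i]) : cmeasurable F ->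
  cmeasurable (GThetaV q (a, b, c, d, t) \o F).
Proof.
move=> mF; have mk (k : R[i]) (G : T -> R[i]) : cmeasurable G -> cmeasurable (fun x : T => k * G x).
  by move=> mG; apply: cmeasurableM => //; exact: cmeasurable_cst.
have mV := cmeasurableV mF.
rewrite /comp /GThetaV; apply: cmeasurableM; first by apply: cmeasurableM; apply: cmeasurable_theta => //; exact: mk.
apply: cmeasurableV; apply: cmeasurableM; apply: cmeasurable_qpoch => //; apply: (mk);
  apply: cmeasurableV; exact: mk.
Qed.

Lemma cmeasurable_Gtau disp (T : measurableType disp) (F : T -> R[i]) : cmeasurable F ->
  cmeasurable (Gtau q (a, b, c, d, t) \o F).
Proof.
move=> mF; have mk (k : R[i]) (G : T -> R[i]) : cmeasurable G -> cmeasurable (fun x : T => k * G x).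
  by move=> mG; apply: cmeasurableM => //; exact: cmeasurable_cst.
have mV := cmeasurableV mF.
by rewrite /comp /Gtau /Gfun; apply: cmeasurableV; apply: cmeasurableM; apply: cmeasurable_qpoch => //; exact: mk.
Qed.

End circle_bounds.

(** * The measure on D_- *)

Section weighted_sequences.
Local Open Scope complex_scope.
Context {R : realType} (w : nat -> R) (w0 : forall n, 0 <= w n).
Implicit Types (F G : nat -> R[i]).

Definition wnorm F : \bar R := (\sum_(0 <= n <oo) (w n * cabs (F n) ^+ 2)%:E)%E.

Let term_ge0 F n : (0 <= (w n * cabs (F n) ^+ 2)%:E)%E.
Proof. by rewrite lee_fin mulr_ge0// sqr_ge0. Qed.

Lemma wnorm_ge0 F : (0 <= wnorm F)%E.
Proof. by apply: nneseries_ge0. Qed.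

Lemma wnorm_le F (e : R) :
  (forall L, \sum_(n < L) w n * cabs (F n) ^+ 2 <= e) -> (wnorm F <= e%:E)%E.
Proof.
move=> h; apply: lime_le; first by apply: is_cvg_nneseries.
by apply: nearW => L; rewrite big_mkord sumEFin lee_fin.
Qed.

Lemma wnorm_ge F L : ((\sum_(n < L) w n * cabs (F n) ^+ 2)%:E <= wnorm F)%E.
Proof.
have := nneseries_lim_ge (u_ := fun n => (w n * cabs (F n) ^+ 2)%:E) (P := xpredT) (m := 0) L.
by rewrite big_mkord sumEFin; apply => n _ _; exact: term_ge0.
Qed.

Lemma wnormD_le F G :
  (wnorm (fun n => F n + G n)%R <= 2%:E * wnorm F + 2%:E * wnorm G)%E.
Proof.
rewrite /wnorm -!nneseriesZl//; try by move=> n _; exact: term_ge0.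
rewrite -nneseriesD; try by move=> n _ _; rewrite mule_ge0// ?lee_fin// term_ge0.
apply: lee_nneseries => [*|n *]; first by rewrite lee_fin mulr_ge0// sqr_ge0.
rewrite -!EFinM -EFinD lee_fin; have := ler_wpM2l (w0 n) (sqr_cabsD_le (F n) (G n)).
by move/le_trans; apply; rewrite le_eqVlt; apply/orP; left; apply/eqP; ring.
Qed.

Lemma wnormZ (z : R[i]) F : wnorm (fun n => z * F n) = ((cabs z ^+ 2)%:E * wnorm F)%E.
Proof.
rewrite /wnorm -nneseriesZl; first by apply: eq_eseriesr => n _; rewrite cabsM -EFinM; congr _%:E; ring.
by move=> n _; exact: term_ge0.
Qed.

Context (y g : nat -> R[i]).

Definition wapprox F := forall e : R, 0 < e -> exists p : {poly R[i]},
  (wnorm (fun n => F n - p.[y n] * g n)%R < e%:E)%E.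

Let four (e : R) : e%:E = (2%:E * (e / 4)%:E + 2%:E * (e / 4)%:E)%E.
Proof. by rewrite -!EFinM -EFinD; congr _%:E; field. Qed.

Lemma wapprox0 : wapprox (fun=> 0).
Proof.
move=> e e0; exists 0; rewrite /wnorm (eq_eseriesr (g := fun=> 0%E)) ?eseries0//.
by move=> n _; rewrite horner0 mul0r subr0 (cabsR 0) normr0 expr0n/= mulr0.
Qed.

Lemma wapproxD F G : wapprox F -> wapprox G -> wapprox (fun n => F n + G n).
Proof.
move=> aF aG e e0; have e4 : 0 < e / 4 by rewrite divr_gt0.
have [p hp] := aF _ e4; have [s hs] := aG _ e4; exists (p + s).
have -> : (fun n => F n + G n - (p + s).[y n] * g n) =
    (fun n => (F n - p.[y n] * g n) + (G n - s.[y n] * g n)).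
  by apply/funext => n; rewrite hornerD; ring.
by apply: le_lt_trans (wnormD_le _ _) _; rewrite four; apply: lteD; rewrite lte_pmul2l// lte_fin.
Qed.

Lemma wapproxZ z F : wapprox F -> wapprox (fun n => z * F n).
Proof.
move=> aF e e0; have z1 : 0 < cabs z ^+ 2 + 1 by rewrite ltr_wpDl ?sqr_ge0.
have [|p hp] := aF (e / (cabs z ^+ 2 + 1)); first by rewrite divr_gt0.
exists (z *: p).
have -> : (fun n => z * F n - (z *: p).[y n] * g n) = (fun n => z * (F n - p.[y n] * g n)).
  by apply/funext => n; rewrite hornerZ; ring.
rewrite wnormZ; apply: (@le_lt_trans _ _ ((cabs z ^+ 2)%:E * (e / (cabs z ^+ 2 + 1))%:E)%E).
  by apply: lee_wpmul2l; [rewrite lee_fin sqr_ge0|exact: ltW].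
by rewrite -EFinM lte_fin mulrA ltr_pdivrMr// mulrC ltr_pM2l// ltrDl.
Qed.

Lemma wapprox_sum (H : nat -> nat -> R[i]) J : (forall j, wapprox (H j)) ->
  wapprox (fun n => \sum_(j < J) H j n).
Proof.
move=> aH; elim: J => [|J IH].
  by rewrite (_ : (fun n => _) = fun=> 0); [exact: wapprox0|apply/funext => n; rewrite big_ord0].
rewrite (_ : (fun n => _) = fun n => \sum_(j < J) H j n + H J n); first exact: wapproxD.
by apply/funext => n; rewrite big_ord_recr.
Qed.

Lemma wapprox_cvg F :
  (forall e : R, 0 < e -> exists G, wapprox G /\ (wnorm (fun n => F n - G n)%R < e%:E)%E) ->
  wapprox F.
Proof.
move=> h e e0; have e4 : 0 < e / 4 by rewrite divr_gt0.
have [G [aG FG]] := h _ e4; have [p hp] := aG _ e4; exists p.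
have -> : (fun n => F n - p.[y n] * g n) = (fun n => (F n - G n) + (G n - p.[y n] * g n)).
  by apply/funext => n; ring.
by apply: le_lt_trans (wnormD_le _ _) _; rewrite four; apply: lteD; rewrite lte_pmul2l// lte_fin.
Qed.

(** A sequence of finite norm is the limit of its truncations, which are combinations of the point
    sequences. The value [g j] at j is the one produced by a polynomial equal to 1 at [y j]. *)
Lemma wapprox_of_delta F : (forall j, g j != 0) ->
  (forall j, wapprox (fun n => if n == j then g j else 0)) -> (wnorm F < +oo)%E ->
  wapprox F.
Proof.
move=> g0 ad Foo; apply: wapprox_cvg => e e0.
have term0 n : (0 <= (w n * cabs (F n) ^+ 2)%:E)%E by exact: term_ge0.
have := nneseries_tail_cvg Foo (fun n _ => term0 n).
move=> /fine_cvgP[fin_near /cvgrPdist_lt/(_ _ e0) dist_near].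
have [J [Jfin Jlt]] : exists J, (\sum_(J <= n <oo) (w n * cabs (F n) ^+ 2)%:E)%E \is a fin_num /\
    `|0 - fine (\sum_(J <= n <oo) (w n * cabs (F n) ^+ 2)%:E)%E| < e.
  by apply: (@filter_ex _ \oo); apply: filterI.
exists (fun n : nat => \sum_(j < J) F j / g j * (if n == j :> nat then g j else 0)); split.
  by apply: (@wapprox_sum (fun j n => F j / g j * (if n == j then g j else 0))) => j; exact: wapproxZ.
have SE n : F n - \sum_(j < J) F j / g j * (if n == j :> nat then g j else 0) =
    if (n < J)%N then 0 else F n.
  case: ltnP => nJ.
    rewrite (bigD1 (Ordinal nJ))//= eqxx divfK// big1 ?addr0 ?subrr// => j jn.
    by rewrite ifF ?mulr0//; apply/negbTE; apply: contra_neq jn => nj; exact/val_inj.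
  rewrite big1 ?subr0// => j _; rewrite ifF ?mulr0//.
  by apply/negbTE; rewrite gtn_eqF// (leq_trans (ltn_ord j)).
rewrite /wnorm; under eq_eseriesr do rewrite SE.
rewrite (nneseries_split 0 J); last by move=> n _; rewrite lee_fin mulr_ge0// sqr_ge0.
rewrite add0n big_nat big1 ?add0e; last first.
  by move=> n /andP[_ nJ]; rewrite nJ (cabsR 0) normr0 expr0n/= mulr0.
have -> : (\sum_(J <= n <oo) (w n * cabs (if (n < J)%N then 0 else F n) ^+ 2)%:E)%E =
    (\sum_(J <= n <oo) (w n * cabs (F n) ^+ 2)%:E)%E.
  by congr (limn _); apply/funext => L; apply: eq_big_nat => n /andP[Jn _]; rewrite ltnNge Jn.
rewrite -(fineK Jfin) lte_fin; move: Jlt; rewrite sub0r normrN; apply: le_lt_trans; exact: ler_norm.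
Qed.

End weighted_sequences.

Section geometric_tails.
Context {R : realType} (r : R) (r0 : 0 <= r) (r1 : r < 1).

Definition gtail (N n : nat) : R := if (N <= n)%N then r ^+ (n - N) else 0.

Lemma gtail_ge0 N n : 0 <= gtail N n.
Proof. by rewrite /gtail; case: ifP => // _; rewrite exprn_ge0. Qed.

Lemma sum_gtail_le N L : \sum_(n < L) gtail N n <= (1 - r)^-1.
Proof.
have r1' : 0 < 1 - r by rewrite subr_gt0.
rewrite -div1r ler_pdivlMr//.
suff -> : (\sum_(n < L) gtail N n) * (1 - r) = 1 - r ^+ (L - N).
  by rewrite gerBl exprn_ge0.
elim: L => [|L IH]; first by rewrite big_ord0 mul0r sub0n expr0 subrr.
rewrite big_ord_recr/= mulrDl IH /gtail; case: leqP => NL.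
  by rewrite subSn// exprS; ring.
by rewrite mul0r addr0; congr (1 - r ^+ _); move: NL; clear; lia.
Qed.

(** For fixed n, the starting indices up to n give distinct powers of r and the later ones give 0,
    so again a geometric series bounds the sum. Truncated subtraction lets one closed form cover
    every case. *)
Lemma sum_gtail_start_le j M n : \sum_(s < M) gtail (j + s) n <= (1 - r)^-1.
Proof.
have r1' : 0 < 1 - r by rewrite subr_gt0.
rewrite -div1r ler_pdivlMr//.
suff -> : (\sum_(s < M) gtail (j + s) n) * (1 - r) = r ^+ (n.+1 - (j + M)) - r ^+ (n.+1 - j).
  by rewrite (le_trans (_ : _ <= r ^+ (n.+1 - (j + M))))// ?gerBl ?exprn_ge0// exprn_ile1// ltW.
elim: M => [|M IH]; first by rewrite big_ord0 mul0r addn0 subrr.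
rewrite big_ord_recr/= mulrDl IH /gtail; case: leqP => NL.
  rewrite (_ : n.+1 - (j + M) = (n - (j + M)).+1)%N; last by rewrite subSn.
  rewrite (_ : n.+1 - (j + M.+1) = n - (j + M))%N; last by rewrite addnS subSS.
  by rewrite exprS; ring.
rewrite mul0r addr0; congr (r ^+ _ - _).
by move: NL; clear; lia.
Qed.

End geometric_tails.

(** * Approximation of point masses on D_- when tau2 >= q^2 *)

Section strange_density.
Local Open Scope complex_scope.
Context {R : realType} (q : R) (q01 : 0 < q < 1) (a b c d t : R).
Context (adm : admissible q (a, b, c, d, t)).

Let q0 : 0 < q. Proof. by case/andP: q01. Qed.
Let q1 : q < 1. Proof. by case/andP: q01. Qed.

Local Notation k := (kexp q (a, b, c, d, t)).
Local Notation X := (xzero q a b c d t).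
Local Notation t2 := (tau2 q a b c d t).

Definition wminus n : R := minus_weight q (a, b, c, d, t) (k - n%:Z).
Definition gminus n : R := gtau q a b c d t n.
Definition yminus n : R := ylat q X n.

Let X1 : 1 < X. Proof. by case/andP: (xzero_itv q01 adm). Qed.
Let t2_gt0 : 0 < t2. Proof. by have := tau2_gt0 q01 adm. Qed.

Lemma wminus_ge0 n : 0 <= wminus n.
Proof. exact: minus_weight_ge0. Qed.

Let mass_gt0 n : 0 < wminus n * gminus n ^+ 2.
Proof.
have [C1 [C2 [C10 _ /(_ n)/andP[h _]]]] := strange_mass_bounds q01 adm.
by apply: lt_le_trans h; rewrite mulr_gt0// divr_gt0 ?exprn_gt0.
Qed.

Lemma wminus_gt0 n : 0 < wminus n.
Proof.
rewrite lt_neqAle wminus_ge0 andbT; apply/eqP => h.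
by have := mass_gt0 n; rewrite -h mul0r ltxx.
Qed.

Lemma gminus_neq0 n : gminus n != 0.
Proof. by apply/eqP => h; have := mass_gt0 n; rewrite h expr0n mulr0 ltxx. Qed.

Let y_neq i j : i != j -> (yminus i)%:C - (yminus j)%:C != 0 :> R[i].
Proof. by move=> ij; rewrite -rmorphB fmorph_eq0 subr_eq0 ylat_inj. Qed.

Let interp j N : {poly R[i]} :=
  \prod_(i < N | (i : nat) != j) (((yminus j)%:C - (yminus i)%:C)^-1 *: ('X - (yminus i)%:C%:P)).

Let interpE j N n : (interp j N).[(yminus n)%:C] =
  \prod_(i < N | (i : nat) != j) (((yminus n)%:C - (yminus i)%:C) / ((yminus j)%:C - (yminus i)%:C)).
Proof.
rewrite /interp horner_prod; apply: eq_bigr => i _.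
by rewrite hornerZ hornerXsubC mulrC.
Qed.

Let interp_self j N : (interp j N).[(yminus j)%:C] = 1.
Proof. by rewrite interpE big1// => i ij; rewrite divff// y_neq// eq_sym. Qed.

Let interp0 j N n : n != j -> (n < N)%N -> (interp j N).[(yminus n)%:C] = 0.
Proof.
move=> nj nN; rewrite interpE (bigD1 (Ordinal nN))//= subrr mul0r mul0r//.
Qed.

Let cabs_prodP (I : finType) (P : pred I) (f : I -> R[i]) :
  cabs (\prod_(i | P i) f i) = \prod_(i | P i) cabs (f i).
Proof.
elim/big_rec2: _ => [|i y1 y2 _ <-]; first by rewrite (cabsR 1) normr1.
by rewrite cabsM.
Qed.

(** Bounding tau2^n below by q^(2n) in the mass, the exponents from [strange_mass_bounds] and
    [interp_bound] add up to (n - N)(n - N + 1), apart from the constant -2j; this is at least n -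
    N. *)
Lemma strange_interp_bound j : q ^+ 2 <= t2 -> exists2 K, 0 <= K & forall N n,
  (j < N)%N -> (N <= n)%N ->
  wminus n * gminus n ^+ 2 * cabs (interp j N).[(yminus n)%:C] ^+ 2 <= K * q ^+ (n - N).
Proof.
move=> qt; have [C1 [C2 [_ C20 hM]]] := strange_mass_bounds q01 adm.
have rq : 0 < rpoch q q by exact: rpoch_gt0.
exists (C2 * ((rpoch q q ^+ 4) ^- 2 / q ^+ j.*2)).
  by rewrite mulr_ge0 ?divr_ge0 ?invr_ge0 ?exprn_ge0 ?(ltW q0) ?(ltW C20)// ltW.
move=> N n jN Nn; rewrite interpE cabs_prodP.
have -> : \prod_(i < N | (i : nat) != j) cabs (((yminus n)%:C - (yminus i)%:C) / ((yminus j)%:C - (yminus i)%:C)) =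
    \prod_(i < N | (i : nat) != j) (`|ylat q X n - ylat q X i| / `|ylat q X j - ylat q X i|).
  by apply: eq_bigr => i _; rewrite cabsM cabsV -!rmorphB !cabsR.
have B := interp_bound q01 X1 jN Nn; have /andP[_ M2] := hM n.
have qn (i : nat) : 0 < q ^+ i by rewrite exprn_gt0.
have M3 : wminus n * gminus n ^+ 2 <= C2 * (q ^+ (n * n.+1) / q ^+ n.*2).
  apply: (le_trans M2); rewrite ler_pM2l// ler_pM2l// lef_pV2 ?posrE ?exprn_gt0//.
  by rewrite -mul2n exprM; apply: lerXn2r => //; rewrite nnegrE ltW// exprn_gt0.
apply: (le_trans (ler_pM (ltW (mass_gt0 n)) (sqr_ge0 _) M3 B)).
have [m ->] : exists m, n = (N + m)%N by exists (n - N)%N; rewrite subnKC.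
have -> : C2 * (q ^+ ((N + m) * (N + m).+1) / q ^+ (N + m).*2) *
    ((rpoch q q ^+ 4) ^- 2 * (q ^+ (N + m).*2 / q ^+ j.*2 * (q ^+ (N * N.-1) / q ^+ ((N + m) * N).*2))) =
    C2 * ((rpoch q q ^+ 4) ^- 2 / q ^+ j.*2) * (q ^+ ((N + m) * (N + m).+1) * q ^+ (N * N.-1) / q ^+ ((N + m) * N).*2).
  have := lt0r_neq0 (qn (N + m).*2); have := lt0r_neq0 (qn j.*2); have := lt0r_neq0 (qn ((N + m) * N).*2).
  move: (q ^+ (N + m).*2) (q ^+ j.*2) (q ^+ ((N + m) * N).*2) => u1 u2 u3 n1 n2 n3.
  field; rewrite n1 n2 n3/=; rewrite gt_eqF//.
apply: ler_wpM2l; first by rewrite mulr_ge0 ?divr_ge0 ?invr_ge0 ?exprn_ge0 ?(ltW q0) ?(ltW C20)// ltW.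
rewrite -exprD ler_pdivrMr// -exprD ler_wiXn2l ?(ltW q0) ?(ltW q1)//.
case: N {jN Nn B} => [|N] /=; first by clear; nia.
by clear; nia.
Qed.

(* For [tau2 = q^2] the interpolation polynomials [interp j N] stay bounded in
   norm without converging, but their errors concentrate at the nodes just
   above [N], so averaging over [N] makes them small. *)
Lemma strange_delta j : q ^+ 2 <= t2 ->
  wapprox wminus (fun n => (yminus n)%:C) (fun n => (gminus n)%:C)
    (fun n => if n == j then (gminus j)%:C else 0).
Proof.
move=> qt e e0; have [K K0 hK] := strange_interp_bound j qt.
(* [strange_interp_bound] is about squares. The average involves a sum of moduli, and these decay
   like r^(n-N). *)
pose r := Num.sqrt q.
have r0 : 0 <= r by exact: sqrtr_ge0.
have r2 : r ^+ 2 = q by rewrite sqr_sqrtr// ltW.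
have r1 : r < 1 by rewrite -(ltr_pXn2r (n:=2))// ?nnegrE// r2 expr1n.
have r1' : 0 < (1 - r)^-1 by rewrite invr_gt0 subr_gt0.
pose B := K * (1 - r)^-1 * (1 - r)^-1.
have B0 : 0 <= B by rewrite !mulr_ge0// ltW.
have [m hm] : exists m : nat, B / m.+1%:R < e.
  exists (Num.truncn (B / e)); rewrite ltr_pdivrMr// mulrC -ltr_pdivrMr//.
  by rewrite truncnS_gt.
pose M := m.+1; pose A : {poly R[i]} := (M%:R^-1)%:C *: \sum_(s < M) interp j (j.+1 + s).
exists A; apply: (@le_lt_trans _ _ (B / M%:R)%:E); last by rewrite lte_fin.
apply: wnorm_le => [n|L]; first exact: wminus_ge0.
have M0 : 0 < M%:R :> R by rewrite ltr0n.
have AE n : A.[(yminus n)%:C] = (M%:R^-1)%:C * \sum_(s < M) (interp j (j.+1 + s)).[(yminus n)%:C].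
  by rewrite hornerZ horner_sum.
have term n : wminus n * cabs ((if n == j then (gminus j)%:C else 0) - A.[(yminus n)%:C] * (gminus n)%:C) ^+ 2 <=
    K / M%:R ^+ 2 * (1 - r)^-1 * \sum_(s < M) gtail r (j.+1 + s) n.
  have G0 : 0 <= \sum_(s < M) gtail r (j.+1 + s) n.
    by apply: sumr_ge0 => s _; exact: gtail_ge0.
  have [nj|nj] := eqVneq n j.
    rewrite {n}nj in G0 *.
    rewrite AE (eq_bigr (fun=> 1)); last by move=> s _; exact: interp_self.
    rewrite sumr_const card_ord (_ : (M%:R^-1)%:C * M%:R = 1 :> R[i]).
      rewrite mul1r subrr (cabsR 0) normr0 expr0n/= mulr0; apply: mulr_ge0 => //.
      by apply: mulr_ge0; [apply: mulr_ge0; rewrite // invr_ge0 exprn_ge0// ltW|exact: ltW].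
    by rewrite -(rmorph_nat (real_complex R)) -rmorphM/= mulVf ?gt_eqF.
  have -> : cabs (0 - A.[(yminus n)%:C] * (gminus n)%:C) = `|gminus n| * cabs A.[(yminus n)%:C].
    by rewrite sub0r cabsN cabsM cabsR mulrC.
  rewrite exprMn mulrA real_normK ?num_real// AE cabsM cabsR ger0_norm ?invr_ge0 ?(ltW M0)//.
  pose v := Num.sqrt (wminus n * gminus n ^+ 2); pose z := Num.sqrt K.
  have v0 : 0 <= v by exact: sqrtr_ge0.
  have z0 : 0 <= z by exact: sqrtr_ge0.
  have v2 : v ^+ 2 = wminus n * gminus n ^+ 2 by rewrite sqr_sqrtr// ltW.
  have z2 : z ^+ 2 = K by rewrite sqr_sqrtr.
  rewrite -v2 -exprMn.
  pose S := \sum_(s < M) gtail r (j.+1 + s) n.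
  have le : v * cabs (\sum_(s < M) (interp j (j.+1 + s)).[(yminus n)%:C]) <= z * S.
    apply: (@le_trans _ _ (v * \sum_(s < M) cabs (interp j (j.+1 + s)).[(yminus n)%:C])).
      apply: ler_wpM2l => //; elim/big_ind2: _ => [|z1 s1 z3 s3 h1 h2|//].
        by rewrite (cabsR 0) normr0.
      by rewrite (le_trans (cabsD _ _))// lerD.
    rewrite !mulr_sumr; apply: ler_sum => s _; rewrite /gtail; have [sn|sn] := leqP (j.+1 + s) n; last first.
      by rewrite interp0// (cabsR 0) normr0 !mulr0.
    rewrite -(ler_pXn2r (n:=2))// ?nnegrE ?mulr_ge0 ?cabs_ge0 ?exprn_ge0//.
    rewrite !exprMn v2 z2 -exprM mulnC exprM r2.
    by apply: hK => //; rewrite leq_addr.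
  (* One of the two factors in S^2 is bounded by this constant; the other is summed over n below and
     gives at most M / (1 - r). Against the factor M^-2 of the squared average this leaves B / M. *)
  have S1 : S <= (1 - r)^-1 by exact: sum_gtail_start_le.
  rewrite mulrCA exprMn exprVn; set y0 := v * _ in le *.
  have y00 : 0 <= y0 by rewrite mulr_ge0// cabs_ge0.
  have -> : K / M%:R ^+ 2 * (1 - r)^-1 * S = (M%:R ^+ 2)^-1 * (K * (S * (1 - r)^-1)).
    by move: (_^-1) ((1 - r)^-1) => u1 u2; ring.
  apply: ler_wpM2l; first by rewrite invr_ge0 exprn_ge0// ltW.
  apply: (@le_trans _ _ ((z * S) ^+ 2)); first by apply: lerXn2r => //; rewrite nnegrE; exact: mulr_ge0.
  by rewrite exprMn z2; apply: ler_wpM2l => //; rewrite expr2; exact: ler_wpM2l.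
apply: (le_trans (ler_sum _ (fun (n : 'I_L) _ => term n))).
rewrite -mulr_sumr exchange_big/=.
have -> : B / M%:R = K / M%:R ^+ 2 * (1 - r)^-1 * ((1 - r)^-1 *+ M).
  rewrite /B -mulr_natr; move: ((1 - r)^-1) => u; field.
  by rewrite -[m.+1%:R]/(M%:R) gt_eqF.
apply: ler_wpM2l.
  by apply: mulr_ge0; [apply: mulr_ge0; rewrite // invr_ge0 exprn_ge0// ltW|exact: ltW].
have -> : (1 - r)^-1 *+ M = \sum_(s < M) (1 - r)^-1 by rewrite sumr_const card_ord.
by apply: ler_sum => s _; exact: sum_gtail_le.
Qed.

Lemma strange_dense F : q ^+ 2 <= t2 -> (wnorm wminus F < +oo)%E ->
  wapprox wminus (fun n => (yminus n)%:C) (fun n => (gminus n)%:C) F.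
Proof.
move=> qt Foo; apply: wapprox_of_delta => //; first exact: wminus_ge0.
  by move=> j; rewrite fmorph_eq0 gminus_neq0.
by move=> j; exact: strange_delta.
Qed.

End strange_density.

(** * A uniformly bounded divided difference when tau2 < q^2 *)

Section strange_obstruction.
Local Open Scope complex_scope.
Context {R : realType} (q : R) (q01 : 0 < q < 1) (a b c d t : R).
Context (adm : admissible q (a, b, c, d, t)).

Let q0 : 0 < q. Proof. by case/andP: q01. Qed.
Let q1 : q < 1. Proof. by case/andP: q01. Qed.

Local Notation X := (xzero q a b c d t).
Local Notation t2 := (tau2 q a b c d t).
Local Notation w := (wminus q a b c d t).
Local Notation g := (gminus q a b c d t).
Local Notation y := (yminus q a b c d t).

Let X1 : 1 < X. Proof. by case/andP: (xzero_itv q01 adm). Qed.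
Let t2_gt0 : 0 < t2. Proof. by have := tau2_gt0 q01 adm. Qed.
Let w0 n : 0 < w n. Proof. exact: (wminus_gt0 q01 adm). Qed.
Let g0 n : g n != 0. Proof. exact: (gminus_neq0 q01 adm). Qed.

(** Coefficients of the divided difference at the first N nodes, rescaled to be 1 at n = 0, so that
    the functional neither degenerates nor grows on delta_0 as N varies. *)
Let cf N n : R := \prod_(i < N | (i : nat) != 0%N) (y 0 - y i) /
  \prod_(i < N | (i : nat) != n) (y n - y i).

Let cf0 N : cf N 0 = 1.
Proof.
rewrite /cf divff// prodf_seq_neq0; apply/allP => i _; apply/implyP => i0.
by rewrite subr_eq0 ylat_inj// eq_sym.
Qed.

Let cf_sum N (p : {poly R[i]}) : (size p < N)%N ->
  \sum_(n < N) (cf N n)%:C * p.[(y n)%:C] = 0.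
Proof.
move=> pN.
have inj i j : (i < N)%N -> (j < N)%N -> i != j -> (y i)%:C != (y j)%:C :> R[i].
  by move=> _ _ ij; apply/eqP => /complexI/eqP; apply/negP; exact: ylat_inj.
have := lagrange_sum0 (y := fun n => (y n)%:C) inj pN.
move=> /(congr1 (fun z => (\prod_(i < N | (i : nat) != 0%N) (y 0 - y i))%:C * z)).
rewrite mulr0 => E; rewrite -[RHS]E mulr_sumr; apply: eq_bigr => n _.
rewrite /cf rmorphM fmorphV mulrAC -mulrA; congr (_ * (_ / _)).
by rewrite rmorph_prod; apply: eq_bigr => i _; rewrite rmorphB.
Qed.

(** The exponents n(n-1) of the squared coefficient and n(n+1) of the mass leave q^(-2n) against
    tau2^n. Summed over n, these quotients bound the squared dual norm of the functional. *)
Let cf_bound : exists2 K, 0 <= K & forall N n, (n < N)%N ->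
  cf N n ^+ 2 / (w n * g n ^+ 2) <= K * (t2 / q ^+ 2) ^+ n.
Proof.
have [C1 [C2 [C10 _ hM]]] := strange_mass_bounds q01 adm.
have rq : 0 < rpoch q q by exact: rpoch_gt0.
exists ((rpoch q q ^+ 4) ^- 2 / C1).
  by rewrite divr_ge0 ?invr_ge0 ?exprn_ge0 ?ltW.
move=> N n nN; have B := lagrange_weight_bound q01 X1 nN; have /andP[M1 _] := hM n.
have M0 : 0 < C1 * (q ^+ (n * n.+1) / t2 ^+ n) by rewrite mulr_gt0// divr_gt0// exprn_gt0.
have cE : cf N n ^+ 2 = (\prod_(i < N | (i : nat) != 0%N) `|ylat q X 0 - ylat q X i| /
   \prod_(i < N | (i : nat) != n) `|ylat q X n - ylat q X i|) ^+ 2.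
  by rewrite -real_normK ?num_real// /cf normf_div !normr_prod.
rewrite cE; apply: (@le_trans _ _ ((rpoch q q ^+ 4) ^- 2 * q ^+ (n * n.-1) / (C1 * (q ^+ (n * n.+1) / t2 ^+ n)))).
  apply: ler_pM; rewrite ?sqr_ge0 ?invr_ge0//.
    by rewrite mulr_ge0 ?sqr_ge0// ltW.
  by rewrite lef_pV2 ?posrE// (lt_le_trans M0 M1).
have -> : q ^+ (n * n.+1) = q ^+ (n * n.-1) * q ^+ 2 ^+ n.
  by rewrite -exprM -exprD; congr (_ ^+ _); case: n {nN B M1 M0 cE} => // n; clear; rewrite /=; lia.
rewrite [(t2 / q ^+ 2) ^+ n]expr_div_n le_eqVlt; apply/orP; left; apply/eqP.
have n1 : t2 ^+ n != 0 by rewrite expf_neq0// gt_eqF.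
have n2 : (q ^+ 2) ^+ n != 0 by rewrite !expf_neq0// gt_eqF.
have n3 : q ^+ (n * n.-1) != 0 by rewrite expf_neq0// gt_eqF.
have n4 := lt0r_neq0 C10; have n5 := lt0r_neq0 rq.
move: (t2 ^+ n) ((q ^+ 2) ^+ n) (q ^+ (n * n.-1)) n1 n2 n3 => u1 u2 u3 n1 n2 n3.
by field; rewrite n1 n2 n3 n4 n5.
Qed.

(* The divided difference [\sum_n cf N n * p (y n)] vanishes on polynomials of
   small degree; for [tau2 < q^2] it is bounded on the weighted space uniformly
   in [N], so it keeps the sequence [delta_0] at a positive distance. *)
Lemma strange_obstruction : t2 < q ^+ 2 -> exists2 e : R, 0 < e & forall p : {poly R[i]},
  (e%:E <= wnorm w (fun n => (n == 0%N)%:R - p.[(y n)%:C] * (g n)%:C)%R)%E.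
Proof.
move=> tq; have [K K0 hK] := cf_bound.
have rho0 : 0 <= t2 / q ^+ 2 by rewrite divr_ge0// ?ltW// exprn_gt0.
have rho1 : t2 / q ^+ 2 < 1 by rewrite ltr_pdivrMr ?exprn_gt0// mul1r.
pose B := K * (1 - t2 / q ^+ 2)^-1.
have B0 : 0 <= B by rewrite mulr_ge0// invr_ge0 subr_ge0 ltW.
pose s := `|g 0|^-1; have s0 : 0 < s by rewrite invr_gt0 normr_gt0.
(* Here s is the modulus of the functional at delta_0. The parameter [la] enters through 2AC <= la
   A^2/w + w C^2/la and satisfies la B <= s, so an error below la s/2 would give 2s <= s + s/2. *)
pose la := s / (B + 1); have la0 : 0 < la by rewrite divr_gt0// ltr_wpDl.
exists (la * (s / 2)) => [|p]; first by rewrite mulr_gt0// divr_gt0.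
rewrite leNgt; apply/negP => small.
pose u n : R[i] := (n == 0%N)%:R - p.[(y n)%:C] * (g n)%:C.
(* Enough nodes for the divided difference to annihilate p; N depends on p, while B does not depend
   on N. *)
pose N := (size p).+1.
have su : \sum_(n < N) w n * cabs (u n) ^+ 2 <= la * (s / 2).
  by rewrite -lee_fin; apply: (le_trans (wnorm_ge (fun n => ltW (w0 n)) _ _)); exact: ltW.
have sE : ((g 0)^-1)%:C = \sum_(n < N) (cf N n / g n)%:C * u n.
  have := cf_sum (ltnSn (size p)); rewrite -/N => E0.
  have -> : \sum_(n < N) (cf N n / g n)%:C * u n =
      \sum_(n < N) ((cf N n / g n)%:C * ((n : nat) == 0%N)%:R - (cf N n)%:C * p.[(y n)%:C]).
    apply: eq_bigr => n _; rewrite /u mulrBr; congr (_ - _).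
    have gn : (g n)%:C != 0 :> R[i] by rewrite fmorph_eq0.
    have -> : (cf N n / g n)%:C = (cf N n)%:C / (g n)%:C :> R[i] by rewrite -fmorphV -rmorphM.
    move: (g n)%:C (p.[_]) ((cf N n)%:C) gn => z1 z2 z3 z10.
    by field.
  rewrite sumrB E0 subr0 (bigD1 ord0)//= cf0 mulr1 div1r big1 ?addr0// => i i0.
  by rewrite (_ : (i : nat) == 0%N = false) ?mulr0//; apply/negbTE.
have sl : s <= \sum_(n < N) `|cf N n / g n| * cabs (u n).
  have -> : s = cabs ((g 0)^-1)%:C by rewrite cabsR normfV.
  rewrite sE; elim/big_ind2: _ => [|z1 s1 z3 s3 h1 h2|i _].
  - by rewrite (cabsR 0) normr0.
  - by rewrite (le_trans (cabsD _ _))// lerD.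
  - by rewrite cabsM cabsR.
have t1 (n : 'I_N) : `|cf N n / g n| * cabs (u n) *+ 2 <=
    la * (K * (t2 / q ^+ 2) ^+ n) + la^-1 * (w n * cabs (u n) ^+ 2).
  apply: (@le_trans _ _ (la * (cf N n ^+ 2 / (w n * g n ^+ 2)) + la^-1 * (w n * cabs (u n) ^+ 2))).
    have -> : cf N n ^+ 2 / (w n * g n ^+ 2) = `|cf N n / g n| ^+ 2 / w n.
      by rewrite real_normK ?num_real//; field; rewrite g0 gt_eqF.
    have lw : 0 < la / w n by rewrite divr_gt0.
    have := sqr_ge0 (`|cf N n / g n| * (la / w n) - cabs (u n)).
    move=> /(mulr_ge0 (ltW (divr_gt0 (w0 n) la0))).
    have wn := w0 n; move: wn lw; move: (w n) (`|cf N n / g n|) (cabs (u n)) => w' A C w'0 lw.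
    have -> : w' / la * (A * (la / w') - C) ^+ 2 =
      la * (A ^+ 2 / w') + la^-1 * (w' * C ^+ 2) - A * C *+ 2.
      by field; rewrite !gt_eqF.
    by rewrite subr_ge0.
  by rewrite lerD2r ler_pM2l// hK.
have geo : \sum_(n < N) (t2 / q ^+ 2) ^+ n <= (1 - t2 / q ^+ 2)^-1.
  have := sum_gtail_le rho0 rho1 0 N; rewrite /gtail.
  by rewrite (eq_bigr (fun n : 'I_N => (t2 / q ^+ 2) ^+ n)) // => n _; rewrite subn0.
have : s *+ 2 <= la * B + la^-1 * (la * (s / 2)).
  apply: (le_trans (lerD sl sl)); rewrite -mulr2n -sumrMnl.
  apply: (le_trans (ler_sum _ (fun n _ => t1 n))); rewrite big_split/= -!mulr_sumr.
  apply: lerD.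
    by apply: ler_wpM2l; [exact: ltW|apply: ler_wpM2l].
  by apply: ler_wpM2l => //; rewrite invr_ge0 ltW.
rewrite mulKf ?gt_eqF// => hs.
have laB : la * B <= s.
  rewrite /la mulrAC ler_pdivrMr ?ltr_wpDl// ler_wpM2l ?lerDl//.
  exact: ltW.
by move: hs; rewrite mulr2n; lra.
Qed.

End strange_obstruction.

(** * Joining D_- to the rest of the measure *)

Section AW_density.
Local Open Scope complex_scope.
Context {R : realType} (q : R) (q01 : 0 < q < 1) (a b c d t : R).
Context (adm : admissible q (a, b, c, d, t)).

Let q0 : 0 < q. Proof. by case/andP: q01. Qed.
Let q1 : q < 1. Proof. by case/andP: q01. Qed.

Local Notation k := (kexp q (a, b, c, d, t)).
Local Notation X := (xzero q a b c d t).
Local Notation t2 := (tau2 q a b c d t).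
Local Notation w := (wminus q a b c d t).
Local Notation g := (gminus q a b c d t).
Local Notation y := (yminus q a b c d t).
Local Notation xm := (xminus q a b c d t).
Local Notation m := (AWmeasure q01 (a, b, c, d, t)).
Local Notation nu := (classical_measure q01 a b c d t).
Local Notation h := (GThetaV q (a, b, c, d, t)).
Local Notation Gt := (Gtau q (a, b, c, d, t)).

Let w0 n : 0 < w n. Proof. exact: (wminus_gt0 q01 adm). Qed.

Let xm_neq0 n : xm n != 0.
Proof. by rewrite lt_eqF// (lt_trans (xminus_lt q01 adm n))// oppr_lt0. Qed.

Let pole_le (j : int) : pole_minus q j (a, b, c, d, t) < -1 -> j <= k.
Proof. by rewrite /pole_minus (pole_minus_lt q01 adm). Qed.

Lemma norm2sq_minus f : cmeasurable f ->
  norm2sq (minus_part q (a, b, c, d, t)) f =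
  (wnorm w (fun n => f (xm n)%:C) + wnorm w (fun n => f ((xm n)%:C^-1)%R))%E.
Proof.
move=> mf; rewrite /norm2sq (ge0_integral_minus_part _ _ pole_le); first last.
- by move=> z; exact: sqr_cabs_ge0.
- exact: measurable_sqr_cabs.
rewrite /wnorm -nneseriesD; try by move=> n _ _; rewrite lee_fin mulr_ge0 ?sqr_ge0// ltW.
by apply: eq_eseriesr => n _; rewrite -EFinD -EFinM -EFinD mulrDr.
Qed.

Lemma norm2sq_AW f : cmeasurable f -> norm2sq m f = (norm2sq nu f +
  (wnorm w (fun n => f (xm n)%:C) + wnorm w (fun n => f ((xm n)%:C^-1)%R)))%E.
Proof.
move=> mf; rewrite -norm2sq_minus// /AWmeasure.
by rewrite (norm2sq_add _ (measure_add _ _) mf) !norm2sq_add// addeA.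
Qed.

Let minus_atom A n : measurable A -> minus_part q (a, b, c, d, t) A = 0%E ->
  ~ A (xm n)%:C /\ ~ A (xm n)%:C^-1.
Proof.
move=> mA A0.
have iA : measurable_fun setT (fun z : R[i] => (\1_A z)%:E : \bar R).
  by apply/measurable_EFinP; exact: measurable_indic.
have iA0 z : (0 <= ((\1_A z)%:E : \bar R))%E by rewrite lee_fin.
have := ge0_integral_minus_part iA iA0 pole_le; rewrite integral_indic// setIT A0 => E.
pose F n := ((minus_weight q (a, b, c, d, t) (k - n%:Z))%:E *
    ((\1_A (pole_minus q (k - n%:Z) (a, b, c, d, t))%:C)%:E +
     (\1_A (pole_minus q (k - n%:Z) (a, b, c, d, t))%:C^-1%R)%:E) : \bar R)%E.
have F0 i : (0 <= F i)%E.
  by rewrite mule_ge0 ?adde_ge0// lee_fin minus_weight_ge0.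
have Fn : F n = 0%E.
  apply/eqP; rewrite eq_le F0 andbT [leRHS]E.
  have := @nneseries_lim_ge R F xpredT 0 n.+1 (fun i _ _ => F0 i).
  apply: le_trans; rewrite big_nat_recr//= leeDr//.
  by apply: sume_ge0 => i _; exact: F0.
have wn := w0 n; move: Fn; rewrite /F -/(w n) -/(xm n) !indicE -EFinD -EFinM => -[] /eqP.
rewrite mulf_eq0 gt_eqF//= paddr_eq0 ?ler0n// !pnatr_eq0 !eqb0 => /andP[h1 h2].
by split => /mem_set; apply/negP.
Qed.

(** The points of D_- and their inverses are atoms of positive mass, so no null set contains them.
    This turns the almost everywhere symmetry of f into equality at each of these points. *)
Lemma AW_ae (P : R[i] -> Prop) : {ae m, forall x, P x} ->
  {ae nu, forall x, P x} /\ forall n, P (xm n)%:C /\ P (xm n)%:C^-1.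
Proof.
move=> [A [mA A0 PA]].
have E : m A = (circle_part q01 (a, b, c, d, t) A + (plus_part q (a, b, c, d, t) A +
    minus_part q (a, b, c, d, t) A))%E
  by apply: etrans; [exact: measure_addE|congr (_ + _)%E; exact: measure_addE].
have add0 (u v z : \bar R) : (0 <= u)%E -> (0 <= v)%E -> (0 <= z)%E -> (u + (v + z) = 0)%E ->
    [/\ u = 0%E, v = 0%E & z = 0%E].
  move=> u0 v0 z0 /eqP; rewrite padde_eq0 ?adde_ge0// => /andP[/eqP -> ].
  by rewrite padde_eq0// => /andP[/eqP -> /eqP ->].
have [cA pA mA0] := add0 _ _ _ (measure_ge0 _ A) (measure_ge0 _ A) (measure_ge0 _ A) (etrans (esym E) A0).
split.
  exists A; split => //.
  have -> : nu A = (circle_part q01 (a, b, c, d, t) A + plus_part q (a, b, c, d, t) A)%E by exact: measure_addE.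
  by rewrite cA pA adde0.
move=> n; have [h1 h2] := minus_atom n mA mA0.
by split; apply: contrapT => nP; [apply: h1|apply: h2]; exact: PA.
Qed.

Let theta_qz (j : int) : theta q (q ^ j)%:C = 0.
Proof.
have [e _ he] := theta_expz q01 (- j); have := he 1 (oner_neq0 _).
rewrite div1r -fmorphV invr_expz opprK => ->.
by rewrite (thetaE q01 1) subrr !mul0r mulr0.
Qed.

Lemma GThetaV_xminus n : h (xm n)%:C = 0 /\ h (xm n)%:C^-1 = 0.
Proof.
have D0 : d * t != 0 by have := xm_neq0 n; rewrite /xminus mulf_eq0 negb_or => /andP[].
have th0 : theta q ((d * t)%:C / (xm n)%:C) = 0.
  rewrite -fmorphV -rmorphM/= /xminus invfM mulrA mulfV// mul1r invr_expz.
  exact: theta_qz.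
by split; rewrite /GThetaV ?invrK th0 ?mul0r ?mulr0 ?mul0r.
Qed.

Lemma Gtau_xminus n : Gt (xm n)%:C = (g n)%:C /\ Gt (xm n)%:C^-1 = (g n)%:C.
Proof.
have E : Gt (xm n)%:C = (g n)%:C.
  rewrite /Gtau /Gfun /gminus /gtau -fmorphV -!rmorphM/= !qpoch_real// -rmorphM.
  by rewrite -fmorphV.
by split=> //; rewrite Gtau_inv.
Qed.

Let jouk_xminus n : (xm n)%:C + (xm n)%:C^-1 = (y n)%:C /\
  (xm n)%:C^-1 + (xm n)%:C^-1^-1 = (y n)%:C.
Proof.
have E : (xm n)%:C + (xm n)%:C^-1 = (y n)%:C.
  by rewrite -fmorphV -rmorphD/= (xminusE q01 adm).
by split=> //; rewrite invrK addrC.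
Qed.

Let cm_jouk d' (T : measurableType d') (F : T -> R[i]) : cmeasurable F ->
  cmeasurable (fun x => F x + (F x)^-1).
Proof. by move=> mF; apply: cmeasurableD => //; exact: cmeasurableV. Qed.

Let cm_poly d' (T : measurableType d') (F : T -> R[i]) (H : R[i] -> R[i]) (p : {poly R[i]}) :
  cmeasurable F -> cmeasurable (H \o F) -> cmeasurable (fun x => p.[F x + (F x)^-1] * H (F x)).
Proof.
by move=> mF mH; apply: cmeasurableM => //; apply: cmeasurable_horner; exact: cm_jouk.
Qed.

Let mj : cmeasurable (@jsec R).
Proof. by apply: measurable_cmeasurable; exact: measurable_jsec. Qed.

Lemma AW_dense : q ^+ 2 <= t2 ->
  dense_in_L2plus m (sum_space (Vcl q (a, b, c, d, t)) (Vstr q (a, b, c, d, t))).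
Proof.
move=> qt f [mf fV foo] e e0.
have cf := measurable_cmeasurable mf; have e4 : 0 < e / 4 by rewrite divr_gt0.
have [fVnu fVx] := AW_ae fV.
have fx n : f (xm n)%:C^-1 = f (xm n)%:C by have [-> _] := fVx n.
have := foo; rewrite norm2sq_AW//; have -> : (fun n => f ((xm n)%:C^-1)%R) = (fun n => f (xm n)%:C) by apply/funext.
move=> foo'.
have fm : (wnorm w (fun n => f (xm n)%:C) < +oo)%E.
  apply: le_lt_trans foo'; rewrite (le_trans _ (leeDr _ (norm2sq_ge0 _ _)))//.
  by rewrite leeDl// wnorm_ge0// => n; exact: ltW.
have fnu : (norm2sq nu f < +oo)%E.
  apply: le_lt_trans foo'; rewrite leeDl// adde_ge0// wnorm_ge0// => n; exact: ltW.
have [p hp] := strange_dense q01 adm qt fm e4.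
pose v x := p.[x + x^-1] * Gt x.
have cid := @cmeasurable_id R.
have cv : cmeasurable v.
  by apply: (@cm_poly _ _ id) => //; exact: cmeasurable_Gtau.
have cvj : cmeasurable (v \o @jsec R).
  by apply: (@cm_poly _ _ (@jsec R)) => //; exact: cmeasurable_Gtau.
(* What is left for [Vcl]: [v] is already settled on D_-, and off D_- it is bounded, so that u is
   still square integrable there. *)
pose u x := f x - v x.
have cu : cmeasurable u by exact: cmeasurableB.
have cuj : cmeasurable (u \o @jsec R).
  apply: cmeasurableB => //; apply: measurable_cmeasurable.
  by apply: measurableT_comp => //; exact: measurable_jsec.
have [M [H hK]] := classical_support_facts q01 adm.
have aeK := ae_classical_support q01 adm.
have vV x : v x^-1 = v x by rewrite /v invrK Gtau_inv addrC.
have uV : {ae nu, forall x, u x = u x^-1}.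
  by apply: filterS fVnu => x; rewrite /u vV => <-.
have [HG hG] := Gtau_bounded q01 adm.
have [BP hBP] := cabs_horner_le p M.
have nuoo := classical_measure_finite q01 adm.
have unu : (norm2sq nu u < +oo)%E.
  have := norm2sqD_le nu cf (cmeasurableN cv); move=> /le_lt_trans; apply.
  have -> : norm2sq nu (fun x => - v x) = norm2sq nu v.
    by apply: eq_integral => x _; rewrite cabsN.
  rewrite lte_add_pinfty// lte_mul_pinfty ?lee_fin//.
  apply: (@le_lt_trans _ _ (\int[nu]_x (cst ((BP * HG) ^+ 2)%:E x))%E).
    apply: ae_ge0_le_integral => //.
    - by move=> x _; exact: sqr_cabs_ge0.
    - exact: measurable_sqr_cabs.
    - by move=> x _; rewrite lee_fin sqr_ge0.
    - apply: filterS aeK => x Kx _; rewrite lee_fin.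
      have [cx Mx _ _ _] := hK _ Kx.
      have B1 : cabs p.[x + x^-1] <= BP by apply: hBP; rewrite jouk_real// cabsR.
      have B2 := hG _ Kx.
      rewrite lerXn2r ?nnegrE ?cabs_ge0 ?mulr_ge0 ?(le_trans (cabs_ge0 _) B1) ?(le_trans (cabs_ge0 _) B2)//.
      by rewrite cabsM ler_pM ?cabs_ge0.
  by rewrite integral_cst// lte_mul_pinfty ?lee_fin ?sqr_ge0.
have e2 : 0 < e / 2 by rewrite divr_gt0.
have ch : cmeasurable h by exact: (cmeasurable_GThetaV q01 a b c d t cid).
have [pc hpc] := weighted_poly_dense nuoo ch (filterS hK aeK) cu cuj uV unu e2.
pose vc x := pc.[x + x^-1] * h x.
have cvc : cmeasurable vc by apply: (@cm_poly _ _ id).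
exists (vc \+ v).
  by exists vc; [exists pc|exists v; [exists p|]].
rewrite norm2sq_AW; last by apply: cmeasurableB => //; exact: cmeasurableD.
have -> : norm2sq nu (f \- (vc \+ v)) = norm2sq nu (fun x => u x - pc.[x + x^-1] * h x).
  by congr norm2sq; apply/funext => x; rewrite /u /vc /=; ring.
have E1 : (fun n => (f \- (vc \+ v)) (xm n)%:C) = (fun n => f (xm n)%:C - p.[(y n)%:C] * (g n)%:C).
  apply/funext => n; have [h1 _] := GThetaV_xminus n; have [g1 _] := Gtau_xminus n.
  by have [j1 _] := jouk_xminus n; rewrite /= /vc /v h1 g1 j1 mulr0 add0r.
have E2 : (fun n => (f \- (vc \+ v)) (xm n)%:C^-1) = (fun n => f (xm n)%:C - p.[(y n)%:C] * (g n)%:C).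
  apply/funext => n; have [_ h1] := GThetaV_xminus n; have [_ g1] := Gtau_xminus n.
  by have [_ j1] := jouk_xminus n; rewrite /= /vc /v h1 g1 j1 mulr0 add0r fx.
rewrite E1 E2.
have -> : e%:E = ((e / 2)%:E + ((e / 4)%:E + (e / 4)%:E))%E.
  by rewrite -!EFinD; congr _%:E; field.
by apply: lteD => //; exact: lteD.
Qed.

Let meq (x0 : R[i]) : measurable_fun setT (fun x : R[i] => x == x0).
Proof.
have [mr mi] := @cmeasurable_id R.
apply: (measurable_fun_bool true).
rewrite setTI (_ : _ @^-1` _ = ((fun x : R[i] => complex.Re x) @^-1` [set complex.Re x0] `&`
  (fun x : R[i] => complex.Im x) @^-1` [set complex.Im x0])).
  by apply: measurableI; rewrite -[X in measurable X]setTI; [exact: mr|exact: mi].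
apply/seteqP; split => x /=; first by move=> /eqP ->.
by case: x x0 => [u1 u2] [v1 v2] /= [-> ->]; rewrite eqxx.
Qed.

(** The indicator of x_0 and 1/x_0 restricts to delta_0 on D_-, where an approximant shows only its
    [Vstr] component; [strange_obstruction] then bounds the error from below. *)
Lemma AW_not_dense : t2 < q ^+ 2 ->
  ~ dense_in_L2plus m (sum_space (Vcl q (a, b, c, d, t)) (Vstr q (a, b, c, d, t))).
Proof.
move=> tq dense; have [e e0 he] := strange_obstruction q01 adm tq.
pose x0 : R[i] := (xm 0)%:C.
pose f (x : R[i]) : R[i] := if (x == x0) || (x == x0^-1) then 1 else 0.
have mf : measurable_fun setT f.
  by apply: measurable_fun_ifT => //; apply: measurable_or; exact: meq.
have cf := measurable_cmeasurable mf.
have fV x : f x = f x^-1.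
  rewrite /f (inj_eq invr_inj) -[x^-1 == x0](inj_eq invr_inj) invrK orbC.
  by [].
have fx n : f (xm n)%:C = (n == 0%N)%:R.
  rewrite /f; have [->|n0] := eqVneq n 0%N; first by rewrite /x0 eqxx.
  rewrite ifF//; apply/negbTE/negP => E.
  suff : (y n)%:C = (y 0)%:C :> R[i].
    by move=> /complexI/eqP; apply/negP; apply: ylat_inj => //; case/andP: (xzero_itv q01 adm).
  have [<- _] := jouk_xminus n; have [<- _] := jouk_xminus 0.
  case/orP: E => /eqP ->; first by [].
  by rewrite invrK addrC.
have fx' n : f (xm n)%:C^-1 = (n == 0%N)%:R by rewrite -fV fx.
have cn n : cabs ((n == 0%N)%:R : R[i]) = (n == 0%N)%:R.
  by case: (n == 0%N); [have := cabsR (1 : R); rewrite normr1|have := cabsR (0 : R); rewrite normr0].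
have w1 : (wnorm w (fun n => (n == 0%N)%:R) < +oo)%E.
  apply: (@le_lt_trans _ _ (w 0)%:E); last exact: ltry.
  apply: wnorm_le => [n|[|L]]; first exact: ltW.
    by rewrite big_ord0 ltW.
  rewrite (eq_bigr (fun n : 'I_L.+1 => if n == ord0 then w 0 else 0)).
    by rewrite -big_mkcond big_pred1_eq.
  move=> n _; rewrite cn; case: (n =P ord0) => [->|n0]; first by rewrite expr1n mulr1.
  rewrite (_ : (n : nat) == 0%N = false) ?expr0n ?mulr0//.
  by apply/negbTE/eqP => n1; apply: n0; exact/val_inj.
have f1 x : cabs (f x) ^+ 2 <= 1.
  by rewrite /f; case: ifP => _; rewrite ?(cabsR 1) ?(cabsR 0) ?normr1 ?normr0 ?expr1n ?expr0n.
have nuoo := classical_measure_finite q01 adm.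
have L2f : L2plus m f.
  split => //; first exact: aeW.
  rewrite norm2sq_AW//; have -> : (fun n => f (xm n)%:C) = (fun n => (n == 0%N)%:R) by apply/funext.
  have -> : (fun n => f ((xm n)%:C^-1)%R) = (fun n => (n == 0%N)%:R) by apply/funext.
  apply: lte_add_pinfty; last exact: lte_add_pinfty.
  apply: (@le_lt_trans _ _ (\int[nu]_x (cst 1%E x))%E).
    apply: ge0_le_integral => //.
    - by move=> x _; exact: sqr_cabs_ge0.
    - exact: measurable_sqr_cabs.
    - by move=> x _; rewrite lee_fin.
  by rewrite integral_cst// mul1e.
have [v [vc [pc vcE] [vs [p vsE] ->]]] := dense _ L2f _ e0.
have cid := @cmeasurable_id R.
have ch : cmeasurable h by exact: (cmeasurable_GThetaV q01 a b c d t cid).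
have cG : cmeasurable Gt by exact: (cmeasurable_Gtau q01 a b c d t cid).
rewrite norm2sq_AW; last first.
  apply: cmeasurableB => //; apply: cmeasurableD; [rewrite vcE|rewrite vsE];
    exact: (@cm_poly _ _ id).
have E1 : (fun n => (f \- (vc \+ vs)) (xm n)%:C) = (fun n => (n == 0%N)%:R - p.[(y n)%:C] * (g n)%:C).
  apply/funext => n; have [h1 _] := GThetaV_xminus n; have [g1 _] := Gtau_xminus n.
  by have [j1 _] := jouk_xminus n; rewrite /= vcE vsE h1 g1 j1 mulr0 add0r fx.
rewrite E1 => /(le_lt_trans _) lt.
suff : (e%:E < e%:E)%E by rewrite ltxx.
apply: lt; apply: (le_trans (he p)).
rewrite addeCA leeDl// adde_ge0// ?norm2sq_ge0// wnorm_ge0// => n; exact: ltW.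
Qed.

End AW_density.

(** * Duality *)

Section duality.
Context {R : realType} (q : R) (q01 : 0 < q < 1).
Implicit Types (beta : params R).

Let q0 : 0 < q. Proof. by case/andP: q01. Qed.
Let q1 : q < 1. Proof. by case/andP: q01. Qed.

Section fixed_parameters.
Context (a b c d t : R) (adm : admissible q (a, b, c, d, t)).

Local Notation k := (kexp q (a, b, c, d, t)).
Local Notation a' := (atilde q (a, b, c, d, t)).

Let signs : [/\ 0 < a, 0 < b, 0 < c, 0 < d & t < 0].
Proof.
case: adm => t0 [b0 c0 ba ca] ad _; have a0 : 0 < a by exact: lt_le_trans ba.
split => //; have : 0 < d / q by exact: lt_trans ad.
by rewrite pmulr_lgt0 ?invr_gt0.
Qed.

Let atilde_gt0 : 0 < a'.
Proof.
have [a0 b0 c0 d0 _] := signs.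
by rewrite /atilde sqrtr_gt0 !mulr_gt0 ?invr_gt0.
Qed.

Let atilde_sqr : a' ^+ 2 = q^-1 * (a * b * c * d).
Proof.
have [a0 b0 c0 d0 _] := signs.
by rewrite sqr_sqrtr// ltW// !mulr_gt0 ?invr_gt0.
Qed.

Lemma dual_boundE : dual_bound q (a, b, c, d, t) <-> q ^+ 2 <= tau2 q a b c d t.
Proof.
have [a0 b0 c0 d0 t0] := signs.
have E : `|a' * t * q ^ k| ^+ 2 = tau2 q a b c d t / q ^+ 2.
  rewrite /tau2 /xzero !real_normK ?num_real// !exprMn atilde_sqr.
  by field; rewrite !gt_eqF.
rewrite /dual_bound -[q ^+ 2 <= _](ler_pM2r (x := (q ^+ 2)^-1)) ?invr_gt0 ?exprn_gt0//.
rewrite divff ?expf_neq0 ?gt_eqF// -E.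
by rewrite -[X in X <= _ ^+ 2](expr1n _ 2) ler_pXn2r ?nnegrE.
Qed.

(** Duality exchanges the constraints. For the dual parameters, [b <= a] becomes [q <= cd],
    [q <= bd] becomes [c <= a], the product [ab] is unchanged, and [a < d/q] becomes [bc < 1], a
    consequence of [c <= a] and [ab < 1]. *)
Lemma dual_admissible : admissible q (dual q (a, b, c, d, t)).
Proof.
have [a0 b0 c0 d0 t0] := signs; case: adm => _ [_ _ ba ca] ad [bd cd] [ab ac].
have A0 := atilde_gt0; have A2 := atilde_sqr; have An : a' != 0 by rewrite gt_eqF.
rewrite /dual; move: (a') A0 A2 An => A A0 A2 An.
have bc : b * c < 1 by rewrite (le_lt_trans _ ab)// mulrC ler_pM2r.
split.
- by rewrite invr_lt0 nmulr_llt0// mulr_gt0.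
- split; rewrite ?divr_gt0 ?mulr_gt0// ler_pdivrMr// -expr2 A2 ler_pdivlMl// mulrC.
    by rewrite [leRHS](_ : _ = a * b * (c * d)) ?ler_pM2l ?mulr_gt0//; ring.
  by rewrite [leRHS](_ : _ = a * c * (b * d)) ?ler_pM2l ?mulr_gt0//; ring.
- rewrite -mulrA -invfM ltr_pdivlMr ?mulr_gt0// mulrA -expr2 A2.
  rewrite (_ : q^-1 * _ * q = a * d * (b * c)) ?gtr_pMr ?mulr_gt0//.
  by field; rewrite gt_eqF.
- have E1 : a * b / A * (a * d / A) = a * q / c.
    rewrite (_ : _ * _ = a * b * (a * d) / A ^+ 2); last by field.
    by rewrite A2; field; rewrite !gt_eqF.
  have E2 : a * c / A * (a * d / A) = a * q / b.
    rewrite (_ : _ * _ = a * c * (a * d) / A ^+ 2); last by field.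
    by rewrite A2; field; rewrite !gt_eqF.
  by rewrite E1 E2 !ler_pdivlMr// ![q * _]mulrC !ler_pM2r.
- by rewrite ![A * _]mulrC !divfK.
Qed.

(** The dual of [d t] is 1/(atilde t) and the dual of [atilde t] is 1/(d t). With k' the dual
    exponent, the bound and |atilde t| < q^k' give q^(k+k') > 1, hence k + k' <= -1 by integrality.
    Together with |d t| q^(k+1) <= 1 this yields |d t| <= q^k', the dual bound. *)
Lemma dual_bound_dual : dual_bound q (a, b, c, d, t) ->
  dual_bound q (dual q (a, b, c, d, t)).
Proof.
have [a0 b0 c0 d0 t0] := signs; have adm' := dual_admissible.
have A0 := atilde_gt0; have An : a' != 0 by rewrite gt_eqF.
have kP := kexpP q01 adm k; rewrite eqxx in kP; have /andP[_ k2] := kP.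
have := kexpP q01 adm' (kexp q (dual q (a, b, c, d, t))); rewrite eqxx.
have E : atilde q (dual q (a, b, c, d, t)) = a.
  rewrite /dual {1}/atilde.
  have -> : a' * (a * b / a') * (a * c / a') * (a * d / a') = a ^+ 3 * b * c * d / a' ^+ 2.
    by field.
  rewrite atilde_sqr.
  have -> : q^-1 * (a ^+ 3 * b * c * d / (q^-1 * (a * b * c * d))) = a ^+ 2.
    by field; rewrite !gt_eqF.
  by rewrite sqrtr_sqr ger0_norm// ltW.
rewrite /dual_bound /dual -/(dual q (a, b, c, d, t)).
move: E; rewrite /dual => ->.
set k' := kexp q _.
have [an dn tn] : [/\ a != 0, d != 0 & t != 0] by split; rewrite ?(gt_eqF a0) ?(gt_eqF d0) ?(lt_eqF t0).
have -> : a * d / a' * (a * d * t)^-1 = (a' * t)^-1 by field; rewrite An an dn tn.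
have -> : a * (a * d * t)^-1 = (d * t)^-1 by field; rewrite an dn tn.
have nq (j : int) : `|q ^ j| = q ^ j by rewrite ger0_norm// exprz_ge0// ltW.
move: k2; rewrite !normrM !normfV !normrM !nq.
have At : 0 < `|a'| * `|t| by rewrite mulr_gt0// normr_gt0 ?An ?dn ?tn.
have Dt : 0 < `|d| * `|t| by rewrite mulr_gt0// normr_gt0 ?An ?dn ?tn.
have qz (j : int) : 0 < q ^ j by rewrite exprz_gt0.
move=> k2 /andP[h _] hb.
have lt1 : 1 < q ^ k * q ^ k'.
  rewrite mulrC ltr_pdivlMr// mul1r in h.
  apply: (le_lt_trans hb); rewrite [ltRHS]mulrC ltr_pM2r//.
have kk : k + k' <= -1.
  rewrite leNgt; apply/negP => kk; have : 0 <= k + k' by move: kk; clear; lia.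
  move=> kk0; move: lt1; rewrite -expfzDr ?gt_eqF// ltNge => /negP; apply.
  by case: (k + k') kk0 => // n _; rewrite -exprnP exprn_ile1// ltW.
rewrite mulrC ler_pdivlMr// mul1r.
have : (`|d| * `|t|) * q ^ k * q <= 1 by rewrite -ler_pdivlMr// div1r.
rewrite -mulrA -ler_pdivlMr ?mulr_gt0// => /le_trans; apply.
rewrite div1r -[X in q ^ k * X]expr1z -expfzDr ?gt_eqF// invr_expz.
have [n ->] : exists n : nat, - (k + 1) = k' + n%:Z.
  by exists `|- (k + 1) - k'|%N; move: kk; clear; lia.
by rewrite expfzDr ?gt_eqF// ler_piMr ?(ltW (qz _))// exprn_ile1// ltW.
Qed.

End fixed_parameters.

(** Here d t = -1/q, so k = 0, and atilde = q: the bound holds with equality. *)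
Lemma dual_bound_nonempty :
  admissible q (q, q, q, 1, - q^-1) /\ dual_bound q (q, q, q, 1, - q^-1).
Proof.
have adm : admissible q (q, q, q, 1, - q^-1).
  split; rewrite ?oppr_lt0 ?invr_gt0 ?q0 ?mulr1//.
    by rewrite div1r (lt_trans q1)// invf_gt1.
  by rewrite mulr_ilt1 ?(ltW q0).
split=> //; have := kexpP q01 adm 0; rewrite expr0z mulr1 mul1r normrN ger0_norm ?invr_ge0 ?(ltW q0)//.
rewrite lexx andbT invf_gt1// q1 => /esym/eqP k0.
rewrite /dual_bound -k0 expr0z mulr1 /atilde.
have -> : q^-1 * (q * q * q * 1) = q ^+ 2 by field; rewrite gt_eqF.
by rewrite sqrtr_sqr [`|q|]ger0_norm ?(ltW q0)// mulrN normrN mulfV ?normr1// gt_eqF.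
Qed.

End duality.

Theorem proposition6p7 (R : realType) (q : R) (q01 : 0 < q < 1) :
  [/\ forall beta : params R, admissible q beta ->
        dense_in_L2plus (AWmeasure q01 beta)
          (sum_space (Vcl q beta) (Vstr q beta)) <->
        dual_bound q beta,
      [set beta : params R | admissible q beta /\ dual_bound q beta] !=set0 &
      forall beta : params R, admissible q beta /\ dual_bound q beta ->
        admissible q (dual q beta) /\ dual_bound q (dual q beta)].
Proof.
split.
- case=> [[[[a b] c] d] t] adm; rewrite (dual_boundE q01 adm); split.
    move=> dense; rewrite leNgt; apply/negP => /(AW_not_dense (q01 := q01) adm); exact.
  exact: AW_dense.
- by exists (q, q, q, 1, - q^-1); exact: dual_bound_nonempty.
- case=> [[[[a b] c] d] t] [adm bound]; split; first exact: dual_admissible.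
  exact: dual_bound_dual.
Qed.
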